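(* Let $m\ge0$ and let $L_m$ be the $m$-loop quiver with an arbitrary duality structure $(s,\tau_1,\dots,\tau_m)$. For each admissible $e\in\mathbb{Z}_{\ge0}$ let $\mathcal{H}_{L_m}(e)\subset\mathcal{H}_{L_m}$ be the subalgebra generated by the invariants of the $e$-twisted $\mathbb{Z}_2$-action on $V_{L_m}$, and let $W^{\mathsf{prim}}_{L_m,e}\subset\mathcal{M}_{L_m,e}$ be a graded complement of $(\mathcal{H}_{L_m,+}\star\mathcal{M}_{L_m})\cap\mathcal{M}_{L_m,e}$. Then the action map $$\bigoplus_{e}\mathcal{H}_{L_m}(e)\otimes W^{\mathsf{prim}}_{L_m,e}\longrightarrow\mathcal{M}_{L_m},\qquad f\otimes w\mapsto f\star w,$$ is an isomorphism of graded vector spaces, and for each $e$ its restriction to the summand $\mathcal{H}_{L_m}(e)\otimes W^{\mathsf{prim}}_{L_m,e}$ is an isomorphism of $\mathcal{H}_{L_m}(e)$-modules onto its image.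
   Context: $L_m$ has one node and $m$ loops; its involution $\sigma$ fixes the node and all loops, and a duality structure is a choice of signs $s,\tau_1,\dots,\tau_m\in\{\pm1\}$. Let $\tau_+$, $\tau_-$ be the numbers of $\tau_k$ equal to $+1$, $-1$, and let $\tau_s$ be $\tau_+$ if $s=1$ and $\tau_-$ if $s=-1$. Put $\chi(d,d')=(1-m)dd'$ and $\mathcal{E}(d)=\frac{d(d-s)}{2}-\sum_{k=1}^m\frac{d(d+\tau_ks)}{2}$. CoHA. $\mathcal{H}_{L_m}=\bigoplus_{d\ge0}H^\bullet_{\mathsf{GL}_d}(\mathsf{Mat}_{d\times d}^m)$, $\mathcal{H}_{L_m,d}=\mathbb{Q}[x_1,\dots,x_d]^{\mathfrak{S}_d}$; a homogeneous polynomial of polynomial degree $n$ has degree $2n+\chi(d,d)$. For $f_1\in\mathcal{H}_{L_m,d'}$, $f_2\in\mathcal{H}_{L_m,d''}$, $$f_1\cdot f_2=\sum_{\pi}\pi\Big(f_1(x'_1,\dots,x'_{d'})f_2(x''_1,\dots,x''_{d''})\prod_{l=1}^{d''}\prod_{k=1}^{d'}(x''_l-x'_k)^{m-1}\Big),$$ the sum being over $2$-shuffles of type $(d',d'')$ acting by permuting variables, with $x'_k=x_k$, $x''_l=x_{d'+l}$. $\mathcal{H}_{L_m}$ is supercommutative for the $\mathbb{Z}_2$-grading induced by degree. $\mathcal{H}_{L_m,+}=\bigoplus_{d>0}\mathcal{H}_{L_m,d}$. CoHM. $\mathcal{M}_{L_m}=\bigoplus_eH^\bullet_{\mathsf{G}_e}(R^\sigma_e)$,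 where $e\ge0$ (with $e$ even if $s=-1$; these $e$ are called admissible), $\mathsf{G}_e=\mathsf{O}_e(\mathbb{C})$ if $s=1$ and $\mathsf{Sp}_e(\mathbb{C})$ if $s=-1$, and $R^\sigma_e$ is the space of $m$-tuples of endomorphisms $A_k$ of $\mathbb{C}^e$ with $\langle A_kx,y\rangle=\tau_k\langle x,A_ky\rangle$. Then $\mathcal{M}_{L_m,e}=\mathbb{Q}[z_1^2,\dots,z_{\lfloor e/2\rfloor}^2]^{\mathfrak{S}_{\lfloor e/2\rfloor}}$; a homogeneous polynomial of degree $n$ in the $z_j$ has degree $2n+\mathcal{E}(e)$. For $f\in\mathcal{H}_{L_m,d}$, $g\in\mathcal{M}_{L_m,e}$, $f\star g\in\mathcal{M}_{L_m,2d+e}$ is $$2^{(\tau_s-\frac{1-s}{2})d}\sum_\pi\pi\Big(f(x_1,\dots,x_d)g(z_1,\dots,z_{\lfloor e/2\rfloor})\prod_{i=1}^d(-x_i)^{N}\Big(\prod_{1\le i<j\le d}(-x_i-x_j)\prod_{i=1}^d\prod_{j=1}^{\lfloor e/2\rfloor}(x_i^2-z_j^2)\Big)^{m-1}\Big),$$ the sum being over $\mathbb{Z}_2^d\times\{2\text{-shuffles of type }(d,\lfloor e/2\rfloor)\}$, where $\mathbb{Z}_2^d$ acts by sign changes of $x_1,\dots,x_d$ and the shuffles permute the ordered set of variables $(x_1,\dots,x_d,z_1,\dots,z_{\lfloor e/2\rfloor})$, which are identified with the $d+\lfloor e/2\rfloor$ variables of $\mathcal{M}_{L_m,2d+e}$.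 Here $N=m+\tau_+-1$ if $s=1$ and $e$ is odd, $N=\tau_--1$ if $s=-1$, and $N=\tau_+$ if $s=1$ and $e$ is even. The subalgebras $\mathcal{H}_{L_m}(e)$. By a theorem of Efimov there is a graded subspace $V_{L_m}=\bigoplus_{d\ge1}V^{\mathsf{prim}}_{d}\cdot\mathbb{Q}[\sigma_d]\subset\mathcal{H}_{L_m}$, with $\sigma_d=x_1+\dots+x_d$ and $V_d^{\mathsf{prim}}\subset\mathcal{H}_{L_m,d}$ graded and finite dimensional, such that the induced map from the free supercommutative algebra $\mathrm{Sym}(V_{L_m})\to\mathcal{H}_{L_m}$ is an algebra isomorphism; here $V_d^{\mathsf{prim}}\cdot\mathbb{Q}[\sigma_d]$ means ordinary multiplication of polynomials and is isomorphic to $V_d^{\mathsf{prim}}\otimes\mathbb{Q}[\sigma_d]$. Let $S_{\mathcal{H}}(f)(x_1,\dots,x_d)=f(-x_1,\dots,-x_d)$. The $e$-twisted $\mathbb{Z}_2$-action is $f\mapsto(-1)^{\chi(e,d)+\mathcal{E}(d)}S_{\mathcal{H}}(f)$ for $f\in\mathcal{H}_{L_m,d}$; it preserves $V_{L_m}$, and $\mathcal{H}_{L_m}(e)$ is the subalgebra of $\mathcal{H}_{L_m}$ generated by the invariants of this action on $V_{L_m}$. In tensor products with $\mathcal{M}_{L_m}$-components, $\mathcal{H}_{L_m,d}$ is given $e$-degree $2d$. *)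

(* Defs.v *)
From HB Require Import structures.
From mathcomp Require Import fingroup perm.
From mathcomp Require Import all_boot all_order all_algebra generic_quotient.
From mathcomp Require Import ring_quotient.
From mathcomp Require Import finmap boolp classical_sets functions cardinality fsbigop.
From mathcomp Require Import mpoly.

Set Implicit Arguments.
Unset Strict Implicit.
Unset Printing Implicit Defensive.

Import GRing.Theory Num.Theory.
Local Open Scope classical_set_scope.
Local Open Scope ring_scope.
Local Open Scope quotient_scope.

Section Subspaces.
Variable V : lmodType rat.

Definition lspan (A : set V) : {pred V} := [pred x |
  `[< exists n (c : 'I_n -> rat) (v : 'I_n -> V),
        (forall i, A (v i)) /\ x = \sum_i c i *: v i >]].

Lemma lspan_submod_closed A : submod_closed (lspan A).
Proof.
split=> [|a x y].
  apply/asboolP; exists 0%N, (fun=> 0), (fun=> 0).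
  by split=> [[]//|]; rewrite big_ord0.
move=> /asboolP[n [c [v [Av ->]]]] /asboolP[n' [c' [v' [Av' ->]]]].
apply/asboolP; exists (n + n')%N.
exists (fun i => match fintype.split i with inl j => a * c j | inr j => c' j end).
exists (fun i => match fintype.split i with inl j => v j | inr j => v' j end).
split=> [i|]; first by case: (fintype.split i).
rewrite big_split_ord scaler_sumr /=; congr (_ + _); apply: eq_bigr => i _.
  by rewrite (unsplitK (inl i)) scalerA.
by rewrite (unsplitK (inr i)).
Qed.

HB.instance Definition _ A :=
  GRing.isSubmodClosed.Build rat V (lspan A) (lspan_submod_closed A).

Definition subsp (S : submodClosed V) : Type := {x : V | x \in S}.

Variable S : submodClosed V.
Definition insp x (Sx : x \in S) : subsp S := exist _ x Sx.

HB.instance Definition _ := [isSub of subsp S for @sval V (fun x => x \in S)].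
HB.instance Definition _ := [Choice of subsp S by <:].
HB.instance Definition _ := [SubChoice_isSubLmodule of subsp S by <:].

End Subspaces.

Section DirectSums.
Variables (I : choiceType) (V : I -> lmodType rat).

Definition fin_supp (f : forall i, V i) : bool :=
  `[< finite_set [set i | f i <> 0] >].

Record dsum := DSum { dsum_val :> forall i, V i; dsum_fin : fin_supp dsum_val }.

HB.instance Definition _ := [isSub for dsum_val].
HB.instance Definition _ := gen_eqMixin dsum.
HB.instance Definition _ := gen_choiceMixin dsum.

Lemma dsumP (f g : dsum) : (forall i, f i = g i) -> f = g.
Proof. by move=> fg; apply/val_inj/functional_extensionality_dep. Qed.

Lemma fin_supp0 : fin_supp (fun=> 0).
Proof.
apply/asboolP; apply: (@sub_finite_set _ _ set0) => [i /=|]; first by [].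
exact: finite_set0.
Qed.

Lemma fin_suppD (f g : dsum) : fin_supp (fun i => f i + g i).
Proof.
case: f g => f /asboolP ff [g /asboolP fg] /=; apply/asboolP.
have ffg : finite_set ([set i | f i <> 0] `|` [set i | g i <> 0]).
  by rewrite finite_setU.
apply: sub_finite_set ffg => i /= nz.
have [f0|] := pselect (f i = 0); last by left.
by right => g0; apply: nz; rewrite f0 g0 addr0.
Qed.

Lemma fin_suppZ a (f : dsum) : fin_supp (fun i => a *: f i).
Proof.
case: f => f /asboolP ff /=; apply/asboolP.
by apply: sub_finite_set ff => i /= nz f0; apply: nz; rewrite f0 scaler0.
Qed.

Lemma fin_suppN (f : dsum) : fin_supp (fun i => - f i).
Proof.
case: f => f /asboolP ff /=; apply/asboolP.
by apply: sub_finite_set ff => i /= nz f0; apply: nz; rewrite f0 oppr0.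
Qed.

Let zero := DSum fin_supp0.
Let add f g := DSum (fin_suppD f g).
Let opp f := DSum (fin_suppN f).
Let scale a f := DSum (fin_suppZ a f).

Let addA : associative add. Proof. by move=> *; apply: dsumP => i /=; rewrite addrA. Qed.
Let addC : commutative add. Proof. by move=> *; apply: dsumP => i /=; rewrite addrC. Qed.
Let add0 : left_id zero add. Proof. by move=> *; apply: dsumP => i /=; rewrite add0r. Qed.
Let addN : left_inverse zero opp add. Proof. by move=> *; apply: dsumP => i /=; rewrite addNr. Qed.
HB.instance Definition _ := GRing.isZmodule.Build dsum addA addC add0 addN.

Let scaleA a b f : scale a (scale b f) = scale (a * b) f.
Proof. by apply: dsumP => i /=; rewrite scalerA. Qed.
Let scale1 : left_id 1 scale. Proof. by move=> f; apply: dsumP => i /=; rewrite scale1r. Qed.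
Let scaleDr : right_distributive scale +%R.
Proof. by move=> a f g; apply: dsumP => i /=; rewrite scalerDr. Qed.
Let scaleDl f : {morph scale^~ f : a b / a + b}.
Proof. by move=> a b; apply: dsumP => i /=; rewrite scalerDl. Qed.
HB.instance Definition _ :=
  GRing.Zmodule_isLmodule.Build rat dsum scaleA scale1 scaleDr scaleDl.

Definition dinj_fun i (v : V i) (j : I) : V j :=
  if i =P j is ReflectT e then ecast k (V k) e v else 0.

Lemma dinj_fin i (v : V i) : fin_supp (dinj_fun v).
Proof.
apply/asboolP; apply: (@sub_finite_set _ _ [set i]); last exact: finite_set1.
by move=> j /=; rewrite /dinj_fun; case: eqP => // ->.
Qed.

Definition dinj i (v : V i) : dsum := DSum (dinj_fin v).

End DirectSums.

Arguments dinj {I} V i v.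

Definition freemod (K : choiceType) : lmodType rat := dsum (fun _ : K => rat^o).
Definition fgen (K : choiceType) (k : K) : freemod K :=
  dinj (fun _ : K => rat^o) k 1.

Section FreeLift.
Variables (K : choiceType) (X : lmodType rat) (phi : K -> X).

Definition free_lift (r : freemod K) : X :=
  \sum_(k \in [set: K]) (r k : rat) *: phi k.

Lemma free_liftE (r : freemod K) (A : set K) : finite_set A ->
  (forall k, r k <> 0 -> A k) ->
  free_lift r = \sum_(k <- fset_set A) (r k : rat) *: phi k.
Proof.
move=> Afin rA; rewrite -fsbig_finite // /free_lift; apply/esym/fsbig_widen => //.
move=> k [_ /= Ak]; have [->|/rA//] := pselect (r k = 0).
exact: scale0r.
Qed.

Lemma free_lift_linear : linear free_lift.
Proof.
move=> a r r'.
have /asboolP rfin := dsum_fin r; have /asboolP r'fin := dsum_fin r'.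
pose A := [set k | r k <> 0] `|` [set k | r' k <> 0].
have Afin : finite_set A by rewrite /A finite_setU.
have rA k : r k <> 0 -> A k by left.
have r'A k : r' k <> 0 -> A k by right.
have rr'A k : (a *: r + r') k <> 0 -> A k.
  move=> /= nz; have [r0|/rA//] := pselect (r k = 0); apply: r'A => r'0.
  by apply: nz; rewrite r0 r'0 scaler0 addr0.
rewrite !(@free_liftE _ A) // scaler_sumr -big_split /=.
by apply: eq_bigr => k _; rewrite scalerDl scalerA.
Qed.

Lemma free_lift_fgen k : free_lift (fgen k) = phi k.
Proof.
rewrite (@free_liftE _ [set k]); first last.
- by move=> j; rewrite /= /dinj_fun; case: eqP.
- exact: finite_set1.
rewrite -fsbig_finite ?fsbig_set1 /=; last exact: finite_set1.
rewrite /dinj_fun; case: eqP => // e.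
by rewrite (eq_axiomK e) /= scale1r.
Qed.

End FreeLift.

Section Quotients.
Variables (V : lmodType rat) (A : set V).

Definition lquot : Type := Quotient.quot (lspan A).
HB.instance Definition _ := GRing.Zmodule.on lquot.
HB.instance Definition _ := EqQuotient.on lquot.

Definition lquot_scale (a : rat) (x : lquot) : lquot :=
  \pi_lquot (a *: repr x).

Lemma lquotP (x y : V) : \pi_lquot x = \pi_lquot y <-> x - y \in lspan A.
Proof.
rewrite (Quotient.idealrBE (lspan A)); split=> [xy|/eqP//].
by apply/eqP.
Qed.

Lemma lquot_piD (x y : V) : \pi_lquot (x + y) = \pi_lquot x + \pi_lquot y.
Proof. exact: (Quotient.pi_add (lspan A)). Qed.

Lemma lquot_piZ a (x : V) : \pi_lquot (a *: x) = lquot_scale a (\pi_lquot x).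
Proof.
apply/lquotP; rewrite -scalerBr rpredZ//.
have /lquotP := esym (reprK (\pi_lquot x)); exact.
Qed.

Let scaleA a b x : lquot_scale a (lquot_scale b x) = lquot_scale (a * b) x.
Proof.
by rewrite -[x]reprK -(lquot_piZ b) -(lquot_piZ a) -(lquot_piZ (a * b)) scalerA.
Qed.
Let scale1 : left_id 1 lquot_scale.
Proof. by move=> x; rewrite -[x]reprK -!lquot_piZ scale1r. Qed.
Let scaleDr : right_distributive lquot_scale +%R.
Proof.
move=> a x y; rewrite -[x]reprK -[y]reprK -lquot_piD -!lquot_piZ.
by rewrite -lquot_piD scalerDr.
Qed.
Let scaleDl x : {morph lquot_scale^~ x : a b / a + b}.
Proof. by move=> a b; rewrite -[x]reprK -!lquot_piZ -lquot_piD scalerDl. Qed.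
HB.instance Definition _ :=
  GRing.Zmodule_isLmodule.Build rat lquot scaleA scale1 scaleDr scaleDl.

End Quotients.
Arguments lquot {V} A.

Lemma lquot_lift (V X : lmodType rat) (A : set V) (f : V -> X) (x : V) :
  linear f -> (forall y, A y -> f y = 0) -> f (repr (\pi_(lquot A) x)) = f x.
Proof.
move=> f_lin fA.
have fD y z : f (y + z) = f y + f z by have := f_lin 1 y z; rewrite !scale1r.
have f0 : f 0 = 0 by have := f_lin (-1) 0 0; rewrite scaler0 addr0 scaleN1r addNr.
have fZ a y : f (a *: y) = a *: f y by rewrite -[a *: y]addr0 f_lin f0 addr0.
have /lquotP/asboolP[n [c [v [Av xE]]]] := reprK (\pi_(lquot A) x).
have fsum : f (\sum_i c i *: v i) = 0.
  rewrite (big_morph f fD f0) big1 // => i _.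
  by rewrite fZ fA ?scaler0.
by rewrite -[repr _](subrK x) xE fD fsum add0r.
Qed.

Section Tensor.
Variables U W : lmodType rat.

Definition tens_rel : set (freemod (U * W)%type) := [set r |
  (exists a u u' w,
     r = fgen (a *: u + u', w) - (a *: fgen (u, w) + fgen (u', w))) \/
  (exists a u w w',
     r = fgen (u, a *: w + w') - (a *: fgen (u, w) + fgen (u, w')))].

Definition tens : lmodType rat := lquot tens_rel.

Definition pure (u : U) (w : W) : tens := \pi_(lquot tens_rel) (fgen (u, w)).

(* The linear map U (x) W -> X induced by a bilinear map b. *)
Definition tens_lift (X : lmodType rat) (b : U -> W -> X) (t : tens) : X :=
  free_lift (fun k => b k.1 k.2) (repr (t : lquot tens_rel)).

Section Lift.
Variables (X : lmodType rat) (b : U -> W -> X).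
Hypotheses (bl : forall w, linear (b^~ w)) (br : forall u, linear (b u)).

Let phi (k : U * W) := b k.1 k.2.

Lemma tens_lift_rel r : tens_rel r -> free_lift phi r = 0.
Proof.
have lin := free_lift_linear phi.
have liftB x y : free_lift phi (x - y) = free_lift phi x - free_lift phi y.
  by rewrite addrC -scaleN1r lin scaleN1r addrC.
by move=> [[a [u [u' [w ->]]]]|[a [u [w [w' ->]]]]];
  rewrite liftB lin !free_lift_fgen /phi /= ?bl ?br subrr.
Qed.

Lemma tens_lift_pi (r : freemod (U * W)%type) :
  tens_lift b (\pi_(lquot tens_rel) r) = free_lift phi r.
Proof.
apply: (@lquot_lift _ _ tens_rel (free_lift phi)); last exact: tens_lift_rel.
exact: free_lift_linear.
Qed.

Lemma tens_lift_linear : linear (tens_lift b).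
Proof.
move=> a t t'; rewrite -[t](reprK (t : lquot tens_rel)).
rewrite -[t'](reprK (t' : lquot tens_rel)).
have -> : forall x y : freemod (U * W)%type,
    a *: (\pi_(lquot tens_rel) x : tens) + \pi_(lquot tens_rel) y =
    \pi_(lquot tens_rel) (a *: x + y).
  by move=> x y; rewrite lquot_piD lquot_piZ.
by rewrite !tens_lift_pi free_lift_linear.
Qed.

Lemma tens_lift_pure u w : tens_lift b (pure u w) = b u w.
Proof. by rewrite /pure tens_lift_pi free_lift_fgen. Qed.

End Lift.

End Tensor.

Section Gradings.
Variable V : lmodType rat.

Definition graded_sub (hom : int -> set V) (S : submodClosed V) : Prop :=
  forall x, x \in S -> x \in lspan [set y | y \in S /\ exists D, hom D y].

Definition finite_dim (S : submodClosed V) : Prop :=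
  exists n (v : 'I_n -> V), (forall i, v i \in S) /\
    forall x, x \in S -> exists c : 'I_n -> rat, x = \sum_i c i *: v i.

Definition complement (S : submodClosed V) (U : set V) : Prop :=
  (forall x, x \in S -> U x -> x = 0) /\
  (forall x, exists y z, [/\ y \in S, U z & x = y + z]).

End Gradings.

Section FreeSupercommutative.
Variables (V : lmodType rat) (par : bool -> set V).

(* Sym V is the tensor algebra of V modulo supercommutativity, written as the
   space on words in V modulo multilinearity and the relations
   v w = (-1)^(|v| |w|) w v for v, w of parities |v|, |w| (par i being the
   set of vectors of parity i); the product is concatenation of words. *)
Definition sSym_rel : set (freemod (seq V)) := [set r |
  (exists (p q : seq V) a v w,
     r = fgen (p ++ (a *: v + w) :: q)
         - (a *: fgen (p ++ v :: q) + fgen (p ++ w :: q))) \/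
  (exists (p q : seq V) i j v w, [/\ par i v, par j w &
     r = fgen (p ++ v :: w :: q)
         - (-1) ^+ (i && j) *: fgen (p ++ w :: v :: q)])].

Definition sSym : lmodType rat := lquot sSym_rel.

(* The map induced by a linear map V -> B into a supercommutative algebra B with
   unit one and product mul: v1 ... vn |-> phi v1 * (... * (phi vn * 1)). *)
Definition sSym_lift (B : lmodType rat) (one : B) (mul : B -> B -> B)
    (phi : V -> B) (t : sSym) : B :=
  free_lift (foldr (fun v => mul (phi v)) one) (repr (t : lquot sSym_rel)).

End FreeSupercommutative.

(* 2-shuffles of type (a, b), as maps from the ordered set of a + b variables
   (first block 'I_a, second block 'I_b) to 'I_n, for n = a + b. *)
Definition shuffle (a b n : nat) (p : {ffun 'I_a + 'I_b -> 'I_n}) : bool :=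
  [&& injectiveb p,
      [forall i : 'I_a, forall j : 'I_a, (i < j)%N ==> (p (inl i) < p (inl j))%N] &
      [forall i : 'I_b, forall j : 'I_b, (i < j)%N ==> (p (inr i) < p (inr j))%N]].

Notation ratfrac n := {fraction {mpoly rat[n]}}.

Definition fvar n (i : 'I_n) : ratfrac n := @tofrac {mpoly rat[n]} 'X_i.

Definition evalf n k (v : 'I_k -> ratfrac n) (p : {mpoly rat[k]}) : ratfrac n :=
  mmap (fun c : rat => @tofrac {mpoly rat[n]} c%:MP) v p.

(* The element of S equal to the rational function u. The sums over shuffles below
   have apparent denominators when m = 0 or N = -1, which cancel. *)
Definition of_frac n (S : submodClosed {mpoly rat[n]}) (u : ratfrac n) : subsp S :=
  xget 0 [set p : subsp S | tofrac (val p) = u].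

Section CoHA.
Variable m : nat.

Definition euler (d d' : nat) : int := (1 - m%:Z) * (d * d')%:Z.

Definition sympol d : {pred {mpoly rat[d]}} := [pred p | p \is symmetric].
Arguments sympol : clear implicits.

Lemma sympol_submod_closed d : submod_closed (sympol d).
Proof. exact: sym_submod_closed. Qed.

HB.instance Definition _ d :=
  GRing.isSubmodClosed.Build rat {mpoly rat[d]} (sympol d) (@sympol_submod_closed d).

(* H_{GL_d}(Mat_d^m), in terms of the Chern roots x_1, ..., x_d. *)
Definition Hd (d : nat) : lmodType rat := subsp (sympol d).

Definition Hd_hom (d : nat) (D : int) : set (Hd d) := [set f | f = 0 \/
  exists n : nat, val f \is n.-homog /\ D = 2 * n%:Z + euler d d].

Definition coha : lmodType rat := dsum Hd.

Definition coha_hom (d : nat) (D : int) : set coha :=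
  [set f | exists2 p : Hd d, Hd_hom D p & f = dinj Hd d p].

(* Z/2-grading by the parity of the degree 2n + euler d d. *)
Definition coha_par (i : bool) : set coha :=
  [set f | forall d, f d != 0 -> odd `|euler d d|%N = i].

Definition hmul_frac d1 d2 (f : {mpoly rat[d1]}) (g : {mpoly rat[d2]}) :
    ratfrac (d1 + d2) :=
  \sum_(p : {ffun 'I_d1 + 'I_d2 -> 'I_(d1 + d2)} | shuffle p)
    let x' k := fvar (p (inl k)) in
    let x'' l := fvar (p (inr l)) in
    evalf x' f * evalf x'' g *
    \prod_(l < d2) \prod_(k < d1) (x'' l - x' k) ^ (m%:Z - 1).

Definition hmul_comp d1 d2 (f : Hd d1) (g : Hd d2) : Hd (d1 + d2) :=
  of_frac _ (hmul_frac (val f) (val g)).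

Definition hmul (f g : coha) : coha :=
  \sum_(d1 \in [set: nat]) \sum_(d2 \in [set: nat])
    dinj Hd (d1 + d2)%N (hmul_comp (f d1) (g d2)).

Lemma sympol1 d : 1 \in sympol d.
Proof. by rewrite inE rpred1. Qed.

Definition hone : coha := dinj Hd 0%N (insp (sympol1 0)).

(* Subalgebras contain the unit. *)
Inductive subalg (G : set coha) : coha -> Prop :=
| subalg_gen f : G f -> subalg G f
| subalg1 : subalg G hone
| subalgM f g : subalg G f -> subalg G g -> subalg G (hmul f g)
| subalgZD a f g : subalg G f -> subalg G g -> subalg G (a *: f + g).

Definition sigma d : {mpoly rat[d]} := \sum_(i < d) 'X_i.

Lemma sigma_sym d : sigma d \is symmetric.
Proof. by rewrite /sigma -mesym1E mesym_sym. Qed.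

Lemma sigma_mul_sub d (q : {poly rat}) (v : Hd d) :
  val v * horner_alg (sigma d) q \in sympol d.
Proof.
have /= v_sym : val v \is symmetric := valP v.
rewrite inE rpredM //= /horner_alg /horner_morph /= horner_poly.
rewrite rpred_sum // => i _; rewrite mulr_algl rpredZ // rpredX //.
exact: sigma_sym.
Qed.

Definition sigma_mul d (v : Hd d) (q : {poly rat}) : Hd d :=
  insp (sigma_mul_sub q v).

Lemma SH_sub d (f : Hd d) : val f \mPo [tuple - 'X_i | i < d] \in sympol d.
Proof.
have f_sym : val f \is symmetric := valP f.
rewrite inE; apply: msym_comp_poly => // g.
apply/tuple_permP; exists (g^-1)%g; congr (val _).
apply: eq_from_tnth => i; rewrite !tnth_mktuple -tnth_nth tnth_mktuple.
by rewrite raddfN /= /msym mmapX mmap1U /= permKV.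
Qed.

(* f(-x_1, ..., -x_d) *)
Definition SH d (f : Hd d) : Hd d := insp (SH_sub f).

End CoHA.

Section CoHM.
Variables (m : nat) (s : int) (tau : 'I_m -> int).

Definition admissible (e : nat) : bool := (s == -1) ==> ~~ odd e.

Definition tau_plus : nat := #|[pred k | tau k == 1]|.
Definition tau_minus : nat := #|[pred k | tau k == -1]|.
Definition tau_s : nat := if s == 1 then tau_plus else tau_minus.

(* All the divisions are exact when s and the tau k are signs. *)
Definition Ecal (d : nat) : int :=
  (d%:Z * (d%:Z - s) %/ 2)%Z - \sum_(k < m) (d%:Z * (d%:Z + tau k * s) %/ 2)%Z.

(* H_{G_e}(R_e^sigma) = Q[z_1^2, ..., z_k^2]^(S_k) for k = e./2, where G_e is O_e
   if s = 1 and Sp_e if s = -1; the zero space if e is not admissible. *)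
Definition Mpol (e : nat) : {pred {mpoly rat[e./2]}} := [pred p | `[<
  p \is symmetric /\ (exists q : {mpoly rat[e./2]},
    p = q \mPo [tuple 'X_i ^+ 2 | i < e./2]) /\ (~~ admissible e -> p = 0) >]].
Arguments Mpol : clear implicits.

Lemma Mpol_submod_closed e : submod_closed (Mpol e).
Proof.
split=> [|a p q].
  apply/asboolP; split; first exact: rpred0.
  by split=> //; exists 0; rewrite raddf0.
move=> /asboolP[psym [[p' pE] p0]] /asboolP[qsym [[q' qE] q0]].
apply/asboolP; split; first by rewrite rpredD ?rpredZ.
split; first by exists (a *: p' + q'); rewrite linearP /= -pE -qE.
by move=> eN; rewrite p0 ?q0 // scaler0 addr0.
Qed.

HB.instance Definition _ e :=
  GRing.isSubmodClosed.Build rat {mpoly rat[e./2]} (Mpol e) (@Mpol_submod_closed e).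

Definition Md (e : nat) : lmodType rat := subsp (Mpol e).

Definition Md_hom (e : nat) (D : int) : set (Md e) := [set g | g = 0 \/
  exists n : nat, val g \is n.-homog /\ D = 2 * n%:Z + Ecal e].

Definition cohm : lmodType rat := dsum Md.

Definition cohm_hom (e : nat) (D : int) : set cohm :=
  [set g | exists2 p : Md e, Md_hom D p & g = dinj Md e p].

Definition star_exp (e : nat) : int :=
  if s == 1 then if odd e then m%:Z + tau_plus%:Z - 1 else tau_plus%:Z
  else tau_minus%:Z - 1.

Definition star_frac d e (f : {mpoly rat[d]}) (g : {mpoly rat[e./2]}) :
    ratfrac (d.*2 + e)./2 :=
  2 ^ ((tau_s%:Z - ((1 - s) %/ 2)%Z) * d%:Z) *
  \sum_(p : {ffun 'I_d + 'I_(e./2) -> 'I_((d.*2 + e)./2)} | shuffle p)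
  \sum_(eps : {ffun 'I_d -> bool})
    let x i := (-1) ^+ eps i * fvar (p (inl i)) in
    let z j := fvar (p (inr j)) in
    evalf x f * evalf z g * \prod_(i < d) (- x i) ^ star_exp e *
    (\prod_(i < d) \prod_(j < d | (i < j)%N) (- x i - x j) *
     \prod_(i < d) \prod_(j < e./2) (x i ^+ 2 - z j ^+ 2)) ^ (m%:Z - 1).

Definition star_comp d e (f : Hd d) (g : Md e) : Md (d.*2 + e) :=
  of_frac _ (star_frac (val f) (val g)).

Definition star (f : coha) (g : cohm) : cohm :=
  \sum_(d \in [set: nat]) \sum_(e \in [set: nat])
    dinj Md (d.*2 + e)%N (star_comp (f d) (g e)).

(* (H_+ * M) :&: M_e *)
Definition decomposable (e : nat) : set (Md e) := [set p |
  dinj Md e p \in lspan [set h | exists (f : coha) (g : cohm), f 0%N = 0 /\ h = star f g]].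

Section PrimitiveGenerators.
Variable Vprim : forall d, submodClosed (Hd d).

(* The sum over d >= 1 of the spaces V_d^prim . Q[sigma_d]; Vprim 0 is not used. *)
Definition Vgen : {pred coha} := lspan [set f | exists d (v : Hd d) (q : {poly rat}),
  [/\ (0 < d)%N, v \in Vprim d & f = dinj Hd d (sigma_mul v q)]].
HB.instance Definition _ := GRing.SubmodClosed.on Vgen.

(* The map Sym V -> H induced by V < H is multiplicative by construction, so it is
   an isomorphism of algebras when it is bijective. *)
Definition primitive_generators : Prop :=
  (forall d, (0 < d)%N ->
    [/\ graded_sub (@Hd_hom m d) (Vprim d), finite_dim (Vprim d) &
        injective (tens_lift (fun (v : subsp (Vprim d)) (q : {poly rat}) =>
          sigma_mul (val v) q))]) /\
  bijective (sSym_lift (par := fun i => [set v : subsp Vgen | coha_par m i (val v)])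
    hone (@hmul m) val).

Variable e : nat.

(* The e-twisted action of the generator of Z/2. *)
Definition twist (f : coha) : coha := \sum_(d \in [set: nat])
  dinj Hd d ((-1) ^ (euler m e d + Ecal d) *: SH (f d)).

Definition He : {pred coha} := [pred f |
  `[< subalg m [set v | v \in Vgen /\ twist v = v] f >]].

Lemma He_submod_closed : submod_closed He.
Proof.
split=> [|a f g /asboolP Gf /asboolP Gg]; apply/asboolP; last exact: subalgZD.
have -> : 0 = (-1) *: hone + hone by rewrite scaleN1r addNr.
by apply: subalgZD; apply: subalg1.
Qed.

HB.instance Definition _ := GRing.isSubmodClosed.Build rat coha He He_submod_closed.

Lemma He_mul_sub (f g : subsp He) : hmul m (val f) (val g) \in He.
Proof.
case: f g => f fP [g gP] /=; apply/asboolP.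
by apply: subalgM; apply/asboolP; [exact: fP | exact: gP].
Qed.

Definition He_mul (f g : subsp He) : subsp He := insp (He_mul_sub f g).

Variable W : submodClosed (Md e).

(* f . (g (x) w) = (f g) (x) w *)
Definition free_act (f : subsp He) : tens (subsp He) (subsp W) ->
    tens (subsp He) (subsp W) :=
  tens_lift (fun g w => pure (He_mul f g) w).

(* The restriction of the action map below to H(e) (x) W_e. *)
Definition action_map_at : tens (subsp He) (subsp W) -> cohm :=
  tens_lift (fun f w => star (val f) (dinj Md e (val w))).

(* Elements of e-degree a and degree D of H(e) (x) W, H_d having e-degree 2d. *)
Definition tens_hom (a : nat) (D : int) : set (tens (subsp He) (subsp W)) :=
  [set t | t \in lspan [set x | exists (f : subsp He) (w : subsp W) d D1 D2,
    [/\ coha_hom m d D1 (val f), Md_hom D2 (val w), a = (d.*2 + e)%N, D = D1 + D2 &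
        x = pure f w]]].

End PrimitiveGenerators.

Section ActionMap.
Variable Vprim : forall d, submodClosed (Hd d).
Variable W : forall e, submodClosed (Md e).

Definition action_source : lmodType rat :=
  dsum (fun e => tens (subsp (He Vprim e)) (subsp (W e))).

Definition source_hom (a : nat) (D : int) : set action_source :=
  [set t | forall e, tens_hom a D (t e)].

Definition action_map (t : action_source) : cohm :=
  \sum_(e \in [set: nat]) action_map_at (t e).

End ActionMap.

End CoHM.

Arguments Md_hom {m s} tau e D _.
Arguments cohm_hom {m s} tau a D _ : rename.
Arguments decomposable {m s} tau e _.
Arguments star {m s} tau f g.
Arguments He {m} s tau Vprim e.
Arguments free_act {m s tau Vprim e} W f _.
Arguments action_map_at {m s} tau Vprim e W _.
Arguments action_source {m s} tau Vprim W.
Arguments source_hom {m s} tau Vprim W a D _.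
Arguments action_map {m s} tau Vprim W t.

(* Main.v *)
(* Symmetric polynomials are determined by their values at finite sets of distinct
   points, and shuffle sums become sums over subsets. In these terms, once the z_j^2
   are taken as variables, f * g is the product of g with rho f in H, where rho is
   an antihomomorphism H -> H given by summation over sign changes.

   Generation. rho kills the generators on which the twist acts by -1, so a word in
   homogeneous generators acts by 0 or lies in H(e); induction on e then shows that
   the products f * w span M.

   Freeness. The key point is that v is decomposable in H when v is twist-invariant
   and rho v is decomposable: modulo the ideal J spanned by the products of kernels
   of two complementary blocks, rho v agrees up to linear factors with v, and a
   linear form with nonzero derivative along (1, ..., 1) is not a zero divisor
   modulo J. Hence rho is injective from invariant generators to indecomposables.
   Since H is a free supercommutative algebra, it has superderivations dual to the
   generators; they are intertwined by rho up to terms of longer length or of larger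
   degree in W, and a relation sum_i w_i rho (r_i) = 0 is reduced by them to one
   with constant r_i, excluded by the choice of W as a complement. *)

From HB Require Import structures.
Require Import Defs.
From mathcomp Require Import fingroup perm.
From mathcomp Require Import all_boot all_order all_algebra generic_quotient.
From mathcomp Require Import finmap boolp classical_sets functions cardinality fsbigop.
From mathcomp Require Import mpoly.
From mathcomp Require Import fintype finset ring zify.

Set Implicit Arguments.
Unset Strict Implicit.
Unset Printing Implicit Defensive.

Import GRing.Theory Num.Theory.
Local Open Scope ring_scope.
Local Open Scope quotient_scope.

(** * Values of polynomials and of rational functions *)

(** The exponents [m - 1] and [N] can be -1, so the terms of the shuffle sums are rational
    functions. All identities are therefore checked at rational points off the poles: distinct
    coordinates for H, nonzero coordinates with distinct squares for M. That a sum is polynomial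
    follows from antisymmetry: multiplied by a Vandermonde determinant it is polynomial and
    antisymmetric, hence divisible by that determinant. The action changes e by even amounts, and
    both N and the twist depend on e through its parity, so each parity b has its own rho. Changing
    all signs at once multiplies the weight in rho by exactly the sign of the twist; this is why rho
    kills the anti-invariant generators, and why for the invariant ones the two constant choices of
    signs add up instead of cancelling. As rho reverses products, right superderivations D of the
    target are matched with left superderivations E of the source. They match only up to longer
    words or higher W-degree; hence an induction on length and, inside it, on W-degree. *)

Lemma poly_eq0_nat (q : {poly rat}) : (forall k : nat, q.[k%:R] = 0) -> q = 0.
Proof.
move=> q0; apply/eqP; apply: contraT => nz.
have := @max_poly_roots _ q [seq (i%:R : rat) | i <- iota 0 (size q)] nz.
rewrite size_map size_iota ltnn; apply.
  by apply/allP => x /mapP[i _ ->]; rewrite /root q0.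
rewrite map_inj_uniq ?iota_uniq // => i j /eqP.
by rewrite eqr_nat => /eqP.
Qed.

(** The digits will be the exponents of a monomial and [B] a bound on them, so that distinct
    monomials become distinct powers of one variable. *)
Lemma digits_inj (B n : nat) (f g : 'I_n -> nat) :
  (forall i, f i < B)%N -> (forall i, g i < B)%N ->
  (\sum_(i < n) f i * B ^ i = \sum_(i < n) g i * B ^ i)%N -> f =1 g.
Proof.
elim: n f g => [|n IH] f g fB gB; first by move=> _ [].
rewrite !big_ord_recl !expn0 !muln1.
have E h : (\sum_(i < n) h (lift ord0 i) * B ^ lift ord0 i =
            (\sum_(i < n) h (lift ord0 i) * B ^ i) * B)%N.
  by rewrite big_distrl; apply: eq_bigr => i _; rewrite lift0 expnSr mulnA.
rewrite !E => eq.
have e0 : f ord0 = g ord0.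
  have := congr1 (modn^~ B) eq; rewrite /= ![(_ + _ * B)%N]addnC !modnMDl.
  by rewrite !modn_small.
have B0 : (0 < B)%N by apply: leq_ltn_trans (fB ord0).
have eq' : (\sum_(i < n) f (lift ord0 i) * B ^ i =
            \sum_(i < n) g (lift ord0 i) * B ^ i)%N.
  by move: eq; rewrite e0 => /addnI /eqP; rewrite eqn_pmul2r // => /eqP.
have := IH (f \o lift ord0) (g \o lift ord0) _ _ eq' => {}IH i.
case: (unliftP ord0 i) => [j ->|-> //]; apply: IH => k; [exact: fB|exact: gB].
Qed.

(* Kronecker substitution x_i := t^(B^i) separates the monomials of p. *)
Lemma meval_eq0 n (p : {mpoly rat[n]}) : (forall v, p.@[v] = 0) -> p = 0.
Proof.
move=> p0; pose B := msize p; pose k (m : 'X_{1..n}) := (\sum_(i < n) m i * B ^ i)%N.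
pose q : {poly rat} := \sum_(m <- msupp p) p@_m *: 'X^(k m).
have q0 : q = 0.
  apply: poly_eq0_nat => t; rewrite horner_sum.
  rewrite -[RHS](p0 (fun i => t%:R ^+ (B ^ i))) mevalE; apply: eq_bigr => m _.
  rewrite hornerZ hornerXn; congr (_ * _).
  by rewrite /k -prodrXr; apply: eq_bigr => i _; rewrite mulnC exprM.
have ltB m i : m \in msupp p -> (m i < B)%N.
  move=> /msize_mdeg_lt; apply: leq_ltn_trans.
  by rewrite mdegE (bigD1 i) //= leq_addr.
have cE m : m \in msupp p -> p@_m = q`_(k m).
  move=> mp; rewrite coef_sum (bigD1_seq m) ?msupp_uniq //=.
  rewrite coefZ coefXn eqxx mulr1 big_seq_cond big1 ?addr0 // => m' /andP[m'p neq].
  rewrite coefZ coefXn; case: eqP => [e|]; last by rewrite mulr0.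
  case/negP: neq; apply/eqP/mnmP => i; symmetry.
  by apply: (digits_inj _ _ e) => j; apply: ltB.
apply/mpolyP => m; rewrite mcoeff0; have [/cE->|/memN_msupp_eq0//] := boolP (m \in msupp p).
by rewrite q0 coef0.
Qed.

(** [D * p] vanishes everywhere, and polynomials form a domain. [D] is typically a Vandermonde
    determinant or [genpoly], nonzero only off the poles of the kernels. *)
Lemma meval_eq0_generic n (D p : {mpoly rat[n]}) : D != 0 ->
  (forall v, D.@[v] != 0 -> p.@[v] = 0) -> p = 0.
Proof.
move=> D0 pv; have /eqP : D * p = 0.
  apply: meval_eq0 => v; rewrite mevalM.
  by have [->|/pv->] := eqVneq D.@[v] 0; rewrite ?mul0r ?mulr0.
by rewrite mulf_eq0 (negPf D0) => /eqP.
Qed.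

Lemma meval_ext_generic n (D p q : {mpoly rat[n]}) : D != 0 ->
  (forall v, D.@[v] != 0 -> p.@[v] = q.@[v]) -> p = q.
Proof.
move=> D0 pq; apply/eqP; rewrite -subr_eq0; apply/eqP.
by apply: (meval_eq0_generic D0) => v /pq e; rewrite mevalB e subrr.
Qed.

Lemma generic_point n (D : {mpoly rat[n]}) : D != 0 -> exists v, D.@[v] != 0.
Proof.
move=> D0; apply: contrapT => nex; case/eqP: D0; apply: meval_eq0 => v.
by apply/eqP; apply: contrapT => /negP nz; apply: nex; exists v.
Qed.

Section FractionValues.
Variables (n : nat) (v : 'I_n -> rat).

(* The rational function u is defined at the point v, with value c. *)
Definition fev (u : ratfrac n) (c : rat) : Prop := exists p q : {mpoly rat[n]},
  [/\ q.@[v] != 0, u * tofrac q = tofrac p & c * q.@[v] = p.@[v]].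

Lemma fev_tofrac p : fev (tofrac p) p.@[v].
Proof. by exists p, 1; rewrite meval1 tofrac1 !mulr1 oner_neq0. Qed.

Lemma fev_uniq u c c' : fev u c -> fev u c' -> c = c'.
Proof.
move=> [p [q [q0 E F]]] [p' [q' [q0' E' F']]].
have e : p * q' = p' * q.
  by apply/eqP; rewrite -tofrac_eq !tofracM -E -E' mulrAC.
apply: (mulIf q0); apply: (mulIf q0'); rewrite F [RHS]mulrAC F' -!mevalM.
by rewrite e.
Qed.

Lemma fev_tofrac_eq p c : fev (tofrac p) c -> p.@[v] = c.
Proof. by apply: fev_uniq; apply: fev_tofrac. Qed.

Lemma fevD u u' c c' : fev u c -> fev u' c' -> fev (u + u') (c + c').
Proof.
move=> [p [q [q0 E F]]] [p' [q' [q0' E' F']]].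
exists (p * q' + p' * q), (q * q'); split.
- by rewrite mevalM mulf_neq0.
- by rewrite tofracD !tofracM -E -E'; ring.
- by rewrite mevalD !mevalM -F -F'; ring.
Qed.

Lemma fevM u u' c c' : fev u c -> fev u' c' -> fev (u * u') (c * c').
Proof.
move=> [p [q [q0 E F]]] [p' [q' [q0' E' F']]].
exists (p * p'), (q * q'); split.
- by rewrite mevalM mulf_neq0.
- by rewrite !tofracM -E -E'; ring.
- by rewrite !mevalM -F -F'; ring.
Qed.

Lemma fevC a : fev (tofrac a%:MP) a.
Proof. by have := fev_tofrac a%:MP; rewrite mevalC. Qed.

Lemma fev0 : fev 0 0.
Proof. by have := fevC 0; rewrite mpolyC0 tofrac0. Qed.

Lemma fev1 : fev 1 1.
Proof. by have := fevC 1; rewrite mpolyC1 tofrac1. Qed.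

Lemma fevN u c : fev u c -> fev (- u) (- c).
Proof.
move=> uc; rewrite -mulN1r -[- c]mulN1r; apply: fevM => //.
by have := fevC (-1); rewrite mpolyCN mpolyC1 tofracN tofrac1.
Qed.

Lemma fevB u u' c c' : fev u c -> fev u' c' -> fev (u - u') (c - c').
Proof. by move=> uc uc'; apply: fevD => //; apply: fevN. Qed.

Lemma fevV u c : c != 0 -> fev u c -> fev u^-1 c^-1.
Proof.
move=> c0 [p [q [q0 E F]]].
have pv : p.@[v] != 0 by rewrite -F mulf_neq0.
have u0 : u != 0.
  apply: contraNneq pv => u0; move: E; rewrite u0 mul0r => /esym/eqP.
  by rewrite tofrac_eq0 => /eqP->; rewrite meval0.
exists q, p; split=> //; first by rewrite -E mulKf.
by rewrite -F mulKf.
Qed.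

Lemma fev_sum I (r : seq I) (P : pred I) (U : I -> ratfrac n) (C : I -> rat) :
  (forall i, P i -> fev (U i) (C i)) ->
  fev (\sum_(i <- r | P i) U i) (\sum_(i <- r | P i) C i).
Proof.
by move=> UC; apply: (big_ind2 fev) => //; [exact: fev0|move=> *; apply: fevD].
Qed.

Lemma fev_prod I (r : seq I) (P : pred I) (U : I -> ratfrac n) (C : I -> rat) :
  (forall i, P i -> fev (U i) (C i)) ->
  fev (\prod_(i <- r | P i) U i) (\prod_(i <- r | P i) C i).
Proof.
by move=> UC; apply: (big_ind2 fev) => //; [exact: fev1|move=> *; apply: fevM].
Qed.

Lemma fevX u c k : fev u c -> fev (u ^+ k) (c ^+ k).
Proof.
move=> uc; elim: k => [|k IH]; first by rewrite !expr0; apply: fev1.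
by rewrite !exprS; apply: fevM.
Qed.

Lemma fevXz u c (z : int) : c != 0 -> fev u c -> fev (u ^ z) (c ^ z).
Proof.
move=> c0 uc; case: z => k; first exact: fevX.
by rewrite /exprz; apply: fevV; [rewrite expf_neq0|apply: fevX].
Qed.

Lemma fev_fvar i : fev (fvar i) (v i).
Proof. by have := fev_tofrac 'X_i; rewrite mevalXU. Qed.

Lemma fev_evalf k (w : 'I_k -> ratfrac n) (b : 'I_k -> rat) p :
  (forall i, fev (w i) (b i)) -> fev (evalf w p) p.@[b].
Proof.
move=> wb; rewrite mevalE /evalf /mmap; apply: fev_sum => m _.
apply: fevM; first exact: fevC.
by apply: fev_prod => i _; apply: fevX.
Qed.

End FractionValues.

(** Definedness at one point writes [u] as a fraction [a / b]; then [p * b = a] holds wherever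
    [D * b] is nonzero, hence identically. *)
Lemma frac_eq_generic n (D p : {mpoly rat[n]}) (u : ratfrac n) : D != 0 ->
  (forall v, D.@[v] != 0 -> fev v u p.@[v]) -> u = tofrac p.
Proof.
move=> D0 uP; have [v0 /uP[a [b [b0 E _]]]] := generic_point D0.
have nb : b != 0 by apply: contraNneq b0 => ->; rewrite meval0.
have pb : p * b = a.
  apply: (@meval_ext_generic _ (D * b)); first by rewrite mulf_neq0.
  move=> v; rewrite mevalM mulf_eq0 negb_or => /andP[Dv bv].
  have := fevM (uP v Dv) (fev_tofrac v b); rewrite E => /fev_tofrac_eq ->.
  by rewrite mevalM.
apply: (@mulIf _ (tofrac b)); first by rewrite tofrac_eq0.
by rewrite E -pb tofracM.
Qed.

Section PolyRat.
Variable n : nat.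
Implicit Types (p q : {mpoly rat[n]}) (v : 'I_n -> rat).

Lemma meval_msym (s : 'S_n) p v : (msym s p).@[v] = p.@[v \o s].
Proof.
rewrite /msym /mmap raddf_sum /= mevalE; apply: eq_bigr => m _.
rewrite mevalM mevalC; congr (_ * _).
rewrite /mmap1 (rmorph_prod (meval v)); apply: eq_bigr => i _.
by rewrite rmorphXn /= mevalXU.
Qed.

Lemma sym_mevalP p : reflect (forall (s : 'S_n) v, p.@[v \o s] = p.@[v]) (p \is symmetric).
Proof.
apply: (iffP (issymP p)) => [ps s v|ps s]; first by rewrite -meval_msym ps.
apply/eqP; rewrite -subr_eq0; apply/eqP/meval_eq0 => v.
by rewrite mevalB meval_msym ps subrr.
Qed.

(** Points are given as a list, so that a symmetric polynomial can be compared on permuted lists and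
    evaluated on blocks of any index set; entries beyond the end of the list count as 0. *)
Definition pev p (s : seq rat) : rat := p.@[fun i => s`_i].

Lemma pev_perm p (s t : seq rat) : p \is symmetric -> size s = n ->
  perm_eq s t -> pev p s = pev p t.
Proof.
move=> psym sn st; have tn : size t = n by rewrite -(perm_size st).
have /tuple_permP[g gE] : perm_eq (Tuple (introT eqP sn)) (Tuple (introT eqP tn)) by [].
have /sym_mevalP psym' := psym.
rewrite /pev -(psym' g (fun i => t`_i)); apply: meval_eq => i /=.
rewrite /= in gE; rewrite gE.
by rewrite (nth_map i) ?size_enum_ord // nth_ord_enum (tnth_nth 0).
Qed.

Lemma pev_codom p v : pev p [seq v i | i <- enum 'I_n] = p.@[v].
Proof.
apply: meval_eq => i.
by rewrite (nth_map i) ?size_enum_ord // nth_ord_enum.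
Qed.

Definition glue (i j : 'I_n) : n.-tuple {mpoly rat[n]} :=
  [tuple if k == i then 'X_j else 'X_k | k < n].

Lemma meval_glue i j p v :
  (p \mPo glue i j).@[v] = p.@[fun k => if k == i then v j else v k].
Proof.
rewrite comp_mpoly_meval; apply: meval_eq => k; rewrite tnth_mktuple.
by case: eqP; rewrite mevalXU.
Qed.

(** Reduction modulo ['X_i - 'X_j]: the polynomials with this property include constants and
    variables and are closed under sums and products. *)
Lemma glue_modulo i j p : exists q, p = p \mPo glue i j + ('X_i - 'X_j) * q.
Proof.
pose S p := exists q, p = p \mPo glue i j + ('X_i - 'X_j) * q.
have SC c : S c%:MP by exists 0; rewrite comp_mpolyC mulr0 addr0.
have SX k : S 'X_k.
  rewrite /S comp_mpolyXU -tnth_nth tnth_mktuple.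
  case: eqP => [->|_]; last by exists 0; rewrite mulr0 addr0.
  by exists 1; rewrite mulr1 addrC subrK.
have SM r s : S r -> S s -> S (r * s).
  move=> [a ea] [b eb]; rewrite /S rmorphM /=.
  exists (a * s + (r \mPo glue i j) * b).
  have gen (A : comRingType) (u w ug wg a' b' x : A) : u = ug + x * a' ->
      w = wg + x * b' -> u * w = ug * wg + x * (a' * w + ug * b').
    by move=> -> ->; ring.
  exact: gen.
have SD r s : S r -> S s -> S (r + s).
  by move=> [a ea] [b eb]; exists (a + b); rewrite rmorphD /= mulrDr addrACA -ea -eb.
elim/mpolyind: p => [|c m p _ _ Sp]; first by rewrite -mpolyC0; apply: SC.
apply: (SD) => //; rewrite -mul_mpolyC; apply: (SM) => //.
rewrite mpolyXE_id; apply: (big_ind S) => [|r s|k _]; [exact: (SC 1)|exact: SM|].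
by elim: (m k) => [|e IH]; [exact: (SC 1)|rewrite exprS; apply: SM].
Qed.

Definition ltpair (x : 'I_n * 'I_n) := (x.1 < x.2)%N.

(** One factor is divided out at a time. Vanishing on [v i = v j] gives the first factor by
    [glue_modulo]; the quotient still vanishes on each other hyperplane, where that factor is not
    identically zero. *)
Lemma prod_pairs_dvd (r : seq ('I_n * 'I_n)) p : uniq r -> all ltpair r ->
  (forall x v, x \in r -> v x.1 = v x.2 -> p.@[v] = 0) ->
  exists q, p = (\prod_(x <- r) ('X_x.2 - 'X_x.1)) * q.
Proof.
elim: r p => [|[i j] r IH] p /=; first by exists p; rewrite big_nil mul1r.
move=> /andP[ijr ur] /andP[/= ltij lr] pv.
have pg0 : p \mPo glue i j = 0.
  apply: meval_eq0 => v; rewrite meval_glue; apply: (pv (i, j)) => /=.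
    by rewrite inE eqxx.
  by rewrite eqxx; case: eqP.
have [q pE] := glue_modulo i j p; move: pE; rewrite pg0 add0r => pE.
have [||x v xr vx|q' qE] // := IH (- q).
  case: x xr vx => k l /= xr vkl.
  have /= ltkl := allP lr _ xr; rewrite /ltpair /= in ltkl ltij.
  suff qg0 : q \mPo glue k l = 0.
    have := meval_glue k l q v; rewrite qg0 meval0 mevalN => e.
    rewrite -[RHS]oppr0 [X in _ = - X]e; congr (- _); apply: meval_eq => h.
    by case: eqP => // ->.
  (* The first factor restricted to the hyperplane [v k = v l]; it is nonzero because the two pairs
     are distinct and increasing. *)
  pose D := ('X_i - 'X_j) \mPo glue k l.
  apply: (@meval_eq0_generic _ D) => [|w Dw].
    rewrite /D rmorphB /= !comp_mpolyXU -!tnth_nth !tnth_mktuple subr_eq0.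
    apply/negP => /eqP.
    have XI (a b : 'I_n) : 'X_a = 'X_b :> {mpoly rat[n]} -> a = b.
      move=> /(congr1 (mcoeff U_(a)%MM)); rewrite !mcoeffXU eqxx.
      by case: eqP => // _ /eqP; rewrite oner_eq0.
    have nij : (i == j) = false by apply/eqP => e; rewrite e ltnn in ltij.
    have [ik|ik] := eqVneq i k; have [jk|jk] := eqVneq j k.
    - by rewrite ik jk eqxx in nij.
    - by move=> /XI lj; case/negP: ijr; rewrite ik -lj.
    - by move=> /XI il; move: ltij ltkl; rewrite il jk; lia.
    - by move=> /XI /eqP; rewrite nij.
  rewrite meval_glue; move: Dw; rewrite /D meval_glue.
  set w' := fun h => _ => Dw.
  have : p.@[w'] = 0.
    apply: (pv (k, l)); first by rewrite inE xr orbT.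
    by rewrite /w' /= eqxx; case: eqP.
  by rewrite pE mevalM => /eqP; rewrite mulf_eq0 (negPf Dw) => /eqP.
by exists q'; rewrite big_cons /= -mulrA -qE pE mulrN -mulNr opprB.
Qed.

Definition vdm : {mpoly rat[n]} := \prod_(x | ltpair x) ('X_x.2 - 'X_x.1).

Lemma vdm_meval v : vdm.@[v] = \prod_(x | ltpair x) (v x.2 - v x.1).
Proof.
rewrite (rmorph_prod (meval v)); apply: eq_bigr => x _.
by rewrite /= mevalB !mevalXU.
Qed.

Lemma vdm_meval_neq0 v : injective v -> vdm.@[v] != 0.
Proof.
move=> vI; rewrite vdm_meval; apply/prodf_neq0 => -[i j] /= ltij.
by rewrite subr_eq0; apply/eqP => /vI e; rewrite /ltpair /= e ltnn in ltij.
Qed.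

Lemma vdm_neq0_inj v : vdm.@[v] != 0 -> injective v.
Proof.
rewrite vdm_meval => /prodf_neq0 nz i j vij; apply/val_inj/eqP.
have [lt|lt|//] := ltngtP i j.
  by have := nz (i, j) lt; rewrite /= vij subrr eqxx.
by have := nz (j, i) lt; rewrite /= vij subrr eqxx.
Qed.

Lemma vdm_neq0 : vdm != 0.
Proof.
apply: contraTneq isT => e.
have : injective (fun i : 'I_n => (val i)%:R : rat).
  by move=> i j /eqP; rewrite eqr_nat => /eqP /val_inj.
by move=> /vdm_meval_neq0; rewrite e meval0 eqxx.
Qed.

Lemma vdm_perm (s : 'S_n) v : vdm.@[v \o s] = (-1) ^+ s * vdm.@[v].
Proof.
have E w : vdm.@[w] = \det (Vandermonde n (\row_i w i)).
  rewrite det_Vandermonde vdm_meval pair_big_dep /=.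
  by apply: eq_bigr => x _; rewrite !mxE.
rewrite !E; have -> : Vandermonde n (\row_i (v \o s) i) =
    col_perm s (Vandermonde n (\row_i v i)).
  by apply/matrixP => i j; rewrite !mxE.
by rewrite col_permE det_mulmx det_perm odd_permV mulrC.
Qed.

(** At a point with equal coordinates [i] and [j] the transposition changes nothing, so the value
    equals its opposite. *)
Lemma antisym_vdm_dvd p :
  (forall i j v, i != j -> p.@[v \o tperm i j] = - p.@[v]) -> exists q, p = vdm * q.
Proof.
move=> panti; have [||x v xr vx|q ->] :=
  @prod_pairs_dvd (enum [pred x | ltpair x]) p.
- exact: enum_uniq.
- by apply/allP => x; rewrite mem_enum inE.
- move: xr; rewrite mem_enum inE => ltx.
  have neq : x.1 != x.2 by apply/eqP => e; rewrite /ltpair e ltnn in ltx.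
  have := panti _ _ v neq; rewrite (@meval_eq _ _ (v \o tperm x.1 x.2) v); last first.
    by move=> i /=; case: tpermP => [->|->|].
  by move/eqP; rewrite -addr_eq0 -mulr2n mulrn_eq0 => /eqP.
- by exists q; rewrite big_enum.
Qed.

End PolyRat.

Section PairProducts.
Variables (R : comPzRingType) (n : nat).
Implicit Types (h : 'I_n -> 'I_n -> R) (I J : {set 'I_n}).

Definition crossprod h J J' : R := \prod_(j in J) \prod_(k in J') h j k.

Definition pairprod h J : R :=
  \prod_(x : 'I_n * 'I_n | [&& x.1 \in J, x.2 \in J & ltpair x]) h x.1 x.2.

(** In [pairprod] the mixed pairs, with one index in [J] and one outside, are taken in increasing
    order; as [h] need not be symmetric, the cross factor has to restore that order. *)
Lemma pairprod_split h I J : J \subset I ->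
  pairprod h I = pairprod h J * pairprod h (I :\: J) *
    crossprod (fun i j => if (i < j)%N then h i j else h j i) J (I :\: J).
Proof.
move=> /subsetP JI; rewrite /pairprod (bigID (fun x => x.1 \in J)) /=.
rewrite [X in X * _](bigID (fun x => x.2 \in J)) [X in _ * X](bigID (fun x => x.2 \in J)) /=.
have ac (A B C D E : R) : B * C = E -> A * B * (C * D) = A * D * E.
  by move=> <-; ring.
rewrite (ac _ _ _ _ (crossprod (fun i j => if (i < j)%N then h i j else h j i) J (I :\: J))).
  congr (_ * _ * _); apply: eq_bigl => -[i j] /=; rewrite ?inE.
    case: (boolP (i \in J)) => iJ; last by rewrite /= andbF.
    by case: (boolP (j \in J)) => jJ; rewrite ?andbF //= (JI _ iJ) (JI _ jJ) !andbT.
  by case: (i \in J); case: (j \in J); rewrite ?andbF ?andbT.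
rewrite /crossprod pair_big /= [RHS](bigID (@ltpair n)) /=; congr (_ * _).
  rewrite big_mkcond [RHS]big_mkcond; apply: eq_bigr => -[i j] _ /=; rewrite !inE.
  rewrite /ltpair /=; have [iJ|] := boolP (i \in J); last by rewrite /= !andbF.
  by rewrite (JI _ iJ) andbT /=; case: (j \in J); case: (j \in I); case: (i < j)%N.
rewrite (reindex_inj (inv_inj (_ : involutive (fun x : 'I_n * 'I_n => (x.2, x.1))))) /=;
  last by case.
rewrite big_mkcond [RHS]big_mkcond; apply: eq_bigr => -[i j] _ /=; rewrite !inE.
rewrite /ltpair /=; have [iJ|] := boolP (i \in J); last by rewrite /= !andbF.
rewrite (JI _ iJ) /=; have [//|jJ] /= := boolP (j \in J); rewrite ?andbF //.
have [jI|] := boolP (j \in I) => //=; rewrite !andbT -leqNgt ltn_neqAle.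
case: (ltngtP j i) => //= e; by move: jJ; rewrite (val_inj e) iJ.
Qed.

End PairProducts.

(** * Shuffles and finite sets of points *)

Section Points.
Variable n : nat.
Implicit Types (v : 'I_n -> rat) (I J : {set 'I_n}).

Definition pts v J : seq rat := [seq v i | i <- enum J].

Lemma size_pts v J : size (pts v J) = #|J|.
Proof. by rewrite size_map -cardE. Qed.

Lemma eq_pts v w J : {in J, v =1 w} -> pts v J = pts w J.
Proof. by move=> vw; apply/eq_in_map => i; rewrite mem_enum => /vw. Qed.

Lemma meval_pts (f : {mpoly rat[n]}) v : pev f (pts v setT) = f.@[v].
Proof.
rewrite -pev_codom /pts; congr (pev _ (map _ _)).
by apply: eq_enum => i; rewrite inE.
Qed.

End Points.

Lemma pts_imset k n (phi : 'I_k -> 'I_n) (v : 'I_n -> rat) (J : {set 'I_k}) :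
  injective phi -> perm_eq (pts (v \o phi) J) (pts v (phi @: J)).
Proof.
move=> phiI; rewrite /pts (map_comp v phi); apply: perm_map.
apply: uniq_perm; rewrite ?enum_uniq //; first by rewrite map_inj_uniq ?enum_uniq.
move=> i; rewrite mem_enum; apply/mapP/imsetP => -[j jJ ->]; exists j => //.
  by rewrite -mem_enum.
by rewrite mem_enum.
Qed.

Lemma pev_imset d k n (f : {mpoly rat[d]}) (phi : 'I_k -> 'I_n) v (J : {set 'I_k}) :
  f \is symmetric -> injective phi -> #|J| = d ->
  pev f (pts (v \o phi) J) = pev f (pts v (phi @: J)).
Proof.
by move=> fs phiI Jd; apply: pev_perm => //; [rewrite size_pts|apply: pts_imset].
Qed.

Lemma crossprod_imset (R : comPzRingType) k n (phi : 'I_k -> 'I_n) h (J J' : {set 'I_k}) :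
  injective phi -> crossprod (fun i j => h (phi i) (phi j)) J J' =
  crossprod h (phi @: J) (phi @: J') :> R.
Proof.
move=> phiI; rewrite /crossprod big_imset /=; last by move=> ? ? _ _ /phiI.
apply: eq_bigr => i _; rewrite big_imset //=; by move=> ? ? _ _ /phiI.
Qed.

Lemma sum_imset_sub (R : nmodType) (T T' : finType) (phi : T -> T') (F : {set T'} -> R) :
  injective phi ->
  \sum_(J : {set T'} | J \subset phi @: setT) F J = \sum_(J : {set T}) F (phi @: J).
Proof.
move=> phiI.
transitivity (\sum_(J in (fun J : {set T} => phi @: J) @: setT) F J); last first.
  rewrite big_imset /=; last by move=> J J' _ _; apply: imset_inj.
  by apply: eq_bigl => J; rewrite inE.
apply: eq_bigl => J; apply/idP/imsetP => [JT|[J' _ ->]]; last first.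
  by apply: imsetS; apply/subsetP => i _; rewrite inE.
exists (phi @^-1: J); first by rewrite inE.
apply/setP => i; apply/idP/imsetP => [iJ|[j]]; last by rewrite inE => ? ->.
have /imsetP[j _ ij] := subsetP JT i iJ.
by exists j; rewrite // inE -ij.
Qed.

Section Shuffles.
Variables (a b n : nat).
Implicit Types p : {ffun 'I_a + 'I_b -> 'I_n}.

Lemma incr_inj k (f : 'I_k -> 'I_n) :
  (forall i j : 'I_k, (i < j)%N -> (f i < f j)%N) -> injective f.
Proof.
move=> finc i j e; apply/val_inj/eqP.
by have [/finc|/finc|//] := ltngtP i j; rewrite e ltnn.
Qed.

(** An increasing map lists its image in sorted order. *)
Lemma incr_unique k (f g : 'I_k -> 'I_n) :
  (forall i j : 'I_k, (i < j)%N -> (f i < f j)%N) ->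
  (forall i j : 'I_k, (i < j)%N -> (g i < g j)%N) ->
  f @: setT = g @: setT -> f =1 g.
Proof.
move=> finc ginc fg.
have srt (h : 'I_k -> 'I_n) : (forall i j : 'I_k, (i < j)%N -> (h i < h j)%N) ->
    sorted (fun i j : 'I_n => (i < j)%N) [seq h i | i <- enum 'I_k].
  move=> hinc; rewrite sorted_map.
  apply: (@sub_sorted _ (relpre val ltn)) => [i j /= /hinc //|].
  by rewrite -sorted_map val_enum_ord iota_ltn_sorted.
have [tr irr] : transitive (fun i j : 'I_n => (i < j)%N) /\
    irreflexive (fun i j : 'I_n => (i < j)%N).
  by split=> [y x z|x]; [exact: ltn_trans|rewrite ltnn].
have := irr_sorted_eq tr irr (srt f finc) (srt g ginc); move=> e i.
suff /eq_in_map : [seq f i | i <- enum 'I_k] = [seq g i | i <- enum 'I_k].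
  by apply; rewrite mem_enum.
apply: e => x; have mE h : (x \in [seq h i | i <- enum 'I_k]) = (x \in h @: setT).
  apply/mapP/imsetP => -[j _ ->]; exists j => //; by rewrite ?mem_enum ?inE.
by rewrite !mE fg.
Qed.

Lemma incr_enum_val (J : {set 'I_n}) k (c : k = #|J|) (i j : 'I_k) : (i < j)%N ->
  (enum_val (cast_ord c i) < enum_val (cast_ord c j))%N.
Proof.
move=> ij; have x0 : 'I_n := enum_val (cast_ord c i).
rewrite !(enum_val_nth x0) /=.
have srt : sorted (fun i j : 'I_n => (i < j)%N) (enum J).
  rewrite {1}/enum_mem -enumT; apply: sorted_filter; first by move=> ? ? ?; apply: ltn_trans.
  by rewrite -[sorted _ _](@sorted_map _ _ val ltn) val_enum_ord iota_ltn_sorted.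
apply: (sorted_ltn_nth _ x0 srt) => //; first by move=> ? ? ?; apply: ltn_trans.
  by rewrite inE -cardE -c.
by rewrite inE -cardE -c.
Qed.

Lemma shuffleP p : reflect [/\ injective p,
   (forall i j : 'I_a, (i < j)%N -> (p (inl i) < p (inl j))%N) &
   (forall i j : 'I_b, (i < j)%N -> (p (inr i) < p (inr j))%N)] (shuffle p).
Proof.
apply: (iffP and3P) => [[/injectiveP pI pl pr]|[pI pl pr]]; split=> //.
- by move=> i j ij; have /forallP/(_ j)/implyP := forallP pl i; apply.
- by move=> i j ij; have /forallP/(_ j)/implyP := forallP pr i; apply.
- exact/injectiveP.
- by apply/forallP => i; apply/forallP => j; apply/implyP; apply: pl.
- by apply/forallP => i; apply/forallP => j; apply/implyP; apply: pr.
Qed.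

Definition lblock p : {set 'I_n} := [set p (inl i) | i in setT].

Hypothesis nE : n = (a + b)%N.

Lemma shuffle_inj p : shuffle p -> injective p.
Proof. by case/shuffleP. Qed.

Lemma rblockE p : injective p -> ~: lblock p = [set p (inr i) | i in setT].
Proof.
move=> pI; have cl : #|lblock p| = a.
  rewrite card_imset ?cardsT ?card_ord // => i j /pI []; exact.
have cr : #|[set p (inr i) | i in setT]| = b.
  rewrite card_imset ?cardsT ?card_ord // => i j /pI []; exact.
apply/esym/eqP; rewrite eqEcard; apply/andP; split; last first.
  by rewrite cardsCs setCK cl cr card_ord leq_subLR -nE.
apply/subsetP => x /imsetP[i _ ->]; rewrite inE; apply/imsetP => -[j _ /pI].
by [].
Qed.

Lemma card_lblock p : shuffle p -> #|lblock p| = a.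
Proof.
by move=> /shuffleP[pI _ _]; rewrite card_imset ?cardsT ?card_ord // => i j /pI [].
Qed.

Lemma shuffle_of_set (J : {set 'I_n}) : #|J| = a ->
  exists2 p, shuffle p & lblock p = J.
Proof.
move=> Ja; have Jb : b = #|~: J| by rewrite cardsCs setCK card_ord Ja; lia.
pose p : {ffun 'I_a + 'I_b -> 'I_n} := [ffun x => match x with
  | inl i => enum_val (cast_ord (esym Ja) i) | inr i => enum_val (cast_ord Jb i) end].
have plJ : lblock p = J.
  apply/setP => x; apply/imsetP/idP => [[i _ ->]|xJ]; first by rewrite ffunE enum_valP.
  exists (cast_ord Ja (enum_rank_in xJ x)) => //; rewrite ffunE cast_ordK.
  by rewrite enum_rankK_in.
exists p => //; apply/shuffleP.
have il (i j : 'I_a) : (i < j)%N -> (p (inl i) < p (inl j))%N.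
  by move=> ij; rewrite !ffunE; apply: incr_enum_val.
have ir (i j : 'I_b) : (i < j)%N -> (p (inr i) < p (inr j))%N.
  by move=> ij; rewrite !ffunE; apply: incr_enum_val.
split=> // -[i|i] [j|j].
- by move=> /(incr_inj il) ->.
- rewrite !ffunE => e; have := enum_valP (cast_ord Jb j); rewrite -e inE.
  by rewrite enum_valP.
- rewrite !ffunE => e; have := enum_valP (cast_ord Jb i); rewrite e inE.
  by rewrite enum_valP.
- by move=> /(incr_inj ir) ->.
Qed.

(** A shuffle is increasing on both blocks, hence determined by the image of its first block, and
    every set of [a] indices occurs. *)
Lemma sum_shuffle (R : nmodType) (F : {set 'I_n} -> R) :
  \sum_(p : {ffun 'I_a + 'I_b -> 'I_n} | shuffle p) F (lblock p) =
  \sum_(J : {set 'I_n} | #|J| == a) F J.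
Proof.
rewrite -big_imset /=; last first.
  move=> p q ps qs e; have [/shuffleP[_ pl pr] /shuffleP[_ ql qr]] := (ps, qs).
  apply/ffunP => -[i|i]; first exact: (incr_unique pl ql).
  apply: (incr_unique pr qr); rewrite -!rblockE ?e //; exact: shuffle_inj.
apply: eq_bigl => J; apply/imsetP/eqP => [[p ps ->]|/shuffle_of_set[p ps <-]].
  exact: card_lblock.
by exists p.
Qed.

Lemma lblock_pev (f : {mpoly rat[a]}) (v : 'I_n -> rat) p : f \is symmetric ->
  injective p -> f.@[fun i => v (p (inl i))] = pev f (pts v (lblock p)).
Proof.
move=> fs pI; rewrite -(meval_pts f).
by apply: (pev_imset (phi := fun i => p (inl i))) => // [i j /pI[]//|]; rewrite cardsT card_ord.
Qed.

Lemma rblock_pev (f : {mpoly rat[b]}) (v : 'I_n -> rat) p : f \is symmetric ->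
  injective p -> f.@[fun i => v (p (inr i))] = pev f (pts v (~: lblock p)).
Proof.
move=> fs pI; rewrite rblockE //.
rewrite -(meval_pts f).
by apply: (pev_imset (phi := fun i => p (inr i))) => // [i j /pI[]//|]; rewrite cardsT card_ord.
Qed.

Lemma block_cross (R : comPzRingType) (h : 'I_n -> 'I_n -> R) p : injective p ->
  \prod_(i < a) \prod_(j < b) h (p (inl i)) (p (inr j)) =
  crossprod h (lblock p) (~: lblock p).
Proof.
move=> pI; rewrite rblockE //.
rewrite /crossprod big_imset /=; last by move=> ? ? _ _ /pI[].
apply: eq_big => [i|i _]; first by rewrite inE.
rewrite big_imset /=; last by move=> ? ? _ _ /pI[].
by apply: eq_bigl => j; rewrite inE.
Qed.

End Shuffles.

Arguments dinj {I} V i v : simpl never.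

Lemma dinjE (I : choiceType) (V : I -> lmodType rat) i (x : V i) : dinj V i x i = x.
Proof. by rewrite /dinj /= /dinj_fun; case: eqP => // e; rewrite (eq_axiomK e). Qed.

Lemma dinj_neq (I : choiceType) (V : I -> lmodType rat) i j (x : V i) :
  i <> j -> dinj V i x j = 0.
Proof. by move=> ij; rewrite /dinj /= /dinj_fun; case: eqP. Qed.

Lemma dsum_sumE (I : choiceType) (V : I -> lmodType rat) T (r : seq T) (P : pred T)
    (F : T -> dsum V) i : (\sum_(k <- r | P k) F k) i = \sum_(k <- r | P k) F k i.
Proof. by apply: (big_morph (fun f : dsum V => f i)). Qed.

Lemma dinj_is_linear (I : choiceType) (V : I -> lmodType rat) i : linear (dinj V i).
Proof.
move=> c x y; apply: dsumP => j.
rewrite -[RHS]/(c *: dinj V i x j + dinj V i y j); have [<-|ij] := pselect (i = j).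
  by rewrite !dinjE.
by rewrite !dinj_neq // scaler0 addr0.
Qed.

HB.instance Definition _ (I : choiceType) (V : I -> lmodType rat) i :=
  GRing.isLinear.Build rat (V i) (dsum V) *:%R (dinj V i) (@dinj_is_linear I V i).

Lemma dinj_inj (I : choiceType) (V : I -> lmodType rat) i : injective (dinj V i).
Proof. by move=> x y /(congr1 (fun f : dsum V => f i)); rewrite !dinjE. Qed.

Lemma dsum_bound (V : nat -> lmodType rat) (f : dsum V) :
  exists B, forall i, (B <= i)%N -> f i = 0.
Proof.
have /asboolP/finite_seqP[s sE] := dsum_fin f; exists (\max_(i <- s) i).+1 => i lt.
apply: contrapT => nz; have : i \in s.
  have : [set i | f i <> 0]%classic i by [].
  by rewrite sE.
by move=> si; have := @leq_bigmax_seq _ s xpredT id i si isT; rewrite leqNgt lt.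
Qed.

Lemma dsum_bound2 (V W : nat -> lmodType rat) (f : dsum V) (g : dsum W) :
  exists B, (forall i, (B <= i)%N -> f i = 0) /\ (forall i, (B <= i)%N -> g i = 0).
Proof.
have [B fB] := dsum_bound f; have [C gC] := dsum_bound g.
by exists (maxn B C); split=> i; rewrite geq_max => /andP[/fB ? /gC ?].
Qed.

Lemma fsum_nat (V : nmodType) (F : nat -> V) B : (forall i, (B <= i)%N -> F i = 0) ->
  \sum_(i \in [set: nat]%classic) F i = \sum_(i < B) F i.
Proof.
move=> F0; rewrite fsbig_ord; apply/esym/fsbig_widen => // i [_ /= /negP].
by rewrite -leqNgt => /F0.
Qed.

Lemma dsum_decomp (V : nat -> lmodType rat) (f : dsum V) B :
  (forall i, (B <= i)%N -> f i = 0) -> f = \sum_(i < B) dinj V i (f i).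
Proof.
move=> fB; apply: dsumP => j; rewrite dsum_sumE; have [jB|jB] := ltnP j B; last first.
  rewrite fB // big1 // => i _; rewrite dinj_neq // => ij.
  by have := ltn_ord i; rewrite ij ltnNge jB.
rewrite (bigD1 (Ordinal jB)) // dinjE big1 => [|i ij]; first exact/esym/addr0.
rewrite dinj_neq // => e; case/negP: ij; exact/eqP/val_inj.
Qed.

Section PairMorph.
Variables (R S : comPzRingType) (phi : {rmorphism R -> S}) (n : nat).

Lemma rmorph_pairprod (h : 'I_n -> 'I_n -> R) J :
  phi (pairprod h J) = pairprod (fun i j => phi (h i j)) J.
Proof. exact: rmorph_prod. Qed.

Lemma rmorph_crossprod (h : 'I_n -> 'I_n -> R) J J' :
  phi (crossprod h J J') = crossprod (fun i j => phi (h i j)) J J'.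
Proof. by rewrite rmorph_prod; apply: eq_bigr => i _; rewrite rmorph_prod. Qed.

End PairMorph.

Lemma crossprodM (R : comPzRingType) n (h k : 'I_n -> 'I_n -> R) (J J' : {set 'I_n}) :
  crossprod (fun i j => h i j * k i j) J J' = crossprod h J J' * crossprod k J J'.
Proof. by rewrite -big_split /=; apply: eq_bigr => i _; rewrite -big_split. Qed.

Lemma eq_crossprod (R : comPzRingType) n (h k : 'I_n -> 'I_n -> R) (J J' : {set 'I_n}) :
  (forall i j, i \in J -> j \in J' -> h i j = k i j) -> crossprod h J J' = crossprod k J J'.
Proof. by move=> hk; apply: eq_bigr => i iJ; apply: eq_bigr => j jJ; apply: hk. Qed.

Lemma crossprodX (R : comPzRingType) n (h : 'I_n -> 'I_n -> R) (J J' : {set 'I_n}) m :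
  crossprod (fun i j => h i j ^+ m) J J' = crossprod h J J' ^+ m.
Proof. by rewrite /crossprod -prodrXl; apply: eq_bigr => i _; rewrite prodrXl. Qed.

Lemma eq_pairprod (R : comPzRingType) n (h k : 'I_n -> 'I_n -> R) (J : {set 'I_n}) :
  (forall i j, i \in J -> j \in J -> h i j = k i j) -> pairprod h J = pairprod k J.
Proof. by move=> hk; apply: eq_bigr => -[i j] /and3P[iJ jJ _]; apply: hk. Qed.

(* A symmetric function whose product with the Vandermonde determinant is
   polynomial is polynomial: that product is antisymmetric. *)
Lemma sym_integral n (c : ('I_n -> rat) -> rat) (N : {mpoly rat[n]}) :
  (forall v, injective v -> N.@[v] = c v * (vdm n).@[v]) ->
  (forall (s : 'S_n) v, injective v -> c (v \o s) = c v) ->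
  exists2 P : {mpoly rat[n]}, P \is symmetric & forall v, injective v -> P.@[v] = c v.
Proof.
move=> Nc csym; have [i j v ij|P PE] := @antisym_vdm_dvd n N.
  apply/eqP; rewrite -addr_eq0 -meval_msym -mevalD; apply/eqP.
  suff -> : msym (tperm i j) N + N = 0 by rewrite meval0.
  apply: (meval_eq0_generic (vdm_neq0 n)) => w /vdm_neq0_inj wI.
  rewrite mevalD meval_msym !Nc //; last by apply: inj_comp => //; apply: perm_inj.
  by rewrite csym // vdm_perm odd_tperm ij expr1; ring.
have Pc v : injective v -> P.@[v] = c v.
  move=> vI; have := Nc v vI; rewrite PE mevalM mulrC; apply: mulIf.
  exact: vdm_meval_neq0.
exists P => //; apply/sym_mevalP => s v; rewrite -meval_msym.
congr (_ .@[ v]); apply: (meval_ext_generic (vdm_neq0 n)) => w /vdm_neq0_inj wI.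
by rewrite meval_msym !Pc ?csym //; apply: inj_comp => //; apply: perm_inj.
Qed.

Lemma of_fracE n (S : submodClosed {mpoly rat[n]}) (u : ratfrac n) P :
  P \in S -> u = tofrac P -> val (of_frac S u) = P.
Proof.
move=> PS ->; rewrite /of_frac.
have := @xgetPex _ 0 [set p : subsp S | tofrac (val p) = tofrac P]%classic.
case/(_ (ex_intro _ (insp PS) erefl)) => /eqP.
by rewrite tofrac_eq => /eqP.
Qed.

Section PolyBlocks.
Variables (n d : nat) (f : {mpoly rat[d]}).

Definition polblock (J : {set 'I_n}) : {mpoly rat[n]} :=
  f \mPo [tuple [seq 'X_i | i <- enum J]`_k | k < d].

Lemma meval_polblock J v : (polblock J).@[v] = pev f (pts v J).
Proof.
rewrite comp_mpoly_meval; apply: meval_eq => k; rewrite tnth_mktuple /pts.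
have [lt|ge] := ltnP k (size (enum J)); last by rewrite !nth_default ?size_map ?meval0.
have x0 : 'I_n by case: (enum J) lt.
by rewrite !(nth_map x0) // mevalXU.
Qed.

End PolyBlocks.

Section HmulValues.
Variable m : nat.

Definition hker n (v : 'I_n -> rat) (j k : 'I_n) : rat := (v k - v j) ^ (m%:Z - 1).

Lemma exprz_mulX (x : rat) : x != 0 -> x ^ (m%:Z - 1) * x = x ^+ m.
Proof. by move=> x0; rewrite -[X in _ * X]expr1z -expfzDr // subrK. Qed.

(* The product of the kernel with the Vandermonde determinant is polynomial,
   including for m = 0, where the kernel itself is not. *)
Definition kerpoly n (J : {set 'I_n}) : {mpoly rat[n]} :=
  let X (j k : 'I_n) : {mpoly rat[n]} := 'X_k - 'X_j in
  crossprod X J (~: J) ^+ m * (pairprod X J * pairprod X (~: J) *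
    crossprod (fun j k : 'I_n => if (j < k)%N then 1 else -1) J (~: J)).

(** Each mixed pair of [J] and its complement contributes one factor to the Vandermonde determinant,
    which raises the exponent [m - 1] of the kernel to [m]; [sg] corrects the pairs that occur in
    decreasing order. *)
Lemma meval_kerpoly n (J : {set 'I_n}) v : injective v ->
  (kerpoly J).@[v] = crossprod (hker v) J (~: J) * (vdm n).@[v].
Proof.
move=> vI; rewrite /kerpoly; set X := fun _ => _; set sg := fun _ => _.
have -> : (vdm n).@[v] = (pairprod X setT).@[v].
  by congr (_ .@[ v]); apply: eq_bigl => x; rewrite !inE.
rewrite (pairprod_split _ (subsetT J)) setTD !mevalM.
have -> : (crossprod (fun i j => if (i < j)%N then X i j else X j i) J (~: J)) =
    crossprod X J (~: J) * crossprod sg J (~: J).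
  rewrite -crossprodM; apply: eq_crossprod => i j _ _; rewrite /X /sg.
  by case: (i < j)%N; rewrite ?mulr1 // mulrN1 opprB.
rewrite mevalM rmorphXn /=.
set A := (crossprod X _ _).@[v]; set B := (crossprod sg _ _).@[v].
have -> : A ^+ m = crossprod (hker v) J (~: J) * A.
  rewrite /A -rmorphXn -crossprodX !rmorph_crossprod -crossprodM.
  apply: eq_crossprod => i j iJ; rewrite inE => jJ.
  rewrite rmorphXn /= mevalB !mevalXU exprz_mulX // subr_eq0.
  by apply: contraNneq jJ => /vI ->.
by ring.
Qed.

Section Comp.
Variables (d1 d2 n : nat) (f : {mpoly rat[d1]}) (g : {mpoly rat[d2]}).

Definition hsum n (v : 'I_n -> rat) : rat := \sum_(J : {set 'I_n} | #|J| == d1)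
  pev f (pts v J) * pev g (pts v (~: J)) * crossprod (hker v) J (~: J).

Hypotheses (fs : f \is symmetric) (gs : g \is symmetric).

Lemma card_setC_eq (J : {set 'I_n}) : n = (d1 + d2)%N -> #|J| = d1 -> #|~: J| = d2.
Proof. by move=> nE Jd; rewrite cardsCs setCK card_ord Jd; lia. Qed.

Lemma hsum_integral : n = (d1 + d2)%N ->
  exists2 P : {mpoly rat[n]}, P \is symmetric & forall v, injective v -> P.@[v] = hsum v.
Proof.
move=> nE.
pose N := \sum_(J : {set 'I_n} | #|J| == d1) polblock f J * polblock g (~: J) * kerpoly J.
apply: (@sym_integral n (@hsum n) N) => [v vI|s v vI].
  rewrite raddf_sum mulr_suml; apply: eq_bigr => J _.
  by rewrite /= mevalM meval_kerpoly // mevalM !meval_polblock; ring.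
rewrite /hsum.
have sC (J : {set 'I_n}) : s @: (~: J) = ~: (s @: J).
  apply/setP => i; rewrite -[i](permKV s) inE !mem_imset ?inE //; exact: perm_inj.
apply/esym; rewrite big_mkcond [RHS]big_mkcond /= (reindex_inj (imset_inj (@perm_inj _ s))) /=.
apply: eq_bigr => J _; rewrite card_imset; last exact: perm_inj.
case: eqP => // Jd; have Jd' := card_setC_eq nE Jd.
rewrite -sC -!(pev_imset _ _ (@perm_inj _ s)) // -crossprod_imset //; exact: perm_inj.
Qed.

Lemma hmul_frac_fev (v : 'I_(d1 + d2) -> rat) : injective v ->
  fev v (hmul_frac m f g) (hsum v).
Proof.
move=> vI; rewrite /hsum -(@sum_shuffle d1 d2 (d1 + d2)%N erefl _
  (fun J => pev f (pts v J) * pev g (pts v (~: J)) * crossprod (hker v) J (~: J))).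
apply: fev_sum => p ps.
rewrite -(lblock_pev _ fs (shuffle_inj ps)) -(@rblock_pev _ _ _ erefl _ _ _ gs (shuffle_inj ps)).
rewrite -(@block_cross _ _ _ erefl _ _ _ (shuffle_inj ps)) exchange_big /=.
apply: fevM.
  by apply: fevM; apply: fev_evalf => i; apply: fev_fvar.
apply: fev_prod => l _; apply: fev_prod => k _; apply: fevXz.
  rewrite subr_eq0; apply/eqP => /vI; case/shuffleP: ps => pI _ _.
  by move/pI.
by apply: fevB; apply: fev_fvar.
Qed.

End Comp.

(** [hsum_integral] provides a polynomial with these values, so [of_frac] finds it and does not fall
    back on its default. *)
Lemma hmul_comp_val d1 d2 (f : Hd d1) (g : Hd d2) v : injective v ->
  (val (hmul_comp m f g)).@[v] = hsum (val f) (val g) v.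
Proof.
have [fs gs] : val f \is symmetric /\ val g \is symmetric by split; apply: valP.
have [P Ps PE] := hsum_integral fs gs (erefl (d1 + d2)%N) => vI.
rewrite /hmul_comp (@of_fracE _ _ _ P) ?PE //.
apply: (frac_eq_generic (vdm_neq0 _)) => w /vdm_neq0_inj wI.
by rewrite PE //; apply: hmul_frac_fev.
Qed.

End HmulValues.

(** * The algebra H *)

Section SetConvolution.
Variables (n : nat) (K : 'I_n -> 'I_n -> rat).
Implicit Types (F G H : {set 'I_n} -> rat) (I J : {set 'I_n}).

Definition conv F G I : rat :=
  \sum_(J : {set 'I_n} | J \subset I) F J * G (I :\: J) * crossprod K J (I :\: J).

Lemma crossprod_splitl (h : 'I_n -> 'I_n -> rat) (L J I : {set 'I_n}) : L \subset J ->
  crossprod h J I = crossprod h L I * crossprod h (J :\: L) I.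
Proof.
move=> LJ; rewrite /crossprod (big_setID L) /=.
by have /setIidPr -> := LJ.
Qed.

Lemma crossprod_splitr (h : 'I_n -> 'I_n -> rat) (L J I : {set 'I_n}) : L \subset J ->
  crossprod h I J = crossprod h I L * crossprod h I (J :\: L).
Proof.
move=> LJ; rewrite /crossprod -big_split /=; apply: eq_bigr => i _.
rewrite (big_setID L) /=.
by have /setIidPr -> := LJ.
Qed.

Lemma sum_subset_split (R : nmodType) (A : {set 'I_n} -> {set 'I_n} -> R) I :
  \sum_(J : {set 'I_n} | J \subset I) \sum_(L : {set 'I_n} | L \subset J) A J L =
  \sum_(L : {set 'I_n} | L \subset I)
    \sum_(M : {set 'I_n} | M \subset I :\: L) A (L :|: M) L.
Proof.
rewrite (exchange_big_dep (fun L : {set 'I_n} => L \subset I)) /=; last first.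
  by move=> J L JI LJ; apply: subset_trans JI.
apply: eq_bigr => L LI.
rewrite (reindex_onto (fun M => L :|: M) (fun J => J :\: L)) /=; last first.
  by move=> J /andP[_ LJ]; apply/setP => i; rewrite !inE; case: (boolP (i \in L)) => //= /(subsetP LJ).
apply: eq_bigl => M; rewrite finset.subsetUl andbT subUset LI /= subsetD.
congr (_ && _); apply/eqP/idP => [<-|/disjoint_setI0 ML].
  by rewrite disjoints_subset; apply/subsetP => i; rewrite !inE => /andP[].
rewrite setDUl finset.setDv finset.set0U; apply/setDidPl.
by rewrite -setI_eq0 ML.
Qed.

(** Both sides are the sum over ordered partitions of [I] into three blocks, the kernel being
    multiplicative over pairs of blocks. *)
Lemma convA F G H I : conv (conv F G) H I = conv F (conv G H) I.
Proof.
rewrite /conv.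
under eq_bigr => J _ do rewrite mulr_suml mulr_suml.
rewrite (sum_subset_split (fun J L => F L * G (J :\: L) * crossprod K L (J :\: L)
  * H (I :\: J) * crossprod K J (I :\: J))).
apply: eq_bigr => L LI; rewrite mulr_sumr mulr_suml; apply: eq_bigr => M.
rewrite subsetD => /andP[MI LM].
have E1 : (L :|: M) :\: L = M.
  apply/setP => i; rewrite !inE; case: (boolP (i \in M)) => [iM|_]; last by case: (i \in L).
  by rewrite orbT andbT; apply/negP => iL; move: LM; rewrite disjoints_subset
    => /subsetP/(_ i iM); rewrite inE iL.
have E2 : I :\: (L :|: M) = I :\: L :\: M by rewrite setDDl.
rewrite E1 E2 (crossprod_splitl K (I :\: L :\: M) (finset.subsetUl L M)) E1.
rewrite (crossprod_splitr K L (_ : M \subset I :\: L)); first by ring.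
by rewrite subsetD MI LM.
Qed.

Lemma sum_setD (R : nmodType) (A : {set 'I_n} -> R) I :
  \sum_(J : {set 'I_n} | J \subset I) A J = \sum_(J : {set 'I_n} | J \subset I) A (I :\: J).
Proof.
rewrite (reindex_onto (fun J => I :\: J) (fun J => I :\: J)) /=; last first.
  by move=> J JI; rewrite setDDr finset.setDv finset.set0U; apply/setIidPr.
apply: eq_bigl => J; rewrite subDset finset.subsetUr /=; apply/eqP/idP => [<-|JI].
  by rewrite subDset finset.subsetUr.
by rewrite setDDr finset.setDv finset.set0U; apply/setIidPr.
Qed.

End SetConvolution.

Lemma dscale_fin (V : nat -> lmodType rat) (c : nat -> rat) (f : dsum V) :
  fin_supp (fun i => c i *: f i).
Proof.
have /asboolP ff := dsum_fin f; apply/asboolP; apply: sub_finite_set ff => i /= nz f0.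
by apply: nz; rewrite f0 scaler0.
Qed.

(** Used with signs for the Koszul rule, and with an indicator function to project onto one
    component. *)
Definition dscale (V : nat -> lmodType rat) (c : nat -> rat) (f : dsum V) : dsum V :=
  DSum (dscale_fin c f).

Lemma dscale_is_linear (V : nat -> lmodType rat) c : linear (@dscale V c).
Proof.
by move=> a f g; apply: dsumP => i /=; rewrite scalerDr !scalerA mulrC.
Qed.

HB.instance Definition _ (V : nat -> lmodType rat) c :=
  GRing.isLinear.Build rat (dsum V) (dsum V) *:%R (@dscale V c) (@dscale_is_linear V c).

Lemma dscaleE (V : nat -> lmodType rat) c (f : dsum V) i : dscale c f i = c i *: f i.
Proof. by []. Qed.

Definition hdeg (V : nat -> lmodType rat) d (x : dsum V) : Prop := forall i, i <> d -> x i = 0.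

Lemma hdeg_dinj (V : nat -> lmodType rat) d (p : V d) : hdeg d (dinj V d p).
Proof. by move=> i id; rewrite dinj_neq // => e; apply: id. Qed.

Lemma hdegE (V : nat -> lmodType rat) d (x : dsum V) : hdeg d x -> x = dinj V d (x d).
Proof.
move=> xd; apply: dsumP => i; have [->|id] := pselect (i = d); first by rewrite dinjE.
by rewrite xd // dinj_neq // => e; apply: id.
Qed.

Lemma dscale_hdeg (V : nat -> lmodType rat) c d (x : dsum V) :
  hdeg d x -> dscale c x = c d *: x.
Proof.
move=> xd; apply: dsumP => i; rewrite dscaleE -[RHS]/(c d *: x i).
by have [->|/xd->] := pselect (i = d); rewrite ?scaler0.
Qed.

Section CohaAlgebra.
Variable m : nat.
Local Notation H := coha.
Implicit Types (x y z : H).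
Local Notation "x ** y" := (hmul m x y) (at level 40, left associativity).

(* x is encoded by its values at the finite subsets of a set of distinct points;
   the product of H becomes a sum over subsets. *)
Definition ev n (v : 'I_n -> rat) (x : H) (I : {set 'I_n}) : rat :=
  pev (val (x #|I|)) (pts v I).

Lemma ev_is_linear n (v : 'I_n -> rat) (I : {set 'I_n}) c x y :
  ev v (c *: x + y) I = c * ev v x I + ev v y I.
Proof. by rewrite /ev /pev /= mevalD mevalZ. Qed.

Lemma ev0 n (v : 'I_n -> rat) (I : {set 'I_n}) : ev v 0 I = 0.
Proof. by rewrite /ev /pev /= meval0. Qed.

Lemma evD n (v : 'I_n -> rat) (I : {set 'I_n}) x y : ev v (x + y) I = ev v x I + ev v y I.
Proof. by rewrite /ev /pev /= mevalD. Qed.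

Lemma evZ n (v : 'I_n -> rat) (I : {set 'I_n}) c x : ev v (c *: x) I = c * ev v x I.
Proof. by rewrite /ev /pev /= mevalZ. Qed.

Lemma ev_sum n (v : 'I_n -> rat) (I : {set 'I_n}) T (r : seq T) P (F : T -> H) :
  ev v (\sum_(i <- r | P i) F i) I = \sum_(i <- r | P i) ev v (F i) I.
Proof. by apply: (big_morph (fun x => ev v x I)) => [x y|]; rewrite ?evD ?ev0. Qed.

Lemma ev_dscale n (v : 'I_n -> rat) (I : {set 'I_n}) c x : ev v (dscale c x) I = c #|I| * ev v x I.
Proof. by rewrite /ev /pev /= mevalZ. Qed.

Lemma ev_dinj n (v : 'I_n -> rat) (I : {set 'I_n}) d (p : Hd d) :
  ev v (dinj Hd d p) I = if #|I| == d then pev (val p) (pts v I) else 0.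
Proof.
rewrite /ev; case: eqP => [Id|nd]; first by subst d; rewrite dinjE.
by rewrite dinj_neq => [|e]; [rewrite /pev /= meval0|apply: nd].
Qed.

Lemma ev_hdeg n (v : 'I_n -> rat) (I : {set 'I_n}) d x : hdeg d x -> #|I| <> d -> ev v x I = 0.
Proof. by move=> xd Id; rewrite /ev xd // /pev /= meval0. Qed.

Lemma evT n (v : 'I_n -> rat) x : ev v x setT = (val (x n)).@[v].
Proof. by rewrite /ev cardsT card_ord meval_pts. Qed.

Lemma comp_ext x y n : (forall v : 'I_n -> rat, injective v -> ev v x setT = ev v y setT) ->
  x n = y n.
Proof.
move=> xy; apply/val_inj; apply: (meval_ext_generic (vdm_neq0 n)) => v /vdm_neq0_inj /xy.
by rewrite !evT.
Qed.

Lemma coha_ext x y :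
  (forall n (v : 'I_n -> rat), injective v -> ev v x setT = ev v y setT) -> x = y.
Proof. by move=> xy; apply: dsumP => n; apply: comp_ext; apply: xy. Qed.

Lemma hmul_comp_pts n (v : 'I_n -> rat) (I : {set 'I_n}) d1 d2 (f : Hd d1) (g : Hd d2) :
  injective v -> #|I| = (d1 + d2)%N -> pev (val (hmul_comp m f g)) (pts v I) =
  \sum_(J : {set 'I_n} | J \subset I)
    (if #|J| == d1 then pev (val f) (pts v J) else 0) *
    (if #|I :\: J| == d2 then pev (val g) (pts v (I :\: J)) else 0) *
    crossprod (hker m v) J (I :\: J).
Proof.
move=> vI Id; pose phi (i : 'I_(d1 + d2)) : 'I_n := enum_val (cast_ord (esym Id) i).
have phiI : injective phi by move=> i j /enum_val_inj/cast_ord_inj.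
have phiT : phi @: setT = I.
  apply/setP => i; apply/imsetP/idP => [[j _ ->]|iI]; first exact: enum_valP.
  exists (cast_ord Id (enum_rank_in iI i)); rewrite ?inE // /phi cast_ordK.
  by rewrite enum_rankK_in.
have sP : val (hmul_comp m f g) \is symmetric by apply: valP.
rewrite -{1}phiT -(pev_imset _ sP phiI) ?cardsT ?card_ord // meval_pts.
rewrite hmul_comp_val; last by move=> i j /vI/phiI.
rewrite -[in RHS]phiT sum_imset_sub // /hsum big_mkcond /=; apply: eq_bigr => J _.
have -> : phi @: setT :\: phi @: J = phi @: (~: J).
  apply/setP => i; rewrite !inE; apply/andP/imsetP => [[iJ /imsetP[j _ ij]]|[j jJ ->]].
    by exists j; rewrite // inE; apply: contra iJ => jJ; rewrite ij imset_f.
  by rewrite !mem_imset // in_setT; move: jJ; rewrite inE => ->.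
rewrite !card_imset //; case: eqP => [Jd|]; last by rewrite !mul0r.
have Jd' : #|~: J| = d2 by rewrite cardsCs setCK card_ord Jd addKn.
rewrite Jd' eqxx -crossprod_imset // -!(pev_imset _ _ phiI) //; exact: valP.
Qed.

Lemma hmul_comp0l d1 d2 (g : Hd d2) : hmul_comp m (0 : Hd d1) g = 0.
Proof.
apply/val_inj; apply: (meval_ext_generic (vdm_neq0 _)) => v /vdm_neq0_inj vI.
rewrite hmul_comp_val // meval0; apply: big1 => J _.
by rewrite /pev meval0 !mul0r.
Qed.

Lemma hmul_comp0r d1 d2 (f : Hd d1) : hmul_comp m f (0 : Hd d2) = 0.
Proof.
apply/val_inj; apply: (meval_ext_generic (vdm_neq0 _)) => v /vdm_neq0_inj vI.
rewrite hmul_comp_val // meval0; apply: big1 => J _.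
by rewrite /pev meval0 mulr0 mul0r.
Qed.

Lemma hmul_bound x y B : (forall i, (B <= i)%N -> x i = 0) ->
  (forall i, (B <= i)%N -> y i = 0) ->
  x ** y = \sum_(d1 < B) \sum_(d2 < B) dinj Hd (d1 + d2)%N (hmul_comp m (x d1) (y d2)).
Proof.
move=> xB yB; rewrite /hmul (@fsum_nat _ _ B).
  by apply: eq_bigr => d1 _; apply: fsum_nat => d2 /yB->; rewrite hmul_comp0r linear0.
move=> d1 /xB->; rewrite (@fsum_nat _ _ 0%N) ?big_ord0 // => d2 _.
by rewrite hmul_comp0l linear0.
Qed.

Lemma ev_hmul n (v : 'I_n -> rat) x y (I : {set 'I_n}) : injective v ->
  ev v (x ** y) I = conv (hker m v) (ev v x) (ev v y) I.
Proof.
move=> vI; have [B [xB yB]] := dsum_bound2 x y.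
have decomp z : (forall i, (B <= i)%N -> z i = 0) -> forall J, ev v z J =
    \sum_(d < B) if #|J| == d then pev (val (z d)) (pts v J) else 0.
  move=> zB J; rewrite {1}(dsum_decomp zB) ev_sum.
  by apply: eq_bigr => d _; rewrite ev_dinj.
rewrite (hmul_bound xB yB) ev_sum /conv.
under [RHS]eq_bigr => J _ do rewrite (decomp _ xB) (decomp _ yB) mulr_suml mulr_suml.
rewrite exchange_big /=; apply: eq_bigr => d1 _.
under [RHS]eq_bigr => J _ do rewrite mulr_sumr mulr_suml.
rewrite exchange_big /= ev_sum; apply: eq_bigr => d2 _.
rewrite ev_dinj; case: eqP => [Id|Id]; first exact: hmul_comp_pts.
apply/esym/big1 => J JI; case: eqP => J1; last by rewrite !mul0r.
case: eqP => J2; last by rewrite mulr0 mul0r.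
by case: Id; rewrite -J1 -J2 -(cardsID J I); have /setIidPr -> := JI.
Qed.

Lemma hmul_linearl y : linear (fun x => x ** y).
Proof.
move=> c x x'; apply: coha_ext => n v vI; rewrite ev_is_linear !ev_hmul //.
rewrite /conv mulr_sumr -big_split /=; apply: eq_bigr => J _.
by rewrite ev_is_linear; ring.
Qed.

Lemma hmul_linearr x : linear (hmul m x).
Proof.
move=> c y y'; apply: coha_ext => n v vI; rewrite ev_is_linear !ev_hmul //.
rewrite /conv mulr_sumr -big_split /=; apply: eq_bigr => J _.
by rewrite ev_is_linear; ring.
Qed.

HB.instance Definition _ x :=
  GRing.isLinear.Build rat H H *:%R (hmul m x) (hmul_linearr x).

Definition hmulr y x := x ** y.

HB.instance Definition _ y :=
  GRing.isLinear.Build rat H H *:%R (hmulr y) (hmul_linearl y).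

Lemma hmul0l y : 0 ** y = 0. Proof. exact: (linear0 (hmulr y)). Qed.
Lemma hmul0r x : x ** 0 = 0. Proof. exact: linear0. Qed.
Lemma hmulDl x x' y : (x + x') ** y = x ** y + x' ** y.
Proof. exact: (linearD (hmulr y)). Qed.
Lemma hmulDr x y y' : x ** (y + y') = x ** y + x ** y'.
Proof. exact: linearD. Qed.
Lemma hmulZl c x y : (c *: x) ** y = c *: (x ** y).
Proof. exact: (linearZ_LR (hmulr y)). Qed.
Lemma hmulZr c x y : x ** (c *: y) = c *: (x ** y).
Proof. exact: linearZ_LR. Qed.
Lemma hmul_suml T (r : seq T) (P : pred T) (F : T -> H) y :
  (\sum_(i <- r | P i) F i) ** y = \sum_(i <- r | P i) F i ** y.
Proof. exact: (linear_sum (hmulr y)). Qed.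
Lemma hmul_sumr T (r : seq T) (P : pred T) (F : T -> H) x :
  x ** (\sum_(i <- r | P i) F i) = \sum_(i <- r | P i) x ** F i.
Proof. exact: linear_sum. Qed.

Lemma hmulA x y z : x ** (y ** z) = x ** y ** z.
Proof.
apply: coha_ext => n v vI; rewrite !ev_hmul //.
rewrite /conv; under eq_bigr => J _ do rewrite ev_hmul //.
under [RHS]eq_bigr => J _ do rewrite ev_hmul //.
exact/esym/convA.
Qed.

Lemma ev_hone n (v : 'I_n -> rat) (I : {set 'I_n}) : ev v hone I = (I == set0)%:R.
Proof.
by rewrite ev_dinj cards_eq0; case: eqP => //= _; rewrite /pev meval1.
Qed.

Lemma hmul1l x : hone ** x = x.
Proof.
apply: coha_ext => n v vI; rewrite !ev_hmul // /conv.
rewrite (bigD1 set0) ?sub0set //= ev_hone eqxx mul1r setD0.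
rewrite /crossprod big_set0 mulr1 big1 ?addr0 // => J /andP[_ /negPf J0].
by rewrite ev_hone J0 !mul0r.
Qed.

Lemma hmul1r x : x ** hone = x.
Proof.
apply: coha_ext => n v vI; rewrite !ev_hmul // /conv.
rewrite (bigD1 setT) ?subxx //= finset.setDv ev_hone eqxx mulr1.
rewrite /crossprod big1 => [|i _]; last by rewrite big_set0.
rewrite mulr1 big1 ?addr0 // => J /andP[_ JT].
by rewrite ev_hone setD_eq0 finset.subTset (negPf JT) mulr0 mul0r.
Qed.

Lemma dscaleM c x y : (forall i j, c (i + j)%N = c i * c j) ->
  dscale c (x ** y) = dscale c x ** dscale c y.
Proof.
move=> cD; apply: coha_ext => n v vI; rewrite ev_dscale !ev_hmul // /conv mulr_sumr.
apply: eq_bigr => J JI; rewrite !ev_dscale -(cardsID J setT) cD.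
by have /setIidPr -> := JI; ring.
Qed.

(** [(m + 1) d d'] has the parity of the Euler form [(1 - m) d d']. *)
Definition ksign (d d' : nat) : rat := (-1) ^+ (m.+1 * d * d').

(* The Koszul sign of moving past an element of H_d: x y = kap d y x. *)
Definition kap (d : nat) : H -> H := dscale (ksign d).

HB.instance Definition _ d := GRing.Linear.on (kap d).

Lemma ksignD d i j : ksign d (i + j) = ksign d i * ksign d j.
Proof. by rewrite /ksign mulnDr exprD. Qed.

Lemma ksignC d d' : ksign d d' = ksign d' d.
Proof. by rewrite /ksign mulnAC. Qed.

Lemma ksignK d d' : ksign d d' * ksign d d' = 1.
Proof. by rewrite -expr2 sqrr_sign. Qed.

Lemma kapM d x y : kap d (x ** y) = kap d x ** kap d y.
Proof. by apply: dscaleM; apply: ksignD. Qed.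

Lemma kapK d : involutive (kap d).
Proof. by move=> x; apply: dsumP => i; rewrite !dscaleE scalerA ksignK scale1r. Qed.

Lemma kap1 d : kap d hone = hone.
Proof.
rewrite /kap (dscale_hdeg _ (hdeg_dinj _)) /ksign muln0 scale1r //.
Qed.

Lemma expN1z_m : (-1) ^ (m%:Z - 1) = (-1) ^+ m.+1 :> rat.
Proof.
rewrite expfzDr ?oppr_eq0 ?oner_eq0 //.
have -> : (-1) ^ (- 1) = -1 :> rat by [].
by rewrite exprS mulrC.
Qed.

Lemma hker_swap n (v : 'I_n -> rat) (J I : {set 'I_n}) :
  crossprod (hker m v) I J = ksign #|I| #|J| * crossprod (hker m v) J I.
Proof.
have -> : ksign #|I| #|J| = crossprod (fun _ _ => (-1) ^+ m.+1) J I.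
  rewrite /crossprod; under eq_bigr do rewrite prodr_const.
  by rewrite prodr_const /ksign -!exprM mulnA.
rewrite -crossprodM {1}/crossprod exchange_big; apply: eq_crossprod => i j _ _.
rewrite /hker -expN1z_m -expfzMl; congr (_ ^ _); ring.
Qed.

(** Exchanging the two blocks of a partition reverses every difference in the kernel, at the cost of
    one sign [(-1) ^ (m - 1)] per pair. *)
Lemma hmul_kap d x y : hdeg d x -> x ** y = kap d y ** x.
Proof.
move=> xd; apply: coha_ext => n v vI; rewrite !ev_hmul // /conv [RHS]sum_setD.
apply: eq_bigr => J JI; rewrite setDDr finset.setDv finset.set0U.
have /setIidPr -> := JI; rewrite ev_dscale.
have [Jd|/(ev_hdeg v xd)->] := pselect (#|J| = d); last by rewrite !mulr0 !mul0r.
rewrite (hker_swap v J) Jd [ksign #|_| d]ksignC.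
have := ksignK d #|setT :\: J|; set k := ksign _ _ => kk.
rewrite -[LHS]mul1r -kk; ring.
Qed.

Lemma hdeg_hmul d e x y : hdeg d x -> hdeg e y -> hdeg (d + e) (x ** y).
Proof.
move=> xd ye n nde; rewrite -[RHS]/((0 : H) n); apply: comp_ext => v vI.
rewrite ev0 ev_hmul //; apply: big1 => J JT.
have [Jd|/(ev_hdeg v xd)->] := pselect (#|J| = d); last by rewrite !mul0r.
rewrite (ev_hdeg v ye) ?mulr0 ?mul0r // => Je; apply: nde.
by rewrite -Jd -Je -[n in LHS]card_ord -cardsT -(cardsID J setT); have /setIidPr -> := JT.
Qed.

End CohaAlgebra.

(** * The homomorphism through which H acts *)

Section SquarePoints.
Variable n : nat.
Implicit Types (v : 'I_n -> rat) (p : {mpoly rat[n]}) (E I J : {set 'I_n}).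

Definition sqv v : 'I_n -> rat := fun i => v i ^+ 2.

(** At such points [v i] and, for [i != j], both [v i + v j] and [v i - v j] are nonzero: no factor
    of the action has a pole. Sign changes preserve the condition. *)
Definition gen v : Prop := (forall i, v i != 0) /\ injective (sqv v).

Definition sqpoly p : {mpoly rat[n]} := p \mPo [tuple 'X_i ^+ 2 | i < n].

Lemma meval_sqpoly p v : (sqpoly p).@[v] = p.@[sqv v].
Proof.
rewrite comp_mpoly_meval; apply: meval_eq => i; rewrite tnth_mktuple.
by rewrite rmorphXn /= mevalXU.
Qed.

Lemma sqpoly_inj p : sqpoly p = 0 -> p = 0.
Proof.
move=> p0; apply/mpolyP => k; rewrite mcoeff0.
have E (l : 'X_{1..n}) : sqpoly 'X_[l] = 'X_[l *+ 2].
  rewrite /sqpoly comp_mpolyX -mpolyXn [in RHS]mpolyXE_id -prodrXl.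
  by apply: eq_bigr => i _; rewrite tnth_mktuple -!exprM mulnC.
have [kp|/memN_msupp_eq0//] := boolP (k \in msupp p).
have := congr1 (mcoeff (k *+ 2)%MM) p0; rewrite mcoeff0.
rewrite /sqpoly comp_mpolyEX raddf_sum (bigD1_seq k) ?msupp_uniq //=.
rewrite mcoeffZ -/(sqpoly _) E mcoeffX eqxx mulr1 big1 ?addr0 // => l lk.
rewrite mcoeffZ -/(sqpoly _) E mcoeffX; case: eqP => [e|]; last by rewrite mulr0.
case/negP: lk; apply/eqP/mnmP => i; move/mnmP: e => /(_ i); rewrite !mulmnE !muln2.
by move/double_inj.
Qed.

Definition genpoly : {mpoly rat[n]} := (\prod_i 'X_i) * sqpoly (vdm n).

Lemma genpolyP v : genpoly.@[v] != 0 <-> gen v.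
Proof.
rewrite mevalM meval_sqpoly mulf_eq0 negb_or (rmorph_prod (meval v)) /=; split.
  move=> /andP[/prodf_neq0 vn0 /vdm_neq0_inj vI]; split=> // i.
  by have := vn0 i isT; rewrite mevalXU.
move=> [vn0 vI]; rewrite vdm_meval_neq0 // andbT; apply/prodf_neq0 => i _.
by rewrite mevalXU.
Qed.

Lemma genpoly_neq0 : genpoly != 0.
Proof.
have g : gen (fun i => (val i).+1%:R).
  split=> [i|i j]; first by rewrite pnatr_eq0.
  rewrite /sqv -!natrX => /eqP; rewrite eqr_nat eqn_exp2r // eqSS => /eqP.
  exact: val_inj.
by move/genpolyP: g; apply: contraNneq => ->; rewrite meval0.
Qed.

(** Only squares of rationals are tested, but substituting squares for the variables is injective on
    polynomials. *)
Lemma meval_ext_sq p q : (forall v, gen v -> p.@[sqv v] = q.@[sqv v]) -> p = q.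
Proof.
move=> pq; apply/eqP; rewrite -subr_eq0; apply/eqP/sqpoly_inj.
apply: (meval_eq0_generic genpoly_neq0) => v /genpolyP /pq e.
by rewrite meval_sqpoly mevalB e subrr.
Qed.

Lemma gen_inj v : gen v -> injective v.
Proof. by move=> [_ vI] i j e; apply: vI; rewrite /sqv e. Qed.

Definition flip E v : 'I_n -> rat := fun i => if i \in E then - v i else v i.

Lemma sqv_flip E v i : flip E v i ^+ 2 = v i ^+ 2.
Proof. by rewrite /flip; case: ifP; rewrite ?sqrrN. Qed.

Lemma gen_flip E v : gen v -> gen (flip E v).
Proof.
move=> [v0 vI]; split=> [i|i j]; first by rewrite /flip; case: ifP; rewrite ?oppr_eq0 v0.
by rewrite /sqv !sqv_flip; apply: vI.
Qed.

(* On monomials the alternating sum is the product of the odd parts. *)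
Lemma odd_part p : exists q : {mpoly rat[n]}, forall v,
  \sum_(E : {set 'I_n}) (-1) ^+ #|E| * p.@[flip E v] = (\prod_i v i) * q.@[sqv v].
Proof.
elim/mpolyind: p => [|c k p _ _ [q qE]].
  by exists 0 => v; rewrite meval0 mulr0 big1 // => E _; rewrite meval0 mulr0.
(* In one variable [x ^+ k - (- x) ^+ k] is [2 x ^+ k] for odd [k] and 0 for even [k]; one factor
   [x] is taken out, and what remains is a power of the square. *)
exists (c *: (\prod_i (if odd (k i) then 2%:R *: 'X_i ^+ (k i)./2 else 0)) + q) => v.
rewrite mevalD mulrDr -qE mevalZ.
have -> : (\prod_i v i) * (c * (\prod_i (if odd (k i) then 2%:R *: 'X_i ^+ (k i)./2 else 0
    : {mpoly rat[n]})).@[sqv v]) = c * \prod_i (- (- v i) ^+ k i + v i ^+ k i).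
  rewrite mulrCA (rmorph_prod (meval (sqv v))) -big_split /=; congr (_ * _).
  apply: eq_bigr => i _; rewrite exprNn -signr_odd; case: ifP => ko.
    rewrite mevalZ rmorphXn /= mevalXU /sqv -exprM.
    have := odd_double_half (k i); rewrite ko add1n -mul2n; set h := (k i)./2 => <-.
    rewrite ![_ ^+ (2 * h).+1]exprS; ring.
  by rewrite meval0 mulr0 expr0 mul1r addNr.
rewrite bigA_distr mulr_sumr -big_split /=; apply: eq_bigr => E _.
rewrite mevalD mevalZ mevalX mulrDr mulrCA; congr (_ * _ + _).
rewrite -prodr_const big_mkcond /= -big_split /=; apply: eq_bigr => i _.
by rewrite /flip; case: ifP; rewrite ?mulN1r ?mul1r.
Qed.

End SquarePoints.

Lemma pairprodE (R : comPzRingType) n (h : 'I_n -> 'I_n -> R) (J : {set 'I_n}) :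
  pairprod h J = crossprod (fun i j => if (i < j)%N then h i j else 1) J J.
Proof.
rewrite /crossprod pair_big /= /pairprod big_mkcond [RHS]big_mkcond /=.
apply: eq_bigr => -[i j] _ /=; rewrite /ltpair /=.
by case: (i \in J); case: (j \in J); case: ltnP.
Qed.

(** [phi] may reverse the order of two indices, whence the symmetry required of [h]. *)
Lemma pairprod_imset (R : comPzRingType) k n (phi : 'I_k -> 'I_n) (h : 'I_n -> 'I_n -> R)
    (J : {set 'I_k}) : injective phi -> (forall i j, h i j = h j i) ->
  pairprod h (phi @: J) = pairprod (fun i j => h (phi i) (phi j)) J.
Proof.
move=> phiI hC; rewrite !pairprodE -crossprod_imset // /crossprod !pair_big /=.
rewrite (bigID (@ltpair k)) /= [RHS](bigID (@ltpair k)) /=.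
rewrite [X in _ * X = _](reindex_inj
  (inv_inj (_ : involutive (fun x : 'I_k * 'I_k => (x.2, x.1))))) /=; last by case.
rewrite [X in _ = _ * X]big1 ?mulr1 => [|[i j] /andP[_ /= /negPf]]; last first.
  by rewrite /ltpair /= => ->.
rewrite [X in _ * X]big_mkcond [X in X * _]big_mkcond [RHS]big_mkcond -big_split /=.
apply: eq_bigr => -[i j] _ /=; rewrite /ltpair /=.
case: (i \in J); case: (j \in J); rewrite ?mulr1 //=.
have [ltij|ltji|/val_inj->] := ltngtP i j; rewrite ?ltnn ?mulr1 //=.
have nij : phi i <> phi j by move=> /phiI e; rewrite e ltnn in ltij.
case: (ltngtP (phi i) (phi j)) => [| |/val_inj//]; rewrite ?mulr1 ?mul1r //.
Qed.

Lemma pairprodM (R : comPzRingType) n (h k : 'I_n -> 'I_n -> R) (J : {set 'I_n}) :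
  pairprod (fun i j => h i j * k i j) J = pairprod h J * pairprod k J.
Proof. by rewrite -big_split. Qed.

Lemma prod_imset (R : comPzRingType) k n (phi : 'I_k -> 'I_n) (h : 'I_n -> R)
    (J : {set 'I_k}) : injective phi -> \prod_(i in phi @: J) h i = \prod_(i in J) h (phi i).
Proof. by move=> phiI; rewrite big_imset //= => i j _ _ /phiI. Qed.

Lemma sum_subset_union (R : nmodType) n (A : {set 'I_n} -> R) (I J : {set 'I_n}) : J \subset I ->
  \sum_(E : {set 'I_n} | E \subset I) A E =
  \sum_(E : {set 'I_n} | E \subset J) \sum_(L : {set 'I_n} | L \subset I :\: J) A (E :|: L).
Proof.
move=> JI; rewrite pair_big /= (reindex_onto (fun p : {set 'I_n} * {set 'I_n} => p.1 :|: p.2)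
  (fun E => (E :&: J, E :\: J))) /=; last by move=> E _; rewrite setID.
apply: eq_big => [[E L] /=|[E L] _] //; rewrite subUset xpair_eqE subsetD.
apply/andP/andP => [[/andP[EI LI] /andP[/eqP e1 /eqP e2]]|[EJ /andP[LI LJ]]].
  split; first by rewrite -e1 finset.subsetIr.
  by rewrite LI -e2 disjoints_subset setDE finset.subsetIr.
split; first by rewrite (subset_trans EJ JI) LI.
have LJ0 := disjoint_setI0 LJ.
rewrite setIUl LJ0 finset.setU0 (setIidPl EJ) eqxx setDUl /=.
by move: EJ; rewrite -setD_eq0 => /eqP->; rewrite finset.set0U; apply/eqP/setDidPl.
Qed.

Section Rho.
Variables (m : nat) (N : nat) (c : rat).
Local Notation H := coha.
Local Notation "x ** y" := (hmul m x y) (at level 40, left associativity).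

(* rhoterm w J is the weight of the point w in the sum over sign changes that
   defines the action on M; N is one more than the exponent of the -x_i. *)
Definition rhoterm n (w : 'I_n -> rat) (J : {set 'I_n}) : rat :=
  \prod_(i in J) (- w i) ^ (N%:Z - 1) *
  pairprod (fun i j => (- w i - w j) ^ (m%:Z - 1)) J.

(** The sum over sign changes makes this even in each coordinate of [J]; for symmetric [f] and [J]
    of size [d] it is the value of a symmetric polynomial at the squares of these coordinates. *)
Definition rhov d (f : {mpoly rat[d]}) n (v : 'I_n -> rat) (J : {set 'I_n}) : rat :=
  c ^+ d * \sum_(E : {set 'I_n} | E \subset J)
    pev f (pts (flip E v) J) * rhoterm (flip E v) J.

Lemma rhoterm_imset k n (phi : 'I_k -> 'I_n) (w : 'I_n -> rat) (J : {set 'I_k}) : injective phi ->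
  rhoterm w (phi @: J) = rhoterm (w \o phi) J.
Proof.
move=> phiI; rewrite /rhoterm prod_imset // pairprod_imset // => i j.
by rewrite -opprD addrC opprD.
Qed.

Lemma flip_imset k n (phi : 'I_k -> 'I_n) (v : 'I_n -> rat) (E : {set 'I_k}) : injective phi ->
  flip (phi @: E) v \o phi =1 flip E (v \o phi).
Proof. by move=> phiI i; rewrite /flip /= mem_imset. Qed.

Lemma rhoterm_eq n (v w : 'I_n -> rat) (J : {set 'I_n}) : {in J, v =1 w} ->
  rhoterm v J = rhoterm w J.
Proof.
move=> vw; rewrite /rhoterm; congr (_ * _); first by apply: eq_bigr => i /vw->.
by apply: eq_pairprod => i j /vw-> /vw->.
Qed.

Lemma rhov_imset d (f : {mpoly rat[d]}) k n (phi : 'I_k -> 'I_n) (v : 'I_n -> rat)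
    (J : {set 'I_k}) : f \is symmetric -> #|J| = d -> injective phi ->
  rhov f v (phi @: J) = rhov f (v \o phi) J.
Proof.
move=> fs Jd phiI; rewrite /rhov; congr (_ * _).
transitivity (\sum_(E in (fun E : {set 'I_k} => phi @: E) @: [set E : {set 'I_k} | E \subset J])
    pev f (pts (flip E v) (phi @: J)) * rhoterm (flip E v) (phi @: J)).
  apply: eq_bigl => E; apply/idP/imsetP => [EJ|[E']]; last first.
    by rewrite inE => E'J ->; apply: imsetS.
  have EE : E = phi @: (phi @^-1: E).
    apply/setP => i; apply/idP/imsetP => [iE|[j]]; last by rewrite inE => ? ->.
    have /imsetP[j _ ij] := subsetP EJ i iE.
    by exists j; rewrite // inE -ij.
  exists (phi @^-1: E) => //; rewrite inE; apply/subsetP => i; rewrite inE => iE.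
  have /imsetP[j jJ /phiI ->//] := subsetP EJ _ iE.
rewrite big_imset /=; last by move=> E E' _ _; apply: imset_inj.
apply: eq_big => [E|E _]; first by rewrite inE.
rewrite -(pev_imset _ fs phiI Jd) rhoterm_imset //; congr (_ * _).
  by congr (pev _ _); apply: eq_pts => i _; apply: flip_imset.
by apply: rhoterm_eq => i _; apply: flip_imset.
Qed.

Lemma rhov_perm d (f : {mpoly rat[d]}) v (g : 'S_d) : f \is symmetric ->
  rhov f (v \o g) setT = rhov f v setT.
Proof.
move=> fs; rewrite -(rhov_imset v fs _ (@perm_inj _ g)) ?cardsT ?card_ord //.
by congr rhov; apply/setP => i; rewrite -[i](permKV g) mem_imset ?inE //; apply: perm_inj.
Qed.

Lemma gen_sum_neq0 n (w : 'I_n -> rat) i j : gen w -> - w i - w j != 0.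
Proof.
move=> [w0 wI]; rewrite -opprD oppr_eq0 addr_eq0; apply/eqP => e.
have /wI ij : sqv w i = sqv w j by rewrite /sqv e sqrrN.
by move/eqP: e; rewrite ij -addr_eq0 -mulr2n mulrn_eq0 /= (negPf (w0 j)).
Qed.

(** Multiplying by the product of the [- w i] and by the Vandermonde determinant of the squares,
    whose factors are [(- w i - w j) * (w i - w j)], makes all exponents nonnegative. The first
    product differs from that of the [v i] by a sign, which turns the sum over [E] into an
    alternating one. *)
Lemma rhoterm_clear n (v : 'I_n -> rat) E : gen v ->
  (\prod_i (- flip E v i) ^+ N) *
    pairprod (fun i j => (- flip E v i - flip E v j) ^+ m * (flip E v i - flip E v j)) setT =
  rhoterm (flip E v) setT * ((-1) ^+ n * (-1) ^+ #|E| * \prod_i v i) * (vdm n).@[sqv v].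
Proof.
move=> gv; have gw := gen_flip E gv; set w := flip E v in gw *.
have -> : (-1) ^+ n * (-1) ^+ #|E| * \prod_i v i = \prod_(i in [set: 'I_n]) (- w i) :> rat.
  have -> : (-1) ^+ n = \prod_(i < n) (-1) :> rat by rewrite prodr_const card_ord.
  rewrite -[(-1) ^+ #|E|]prodr_const [X in _ * X * _]big_mkcond /= -!big_split /=.
  apply: eq_big => [i|i _]; first by rewrite inE.
  by rewrite /w /flip; case: ifP; rewrite ?mulr1 ?mulrN1 ?opprK ?mul1r ?mulN1r.
have -> : (vdm n).@[sqv v] = pairprod (fun i j => (- w i - w j) * (w i - w j)) setT.
  rewrite vdm_meval /pairprod; apply: eq_big => [x|x _]; first by rewrite !inE.
  by rewrite /sqv -(sqv_flip E v x.1) -(sqv_flip E v x.2) -/w; ring.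
have -> : \prod_i (- w i) ^+ N = \prod_(i in [set: 'I_n]) (- w i) ^ (N%:Z - 1) *
    \prod_(i in [set: 'I_n]) (- w i).
  rewrite -big_split /=; apply: eq_big => [i|i _]; first by rewrite inE.
  by rewrite exprz_mulX // oppr_eq0 gw.1.
have -> : pairprod (fun i j => (- w i - w j) ^+ m * (w i - w j)) setT =
    pairprod (fun i j => (- w i - w j) ^ (m%:Z - 1)) setT *
    pairprod (fun i j => (- w i - w j) * (w i - w j)) setT.
  rewrite -pairprodM; apply: eq_pairprod => i j _ _.
  by rewrite mulrA exprz_mulX // gen_sum_neq0.
by rewrite /rhoterm; ring.
Qed.

Hypothesis c0 : c != 0.

(** With denominators cleared the sum is alternating, so [odd_part] presents it as the product of
    the [v i] times a polynomial in the squares. That polynomial is antisymmetric, and the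
    Vandermonde determinant is divided out. *)
Lemma rhov_integral d (f : {mpoly rat[d]}) : f \is symmetric ->
  exists2 P : {mpoly rat[d]}, P \is symmetric &
    forall v, gen v -> P.@[sqv v] = rhov f v setT.
Proof.
move=> fs.
pose h : {mpoly rat[d]} := f * ((\prod_i (- 'X_i) ^+ N) *
  pairprod (fun i j => (- 'X_i - 'X_j) ^+ m * ('X_i - 'X_j)) setT).
have [q qE] := odd_part h.
pose k : rat := (-1) ^+ d * c ^+ d.
have k0 : k != 0 by rewrite mulf_neq0 ?expf_neq0 // oppr_eq0 oner_eq0.
have rq v : gen v -> rhov f v setT * (vdm d).@[sqv v] = k * q.@[sqv v].
  move=> gv; have p0 : \prod_i v i != 0 by apply/prodf_neq0 => i _; apply: gv.1.
  apply: (mulIf p0); rewrite -[RHS]mulrA [q.@[_] * _]mulrC -qE /rhov /k.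
  rewrite -!mulrA [RHS]mulrCA; congr (_ * _); rewrite mulr_suml mulr_sumr.
  apply: eq_big => [E|E _]; first by rewrite finset.subsetT.
  have E1 : (\prod_i (- 'X_i) ^+ N : {mpoly rat[d]}).@[flip E v] =
      \prod_i (- flip E v i) ^+ N.
    rewrite (rmorph_prod (meval _)); apply: eq_bigr => i _.
    by rewrite rmorphXn /= mevalN mevalXU.
  have E2 : (pairprod (fun i j => (- 'X_i - 'X_j) ^+ m * ('X_i - 'X_j)) setT
      : {mpoly rat[d]}).@[flip E v] =
      pairprod (fun i j => (- flip E v i - flip E v j) ^+ m * (flip E v i - flip E v j)) setT.
    rewrite (rmorph_pairprod (meval _)); apply: eq_pairprod => i j _ _.
    by rewrite /= mevalM rmorphXn /= !mevalB !mevalN !mevalXU.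
  rewrite meval_pts /h !mevalM E1 E2.
  rewrite rhoterm_clear //; set A := f.@[_]; set B := rhoterm _ _; set V := (vdm d).@[_].
  set P := \prod_i v i.
  have sd : (-1) ^+ d * (-1) ^+ d = 1 :> rat by rewrite -expr2 sqrr_sign.
  have sE : (-1) ^+ #|E| * (-1) ^+ #|E| = 1 :> rat by rewrite -expr2 sqrr_sign.
  transitivity ((-1) ^+ d * (-1) ^+ d * ((-1) ^+ #|E| * (-1) ^+ #|E|) * (A * B * V * P)).
    by rewrite sd sE !mul1r; ring.
  ring.
have [i j v ij|q' qq'] := @antisym_vdm_dvd _ q.
  apply/eqP; rewrite -addr_eq0 -meval_msym -mevalD; apply/eqP.
  suff -> : msym (tperm i j) q + q = 0 by rewrite meval0.
  apply: meval_ext_sq => w gw; rewrite mevalD meval_msym meval0.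
  have gwt : gen (w \o tperm i j).
    by split=> [k'|k' l']; [apply: gw.1|move=> /gw.2/perm_inj].
  apply: (mulfI k0); rewrite mulr0 mulrDr -(rq w) //.
  have e : k * q.@[sqv w \o tperm i j] = rhov f w setT * (vdm d).@[sqv w \o tperm i j].
    by rewrite -(rhov_perm w (tperm i j) fs); exact/esym/rq.
  by rewrite e vdm_perm odd_tperm ij expr1; ring.
have Pc v : gen v -> (k *: q').@[sqv v] = rhov f v setT.
  move=> gv; apply: (mulIf (vdm_meval_neq0 gv.2)); rewrite rq // qq' mevalM mevalZ; ring.
exists (k *: q') => //; apply/issymP => g; apply: meval_ext_sq => v gv.
have gvg : gen (v \o g) by split=> [k'|k' l']; [apply: gv.1|move=> /gv.2/perm_inj].
by rewrite meval_msym Pc // -(rhov_perm v g) // -Pc.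
Qed.

End Rho.

Lemma enum_map n (I : {set 'I_n}) d : #|I| = d ->
  exists2 phi : 'I_d -> 'I_n, injective phi & phi @: setT = I.
Proof.
move=> Id; exists (fun i => enum_val (cast_ord (esym Id) i)).
  by move=> i j /enum_val_inj/cast_ord_inj.
apply/setP => i; apply/imsetP/idP => [[j _ ->]|iI]; first exact: enum_valP.
exists (cast_ord Id (enum_rank_in iI i)); rewrite ?inE // cast_ordK.
by rewrite enum_rankK_in.
Qed.

Lemma prod_pairs_const (a : rat) n : pairprod (fun _ _ : 'I_n => a) setT = a ^+ 'C(n, 2).
Proof.
rewrite /pairprod (eq_bigl (fun x : 'I_n * 'I_n => (x.1 < x.2)%N)); last first.
  by move=> x; rewrite !inE.
rewrite -(pair_big_dep xpredT (fun i j : 'I_n => (i < j)%N) (fun _ _ => a)) /=.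
rewrite (exchange_big_dep xpredT) //= -bin2_sum big_mkord -prodrXr.
apply: eq_bigr => j _; rewrite prodr_const; congr (_ ^+ _).
have wI : injective (widen_ord (ltnW (ltn_ord j))) by move=> a' b' /(congr1 val) /= /val_inj.
rewrite -[RHS]card_ord -[RHS]cardsT -(card_imset _ wI).
apply: eq_card => i; apply/idP/imsetP => [ij|[k _ ->]]; last by change (is_true (k < j)%N); apply: ltn_ord.
by exists (Ordinal (ij : (i < j)%N)); rewrite ?inE //; apply: val_inj.
Qed.

Lemma flipU n (v : 'I_n -> rat) (E L J : {set 'I_n}) : [disjoint L & J] ->
  {in J, flip (E :|: L) v =1 flip E v}.
Proof.
move=> LJ i iJ; rewrite /flip inE; suff /negPf-> : i \notin L by rewrite orbF.
by apply/negP => iL; move/disjoint_setI0/setP/(_ i): LJ; rewrite !inE iL iJ.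
Qed.

Section RhoMap.
Variables (m N : nat) (c : rat).
Hypothesis c0 : c != 0.
Local Notation H := coha.
Local Notation "x ** y" := (hmul m x y) (at level 40, left associativity).
Implicit Types (x y z : H).
Local Notation rv := (rhov m N c).
Local Notation rt := (rhoterm m N).

(** Such an [h] exists by [rhov_integral] and is unique by [meval_ext_sq]. *)
Definition rho_comp d (f : Hd d) : Hd d :=
  xget 0 [set h : Hd d | forall v, gen v -> (val h).@[sqv v] = rv (val f) v setT]%classic.

Lemma rho_compE d (f : Hd d) v : gen v -> (val (rho_comp f)).@[sqv v] = rv (val f) v setT.
Proof.
have [P Ps PE] := rhov_integral m N c0 (valP f : val f \is symmetric).
have := @xgetPex _ 0 [set h : Hd d | forall v, gen v -> (val h).@[sqv v] = rv (val f) v setT]%classic.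
by move=> h; move: v; apply: h; exists (insp (Ps : P \in sympol (d := d))).
Qed.

Lemma rho_comp_is_linear d : linear (@rho_comp d).
Proof.
move=> a f g; apply/val_inj/meval_ext_sq => v gv /=.
rewrite mevalD mevalZ !rho_compE // /rhov /= mulrCA -mulrDr; congr (_ * _).
rewrite mulr_sumr -big_split /=; apply: eq_bigr => E _.
by rewrite /pev mevalD mevalZ; ring.
Qed.

HB.instance Definition _ d :=
  GRing.isLinear.Build rat (Hd d) (Hd d) *:%R (@rho_comp d) (@rho_comp_is_linear d).

Lemma rho_fin x : fin_supp (fun d => rho_comp (x d)).
Proof.
have /asboolP ff := dsum_fin x; apply/asboolP; apply: sub_finite_set ff => i /= nz f0.
by apply: nz; rewrite f0 linear0.
Qed.

(* As a polynomial in the squares of the variables, f * g is g times rho f, the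
   product being that of H. *)
Definition rho x : H := DSum (rho_fin x).

Lemma rho_is_linear : linear rho.
Proof. by move=> a x y; apply: dsumP => d /=; rewrite linearP. Qed.

HB.instance Definition _ := GRing.isLinear.Build rat H H *:%R rho rho_is_linear.

Lemma pev_rho n (v : 'I_n -> rat) d (f : Hd d) (I : {set 'I_n}) : gen v -> #|I| = d ->
  pev (val (rho_comp f)) (pts (sqv v) I) = rv (val f) v I.
Proof.
move=> gv Id; have [phi phiI phiT] := enum_map Id.
have gvp : gen (v \o phi) by split=> [i|i j]; [apply: gv.1|move=> /gv.2/phiI].
rewrite -[X in pts _ X]phiT -[X in rhov _ _ _ _ _ X]phiT.
rewrite -pev_imset ?cardsT ?card_ord //; last exact: (valP (rho_comp f)).
rewrite rhov_imset ?cardsT ?card_ord //; last exact: (valP f).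
by rewrite meval_pts -rho_compE.
Qed.

Lemma ev_rho n (v : 'I_n -> rat) x (I : {set 'I_n}) : gen v ->
  ev (sqv v) (rho x) I = rv (val (x #|I|)) v I.
Proof. by move=> gv; apply: pev_rho. Qed.

Lemma hdeg_rho d x : hdeg d x -> hdeg d (rho x).
Proof. by move=> xd i /xd xi /=; rewrite xi linear0. Qed.

Lemma rho_dscale a x : rho (dscale a x) = dscale a (rho x).
Proof. by apply: dsumP => d /=; rewrite linearZ. Qed.

Lemma rho_kap d x : rho (kap m d x) = kap m d (rho x).
Proof. exact: rho_dscale. Qed.

Lemma rho1 : rho hone = hone.
Proof.
apply: dsumP => d; have [<-|d0] := pselect (0%N = d); last first.
  by rewrite -[LHS]/(rho_comp (hone d)) /hone !dinj_neq // linear0.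
apply/val_inj/meval_ext_sq => v gv; rewrite rho_compE // dinjE /rhov expr0 mul1r.
rewrite (big_pred1 set0) => [|E]; last first.
  by apply/idP/eqP => [_|->]; [apply/setP => -[]|apply: sub0set].
rewrite meval1 /pev meval1 mul1r /rhoterm /pairprod !big_pred0 ?mulr1 // => [[[]]|[]] //.
Qed.

Lemma rhoterm_split n (w : 'I_n -> rat) (J I : {set 'I_n}) : J \subset I ->
  rt w I = rt w J * rt w (I :\: J) *
    crossprod (fun i j => (- w i - w j) ^ (m%:Z - 1)) J (I :\: J).
Proof.
move=> JI; rewrite /rhoterm (pairprod_split _ JI) (big_setID J) /=.
have /setIidPr -> := JI.
rewrite (@eq_crossprod _ _ _ (fun i j => (- w i - w j) ^ (m%:Z - 1))); first by ring.
by move=> i j _ _; case: ifP => // _; rewrite -opprD addrC opprD.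
Qed.

Lemma coha_ext_sq x y :
  (forall n (v : 'I_n -> rat), gen v -> ev (sqv v) x setT = ev (sqv v) y setT) -> x = y.
Proof.
by move=> xy; apply: dsumP => n; apply/val_inj/meval_ext_sq => v /xy; rewrite !evT.
Qed.

(* (x_j - x_i)(-x_i - x_j) = x_i^2 - x_j^2 turns the kernel of the product into
   that of the product with the factors exchanged. *)
Lemma rho_hmul x y : rho (x ** y) = rho y ** rho x.
Proof.
apply: coha_ext_sq => n v gv; rewrite ev_hmul; last exact: gv.2.
rewrite /conv sum_setD ev_rho // /rhov.
transitivity (\sum_(J : {set 'I_n} | J \subset setT)
    \sum_(E : {set 'I_n} | E \subset J) \sum_(L : {set 'I_n} | L \subset setT :\: J)
      c ^+ #|[set: 'I_n]| * (ev (flip E v) x J * rt (flip E v) J *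
        (ev (flip L v) y (setT :\: J) * rt (flip L v) (setT :\: J)) *
        crossprod (hker m (sqv v)) (setT :\: J) J)).
  rewrite mulr_sumr.
  transitivity (\sum_(E : {set 'I_n} | E \subset setT) \sum_(J : {set 'I_n} | J \subset setT)
     c ^+ #|[set: 'I_n]| * (ev (flip E v) x J * ev (flip E v) y (setT :\: J) *
       crossprod (hker m (flip E v)) J (setT :\: J) * rt (flip E v) setT)).
    apply: eq_bigr => E _; rewrite -/(ev (flip E v) (x ** y) setT) ev_hmul.
      by rewrite mulr_suml mulr_sumr.
    exact/gen_inj/gen_flip.
  (* A sign change of all variables is a sign change [E] on [J] together with one, [L], on the
     rest. *)
  rewrite exchange_big /=; apply: eq_bigr => J JT; rewrite (sum_subset_union _ JT).
  apply: eq_bigr => E EJ; apply: eq_bigr => L LJ; congr (_ * _).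
  have dL : [disjoint L & J] by move: LJ; rewrite subsetD => /andP[].
  have dE : [disjoint E & setT :\: J].
    by rewrite disjoints_subset setCD setCT finset.set0U.
  rewrite (rhoterm_split _ JT); set w := flip (E :|: L) v.
  have wE : {in J, w =1 flip E v} by apply: flipU.
  have wL : {in setT :\: J, w =1 flip L v} by rewrite /w finset.setUC; apply: flipU.
  rewrite /ev (eq_pts wE) (eq_pts wL) (rhoterm_eq _ _ wE) (rhoterm_eq _ _ wL).
  have -> : crossprod (hker m (sqv v)) (setT :\: J) J = crossprod (hker m w) J (setT :\: J) *
      crossprod (fun i j => (- w i - w j) ^ (m%:Z - 1)) J (setT :\: J).
    rewrite -crossprodM [LHS]exchange_big; apply: eq_crossprod => i j _ _.
    rewrite /hker -expfzMl; congr (_ ^ _).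
    by rewrite /sqv -(sqv_flip (E :|: L) v i) -(sqv_flip (E :|: L) v j) -/w; ring.
  by ring.
apply: eq_bigr => J JT; rewrite setDDr finset.setDv finset.set0U (setIidPr JT).
rewrite !ev_rho // /rhov -(cardsID J setT) (setIidPr JT) exprD.
under eq_bigr => E _ do rewrite -mulr_sumr -mulr_suml -mulr_sumr.
rewrite -mulr_sumr -!mulr_suml; ring.
Qed.

Lemma rhoterm_opp n (w : 'I_n -> rat) : rt (fun i => - w i) setT =
  ((-1) ^ (N%:Z - 1)) ^+ n * ((-1) ^ (m%:Z - 1)) ^+ 'C(n, 2) * rt w setT.
Proof.
rewrite /rhoterm -prod_pairs_const mulrACA -pairprodM; congr (_ * _).
  have -> : ((-1) ^ (N%:Z - 1)) ^+ n = \prod_(i in [set: 'I_n]) (-1) ^ (N%:Z - 1) :> rat.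
    by rewrite prodr_const cardsT card_ord.
  by rewrite -big_split /=; apply: eq_bigr => i _; rewrite -expfzMl mulN1r.
by apply: eq_pairprod => i j _ _; rewrite -expfzMl; congr (_ ^ _); ring.
Qed.

(** [E] and its complement give opposite points, and under the second hypothesis their summands
    cancel. *)
Lemma rho_comp_odd d (f : Hd d) (a : rat) :
  (forall v, (val f).@[fun i => - v i] = a * (val f).@[v]) ->
  a * (((-1) ^ (N%:Z - 1)) ^+ d * ((-1) ^ (m%:Z - 1)) ^+ 'C(d, 2)) = -1 ->
  rho_comp f = 0.
Proof.
move=> fa aE; apply/val_inj/meval_ext_sq => v gv; rewrite rho_compE // meval0 /rhov.
set S := \sum_(E | _) _; suff /eqP : S = - S.
  by rewrite -addr_eq0 -mulr2n mulrn_eq0 => /eqP->; rewrite mulr0.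
rewrite {1}/S sum_setD -sumrN; apply: eq_bigr => E _.
have fC : flip (setT :\: E) v =1 fun i => - flip E v i.
  by move=> i; rewrite /flip !inE andbT; case: (i \in E); rewrite ?opprK.
rewrite (rhoterm_eq m N (w := fun i => - flip E v i)) => [|i _]; last exact: fC.
rewrite rhoterm_opp !meval_pts (meval_eq _ fC) fa -[RHS]mulN1r.
move: aE; set k := _ ^+ d * _ => aE; rewrite -aE; ring.
Qed.

End RhoMap.

(** * The module M *)

Lemma fev_nat n (v : 'I_n -> rat) k : fev v k%:R k%:R.
Proof. by have := fevC v k%:R; rewrite mpolyC_nat rmorph_nat. Qed.

Lemma exprz_prod (F : fieldType) I (r : seq I) (P : pred I) (G : I -> F) (z : int) :
  (\prod_(i <- r | P i) G i) ^ z = \prod_(i <- r | P i) G i ^ z.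
Proof.
by apply: (big_morph (fun x => x ^ z)) => [x y|]; [apply: expfzMl|apply: exp1rz].
Qed.

Lemma sum_ffun_set (R : nmodType) d (A : {set 'I_d} -> R) :
  \sum_(eps : {ffun 'I_d -> bool}) A [set i | eps i] = \sum_(E : {set 'I_d}) A E.
Proof.
rewrite [RHS](reindex_onto (fun eps : {ffun 'I_d -> bool} => [set i | eps i])
  (fun E => [ffun i => i \in E])) /=; last by move=> E _; apply/setP => i; rewrite inE ffunE.
by apply: eq_bigl => eps; apply/esym/eqP/ffunP => i; rewrite ffunE inE.
Qed.

Lemma pev_sqpoly n (q : {mpoly rat[n]}) k (v : 'I_k -> rat) (J : {set 'I_k}) : #|J| = n ->
  pev (sqpoly q) (pts v J) = pev q (pts (sqv v) J).
Proof.
move=> Jn; rewrite /pev meval_sqpoly; apply: meval_eq => i; rewrite /sqv /pts.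
have lt : (i < size (enum J))%N by rewrite -cardE Jn.
have x0 : 'I_k by case: (enum J) lt.
by rewrite !(nth_map x0).
Qed.

Section StarValues.
Variables (m : nat) (s : int) (tau : 'I_m -> int).

Definition cst : rat := 2%:R ^ ((tau_s s tau)%:Z - ((1 - s) %/ 2)%Z).

Lemma cst_neq0 : cst != 0.
Proof. by rewrite expfz_neq0 // pnatr_eq0. Qed.

(** [star_exp] is at least -1, so the absolute value loses nothing; it is -1, for instance, when
    [s = -1] and no [tau k] is -1. *)
Definition Nexp (e : nat) : nat := absz (star_exp s tau e + 1).

Lemma star_expE e : star_exp s tau e = (Nexp e)%:Z - 1.
Proof. by rewrite /Nexp /star_exp; case: ifP => _; [case: ifP|]; lia. Qed.

Lemma Nexp_odd e : Nexp e = Nexp (odd e).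
Proof. by rewrite /Nexp /star_exp oddb. Qed.

Lemma half_star d e : ((d.*2 + e)./2 = e./2 + d)%N.
Proof. by rewrite halfD odd_double doubleK add0n addnC. Qed.

Section Comp.
Variables (d e : nat) (f : {mpoly rat[d]}) (g : {mpoly rat[e./2]}).
Hypotheses (fs : f \is symmetric) (gs : g \is symmetric).

Definition ssum n (v : 'I_n -> rat) : rat := \sum_(J : {set 'I_n} | #|J| == d)
  rhov m (Nexp e) cst f v J * pev g (pts v (~: J)) * crossprod (hker m (sqv v)) (~: J) J.

Lemma star_frac_fev (v : 'I_((d.*2 + e)./2) -> rat) : gen v ->
  fev v (star_frac s tau f g) (ssum v).
Proof.
move=> gv; have nE : ((d.*2 + e)./2 = d + e./2)%N by rewrite half_star addnC.
rewrite /ssum -(sum_shuffle nE (fun J => rhov m (Nexp e) cst f v J * pev g (pts v (~: J)) *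
   crossprod (hker m (sqv v)) (~: J) J)).
have -> : \sum_(p : {ffun 'I_d + 'I_(e./2) -> 'I_(d.*2 + e)./2} | shuffle p)
    rhov m (Nexp e) cst f v (lblock p) * pev g (pts v (~: lblock p)) *
    crossprod (hker m (sqv v)) (~: lblock p) (lblock p) = cst ^+ d *
  \sum_(p : {ffun 'I_d + 'I_(e./2) -> 'I_(d.*2 + e)./2} | shuffle p)
  \sum_(eps : {ffun 'I_d -> bool})
    let w := flip [set p (inl i) | i in [set i | eps i]] v in
    pev f (pts w (lblock p)) * rhoterm m (Nexp e) w (lblock p) *
    pev g (pts v (~: lblock p)) * crossprod (hker m (sqv v)) (~: lblock p) (lblock p).
  rewrite mulr_sumr; apply: eq_bigr => p /shuffleP[pI _ _].
  have pI' : injective (fun i => p (inl i)) by move=> i j /pI[].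
  rewrite (sum_ffun_set (fun E => let w := flip [set p (inl i) | i in E] v in
    pev f (pts w (lblock p)) * rhoterm m (Nexp e) w (lblock p) *
    pev g (pts v (~: lblock p)) * crossprod (hker m (sqv v)) (~: lblock p) (lblock p))).
  rewrite -(sum_imset_sub (fun E => let w := flip E v in
    pev f (pts w (lblock p)) * rhoterm m (Nexp e) w (lblock p) *
    pev g (pts v (~: lblock p)) * crossprod (hker m (sqv v)) (~: lblock p) (lblock p)) pI') /=.
  by rewrite -!mulr_suml /rhov -!mulrA.
apply: fevM.
  have -> : cst ^+ d = 2%:R ^ (((tau_s s tau)%:Z - ((1 - s) %/ 2)%Z) * d%:Z).
    by rewrite -[LHS]/(cst ^ d%:Z) exprz_exp.
  by apply: fevXz; [rewrite pnatr_eq0|apply: fev_nat].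
apply: fev_sum => p ps; apply: fev_sum => eps _.
set w := flip _ v => /=.
have [pI pl pr] := shuffleP _ ps.
have pI' : injective (fun i => p (inl i)) by move=> i j /pI[].
have wE i : (-1) ^+ eps i * v (p (inl i)) = w (p (inl i)).
  rewrite /w /flip (mem_imset _ _ pI') inE.
  by case: (eps i); rewrite ?mulN1r ?mul1r.
have wv i : w i ^+ 2 = v i ^+ 2 by apply: sqv_flip.
have gw : gen w by apply: gen_flip.
have fx i : fev v ((-1) ^+ eps i * fvar (p (inl i))) (w (p (inl i))).
  rewrite -wE; apply: fevM; last exact: fev_fvar.
  by apply: fevX; apply: fevN; apply: fev1.
rewrite -(lblock_pev w fs (shuffle_inj ps)) -(rblock_pev nE v gs (shuffle_inj ps)).
have -> : rhoterm m (Nexp e) w (lblock p) = (\prod_(i < d) (- w (p (inl i))) ^ star_exp s tau e) *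
    (\prod_(i < d) \prod_(j < d | (i < j)%N) (- w (p (inl i)) - w (p (inl j)))) ^ (m%:Z - 1).
  rewrite -[lblock p]/((fun i => p (inl i)) @: setT) rhoterm_imset // /rhoterm star_expE.
  congr (_ * _); first by apply: eq_bigl => i; rewrite inE.
  rewrite exprz_prod; under [RHS]eq_bigr do rewrite exprz_prod.
  by rewrite pair_big_dep /pairprod /=; apply: eq_bigl => x; rewrite !inE.
have -> : crossprod (hker m (sqv v)) (~: lblock p) (lblock p) =
    (\prod_(i < d) \prod_(j < e./2) (w (p (inl i)) ^+ 2 - v (p (inr j)) ^+ 2)) ^ (m%:Z - 1).
  rewrite exprz_prod; under [RHS]eq_bigr do rewrite exprz_prod.
  rewrite /crossprod exchange_big /= -[LHS]/(crossprod (fun i j => hker m (sqv v) j i) _ _).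
  rewrite -(block_cross nE _ (shuffle_inj ps)); apply: eq_bigr => i _; apply: eq_bigr => j _.
  by rewrite wv.
set F := f.@[_]; set G := g.@[_]; set A := \prod_(i < d) _ ^ _; set B := \prod_(i < d) _.
set C := \prod_(i < d) _.
have -> : F * (A * B ^ (m%:Z - 1)) * G * C ^ (m%:Z - 1) = F * G * A * (B * C) ^ (m%:Z - 1).
  by rewrite expfzMl; ring.
have B0 : B != 0.
  by apply/prodf_neq0 => i _; apply/prodf_neq0 => j _; apply: gen_sum_neq0.
have C0 : C != 0.
  apply/prodf_neq0 => i _; apply/prodf_neq0 => j _; rewrite wv subr_eq0.
  by apply/eqP => /gv.2/pI.
apply: fevM; first apply: fevM; first apply: fevM.
- exact: fev_evalf.
- by apply: fev_evalf => j; apply: fev_fvar.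
- apply: fev_prod => i _; apply: fevXz; first by rewrite oppr_eq0 gw.1.
  exact: fevN.
apply: fevXz; first by rewrite mulf_neq0.
apply: fevM; apply: fev_prod => i _; apply: fev_prod => j _.
  by apply: fevB => //; apply: fevN.
by apply: fevB; apply: fevX => //; apply: fev_fvar.
Qed.

End Comp.

Lemma Mpol_sqpoly e (g : Md s e) : admissible s e ->
  exists2 q : {mpoly rat[e./2]}, q \is symmetric & val g = sqpoly q.
Proof.
move=> ae; have /asboolP[gs [[q gE] _]] := valP g; exists q => //.
apply/issymP => t; apply: meval_ext_sq => v gv; rewrite meval_msym.
have /sym_mevalP/(_ t v) := gs; rewrite gE -/(sqpoly q) !meval_sqpoly => <-.
by apply: meval_eq.
Qed.

Lemma sqpoly_Mpol e (q : {mpoly rat[e./2]}) : admissible s e -> q \is symmetric ->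
  sqpoly q \in Mpol s (e := e).
Proof.
move=> ae qs; apply/asboolP; split; last by split=> [|/negP//]; exists q.
apply/sym_mevalP => t v; rewrite !meval_sqpoly; have /sym_mevalP/(_ t (sqv v)) := qs.
by move=> <-; apply: meval_eq.
Qed.

Lemma Md_nadm e (g : Md s e) : ~~ admissible s e -> g = 0.
Proof. by move=> ae; apply/val_inj; have /asboolP[_ [_ /(_ ae)]] := valP g. Qed.

Lemma Md_sym e (g : Md s e) : val g \is symmetric.
Proof. by have /asboolP[] := valP g. Qed.

Lemma admissibleD d e : admissible s (d.*2 + e) = admissible s e.
Proof. by rewrite /admissible oddD odd_double. Qed.

(** With [g = sqpoly q], the product of [q] and [rho_comp f] in H, taken at the squares of the
    variables, is a polynomial with the required values; so [of_frac] does not fall back on 0. *)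
Lemma star_comp_val d e (f : Hd d) (g : Md s e) (v : 'I_((d.*2 + e)./2) -> rat) :
  admissible s e -> gen v -> (val (star_comp tau f g)).@[v] = ssum (val f) (val g) v.
Proof.
move=> ae gv; have [q qs gE] := Mpol_sqpoly g ae.
have fs : val f \is symmetric := valP f.
have rs := valP (rho_comp m (Nexp e) cst f) : val (rho_comp m (Nexp e) cst f) \is symmetric.
have [P Ps PE] := hsum_integral m qs rs (half_star d e).
have PM : sqpoly P \in Mpol s (e := (d.*2 + e)%N) by apply: sqpoly_Mpol; rewrite ?admissibleD.
have Pv (w : 'I_((d.*2 + e)./2) -> rat) : gen w -> (sqpoly P).@[w] = ssum (val f) (val g) w.
  move=> gw; rewrite meval_sqpoly PE; last exact: gw.2.
  (* [hsum] sums over the block of the [z] variables, [ssum] over the complementary block of the [x]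
     variables. *)
  rewrite /hsum /ssum [RHS](reindex_inj (can_inj (@setCK _))) /=.
  have nE := half_star d e.
  apply: eq_big => [J|J /eqP Je].
    have := cardsC J; rewrite [X in _ = X]card_ord.
    move: #|J| #|~: J| => a b E; rewrite nE in E; apply/eqP/eqP; lia.
  rewrite setCK gE pev_sqpoly // pev_rho ?cst_neq0 //; first by rewrite [_ * rhov _ _ _ _ _ _]mulrC.
  by have := cardsC J; rewrite [X in _ = X]card_ord Je; move: #|~: J| => b E; lia.
rewrite /star_comp (of_fracE PM) ?Pv //.
apply: (frac_eq_generic (genpoly_neq0 _)) => w /genpolyP gw.
by rewrite Pv //; apply: star_frac_fev => //; apply: Md_sym.
Qed.

End StarValues.

Section Transport.
Variables (m : nat) (s : int) (tau : 'I_m -> int).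
Local Notation H := coha.
Local Notation M := (cohm s).
Local Notation "x ** y" := (hmul m x y) (at level 40, left associativity).

(* M_e is a copy of H_n, n = e./2, with the variables replaced by their squares. *)
Definition unsqc n e (g : Md s e) : Hd n :=
  xget 0 [set h : Hd n | forall v : 'I_n -> rat,
    (val h).@[sqv v] = pev (val g) (pts v setT)]%classic.

Lemma unsqcE n e (g : Md s e) (v : 'I_n -> rat) : e./2 = n ->
  (val (unsqc n g)).@[sqv v] = pev (val g) (pts v setT).
Proof.
move=> en; subst n.
suff hP : [set h : Hd e./2 | forall v : 'I_(e./2) -> rat,
    (val h).@[sqv v] = pev (val g) (pts v setT)]%classic (unsqc e./2 g) by apply: hP.
apply: xgetPex; case: (boolP (admissible s e)) => [/(Mpol_sqpoly g)[q qs gE]|/Md_nadm g0].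
  exists (insp (qs : q \in sympol (d := e./2))) => w.
  by rewrite meval_pts gE meval_sqpoly.
by exists 0 => w; rewrite (g0 g) /pev !meval0.
Qed.

Lemma unsqc_is_linear n e : e./2 = n -> linear (@unsqc n e).
Proof.
move=> en a g h; apply/val_inj/meval_ext_sq => v _.
by rewrite unsqcE // /= mevalD mevalZ !unsqcE // /pev mevalD mevalZ.
Qed.

Lemma unsqc0 n e : e./2 = n -> unsqc n (0 : Md s e) = 0.
Proof. by move=> en; have := unsqc_is_linear en (-1) 0 0; rewrite !scaleN1r addNr addNr. Qed.

Lemma unsqc_eq0 n e (g : Md s e) : e./2 = n -> unsqc n g = 0 -> g = 0.
Proof.
move=> en g0; have gE v := unsqcE g v en; subst n; apply/val_inj/meval_eq0 => v.
by rewrite -meval_pts -gE g0 meval0.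
Qed.

Lemma unsqc_surj n e (h : Hd n) : e./2 = n -> admissible s e ->
  exists g : Md s e, unsqc n g = h.
Proof.
move=> en ae; subst n; exists (insp (sqpoly_Mpol ae (valP h : val h \is symmetric))).
by apply/val_inj/meval_ext_sq => v gv; rewrite unsqcE // meval_pts /= meval_sqpoly.
Qed.

Lemma half_bit n (b : bool) : (n.*2 + b)./2 = n.
Proof. by rewrite addnC half_bit_double. Qed.

Variable b : bool.

Lemma unsq_fin (g : M) : fin_supp (fun n => unsqc n (g (n.*2 + b)%N)).
Proof.
have [B gB] := dsum_bound g; apply/asboolP.
apply: (@sub_finite_set _ _ `I_B) => [n /= nz|]; last exact: finite_II.
rewrite ltnNge; apply/negP => Bn; apply: nz; rewrite gB ?unsqc0 ?half_bit //.
by rewrite -addnn -addnA (leq_trans Bn) // leq_addr.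
Qed.

(** Components of the other parity are dropped: the action changes [e] by [2 d], and on one parity
    [Nexp] is constant, so a single [rhob] describes it. *)
Definition unsq (g : M) : H := DSum (unsq_fin g).

Lemma unsq_is_linear : linear unsq.
Proof. by move=> a g h; apply: dsumP => n; apply: (unsqc_is_linear (half_bit n b)). Qed.

HB.instance Definition _ := GRing.isLinear.Build rat M H *:%R unsq unsq_is_linear.

Definition evM n (v : 'I_n -> rat) (g : M) (I : {set 'I_n}) : rat :=
  pev (val (g (#|I|.*2 + b)%N)) (pts v I).

Lemma ev_unsq n (v : 'I_n -> rat) g (I : {set 'I_n}) : ev (sqv v) (unsq g) I = evM v g I.
Proof.
have [phi phiI phiT] := enum_map (erefl #|I|).
rewrite /ev /evM; have ptsE w : pts w I = pts w (phi @: setT) by rewrite phiT.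
rewrite !ptsE.
rewrite -pev_imset ?cardsT ?card_ord //; last exact: valP.
rewrite -pev_imset ?cardsT ?card_ord ?half_bit //; last exact: Md_sym.
by rewrite meval_pts /= -(unsqcE _ _ (half_bit _ _)).
Qed.

Lemma evM_sum n (v : 'I_n -> rat) (I : {set 'I_n}) T (r : seq T) P (F : T -> M) :
  evM v (\sum_(i <- r | P i) F i) I = \sum_(i <- r | P i) evM v (F i) I.
Proof.
apply: (big_morph (fun x => evM v x I)) => [x y|]; last by rewrite /evM /pev /= meval0.
by rewrite /evM /pev /= mevalD.
Qed.

Lemma evM_dinj n (v : 'I_n -> rat) (I : {set 'I_n}) e (p : Md s e) :
  evM v (dinj (Md s) e p) I = if e == (#|I|.*2 + b)%N then pev (val p) (pts v I) else 0.
Proof.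
rewrite /evM; case: eqP => [Ie|ne]; first by subst e; rewrite dinjE.
by rewrite dinj_neq // /pev /= meval0.
Qed.

Lemma star_comp0l d e (g : Md s e) : star_comp tau (0 : Hd d) g = 0.
Proof.
case: (boolP (admissible s e)) => ae; last by rewrite (Md_nadm (star_comp _ _ _)) ?admissibleD.
apply/val_inj; apply: (meval_ext_generic (genpoly_neq0 _)) => v /genpolyP gv.
rewrite star_comp_val // meval0; apply: big1 => J _; rewrite /rhov big1 ?mulr0 ?mul0r // => E _.
by rewrite /pev meval0 mul0r.
Qed.

Lemma star_comp0r d e (f : Hd d) : star_comp tau f (0 : Md s e) = 0.
Proof.
case: (boolP (admissible s e)) => ae; last by rewrite (Md_nadm (star_comp _ _ _)) ?admissibleD.
apply/val_inj; apply: (meval_ext_generic (genpoly_neq0 _)) => v /genpolyP gv.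
rewrite star_comp_val // meval0; apply: big1 => J _.
by rewrite /pev meval0 mulr0 mul0r.
Qed.

Lemma star_bound (x : H) (g : M) B : (forall i, (B <= i)%N -> x i = 0) ->
  (forall i, (B <= i)%N -> g i = 0) ->
  star tau x g = \sum_(d < B) \sum_(e < B) dinj (Md s) (d.*2 + e)%N (star_comp tau (x d) (g e)).
Proof.
move=> xB gB; rewrite /star (@fsum_nat _ _ B).
  by apply: eq_bigr => d1 _; apply: fsum_nat => d2 /gB->; rewrite star_comp0r linear0.
move=> d1 /xB->; rewrite (@fsum_nat _ _ 0%N) ?big_ord0 // => d2 _.
by rewrite star_comp0l linear0.
Qed.

Definition rhob : H -> H := rho m (Nexp s tau b) (cst_neq0 s tau).

HB.instance Definition _ := GRing.Linear.on rhob.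

Lemma star_comp_pts n (v : 'I_n -> rat) (I : {set 'I_n}) d e (f : Hd d) (g : Md s e) :
  gen v -> (d.*2 + e = #|I|.*2 + b)%N -> pev (val (star_comp tau f g)) (pts v I) =
  \sum_(J : {set 'I_n} | J \subset I)
    (if #|J| == d then rhov m (Nexp s tau b) (cst s tau) (val f) v J else 0) *
    (if e == (#|I :\: J|.*2 + b)%N then pev (val g) (pts v (I :\: J)) else 0) *
    crossprod (hker m (sqv v)) (I :\: J) J.
Proof.
move=> gv Ie; case: (boolP (admissible s e)) => ae; last first.
  rewrite (Md_nadm (star_comp _ _ _)) ?admissibleD // (Md_nadm g) // /pev /= meval0.
  by rewrite big1 // => J _; case: ifP => _; case: ifP => _; rewrite ?meval0 ?mulr0 ?mul0r.
have Ih : #|I| = (d.*2 + e)./2 by rewrite Ie half_bit.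
have [phi phiI phiT] := enum_map Ih.
have gvp : gen (v \o phi) by split=> [i|i j]; [apply: gv.1|move=> /gv.2/phiI].
have sP : val (star_comp tau f g) \is symmetric by apply: Md_sym.
rewrite -{1}phiT -(pev_imset _ sP phiI) ?cardsT ?card_ord // meval_pts.
rewrite star_comp_val // -[in RHS]phiT sum_imset_sub // /ssum big_mkcond /=.
have eb : odd e = b by have := congr1 odd Ie; rewrite !oddD !odd_double /= oddb.
have -> : Nexp s tau e = Nexp s tau b by rewrite Nexp_odd eb.
apply: eq_bigr => J _.
have phiC : phi @: setT :\: phi @: J = phi @: (~: J).
  apply/setP => i; rewrite !inE; apply/andP/imsetP => [[iJ /imsetP[j _ ij]]|[j jJ ->]].
    by exists j; rewrite // inE; apply: contra iJ => jJ; rewrite ij imset_f.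
  by rewrite !mem_imset // in_setT; move: jJ; rewrite inE => ->.
rewrite phiC !card_imset //; case: eqP => [Jd|]; last by rewrite !mul0r.
have cJ : #|~: J| = e./2.
  have := cardsC J; rewrite [X in _ = X]card_ord Jd.
  by move: #|~: J| => k; rewrite half_star; lia.
have -> : e == (#|~: J|.*2 + b)%N.
  by rewrite cJ -{1}[e]odd_double_half eb addnC.
rewrite -crossprod_imset // -(pev_imset _ _ phiI) //; last exact: Md_sym.
by rewrite rhov_imset //; apply: valP.
Qed.

Lemma ev_star n (v : 'I_n -> rat) x g (I : {set 'I_n}) : gen v ->
  ev (sqv v) (unsq (star tau x g)) I = ev (sqv v) (unsq g ** rhob x) I.
Proof.
move=> gv; rewrite ev_unsq ev_hmul; last exact: gv.2.
rewrite /conv sum_setD.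
have [B [xB gB]] := dsum_bound2 x g.
have decx J : ev (sqv v) (rhob x) J =
    \sum_(d < B) if #|J| == d then rhov m (Nexp s tau b) (cst s tau) (val (x d)) v J else 0.
  rewrite {1}(dsum_decomp xB) linear_sum ev_sum; apply: eq_bigr => d _.
  rewrite ev_rho //; case: eqP => [Jd|Jd].
    by move: (x d); rewrite -Jd => y; rewrite dinjE.
  rewrite dinj_neq => [|e]; last by apply: Jd.
  by rewrite /rhov big1 ?mulr0 // => E _; rewrite /pev meval0 mul0r.
have decg J : ev (sqv v) (unsq g) J =
    \sum_(e < B) if e == (#|J|.*2 + b)%N :> nat then pev (val (g e)) (pts v J) else 0.
  rewrite ev_unsq {1}(dsum_decomp gB) evM_sum; apply: eq_bigr => e _.
  by rewrite evM_dinj.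
rewrite (star_bound xB gB) evM_sum.
under [RHS]eq_bigr => J JI.
  rewrite setDDr finset.setDv finset.set0U (setIidPr JI) decx decg [_ * (\sum_(d < B) _)]mulrC.
  rewrite mulr_suml mulr_suml.
over.
rewrite exchange_big /=; apply: eq_bigr => d _.
under [RHS]eq_bigr => J _ do rewrite mulr_sumr mulr_suml.
rewrite exchange_big /= evM_sum; apply: eq_bigr => e _.
rewrite evM_dinj; case: eqP => [Id|Id]; first exact: star_comp_pts.
apply/esym/big1 => J JI; case: eqP => J1; last by rewrite !mul0r.
case: eqP => J2; last by rewrite mulr0 mul0r.
case: Id; rewrite -J1 J2 -(cardsID J I) (setIidPr JI) doubleD addnA //.
Qed.

Lemma unsq_star x g : unsq (star tau x g) = unsq g ** rhob x.
Proof. by apply: coha_ext_sq => n v gv; apply: ev_star. Qed.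

End Transport.

(** * Decomposable elements *)

Section LinearSpans.
Variables (V : lmodType rat) (A : set V).

Lemma lspan_gen x : A x -> x \in lspan A.
Proof.
move=> Ax; apply/asboolP; exists 1%N, (fun=> 1), (fun=> x); split=> //.
by rewrite big_ord1 scale1r.
Qed.

Lemma lspan_ind (P : V -> Prop) : P 0 -> (forall a x y, A x -> P y -> P (a *: x + y)) ->
  forall x, x \in lspan A -> P x.
Proof.
move=> P0 PD x /asboolP[n [a [v [Av ->]]]].
by elim/big_rec: _ => // i y _ Py; apply: PD.
Qed.

Lemma lspan_sub (S : submodClosed V) : (forall x, A x -> x \in S) ->
  forall x, x \in lspan A -> x \in S.
Proof.
by move=> AS; apply: lspan_ind => [|a x y /AS xS yS]; [apply: rpred0|rewrite rpredD ?rpredZ].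
Qed.

Lemma lspan_image (W : lmodType rat) (f : {linear V -> W}) (B : set W) :
  (forall x, A x -> f x \in lspan B) -> forall x, x \in lspan A -> f x \in lspan B.
Proof.
move=> AB; apply: lspan_ind => [|a x y /AB xB yB]; first by rewrite linear0 rpred0.
by rewrite linearP rpredD ?rpredZ.
Qed.

End LinearSpans.

Lemma dscale_delta (V : nat -> lmodType rat) d (x : dsum V) :
  dscale (fun i => (i == d)%:R) x = dinj V d (x d).
Proof.
apply: dsumP => i; rewrite dscaleE; have [->|id] := eqVneq i d; first by rewrite dinjE scale1r.
by rewrite scale0r dinj_neq // => e; rewrite e eqxx in id.
Qed.

Section Orderings.
Variables (a b d : nat).
Hypothesis dE : d = (a + b)%N.
Local Notation T := ('I_a + 'I_b)%type.

(** The injections are bijections by cardinality, and the symmetric group acts simply transitively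
    on them. *)
Lemma sum_perm_inj (R : nmodType) (F : {ffun T -> 'I_d} -> R) (p : {ffun T -> 'I_d}) :
  injective p -> \sum_(g : {ffun T -> 'I_d} | injectiveb g) F g =
  \sum_(s : 'S_d) F [ffun x => s (p x)].
Proof.
move=> pI; have cT : (#|'I_d| <= #|{: T}|)%N by rewrite card_sum !card_ord dE.
have [q pK qK] := inj_card_bij pI cT.
transitivity (\sum_(g in (fun s : 'S_d => [ffun x => s (p x)]) @: setT) F g); last first.
  rewrite big_imset /=; last first.
    move=> s t _ _ e; apply/perm.permP => i; rewrite -(qK i).
    by have /ffunP/(_ (q i)) := e; rewrite !ffunE.
  by apply: eq_bigl => s; rewrite inE.
apply: eq_bigl => g; apply/injectiveP/imsetP => [gI|[s _ ->] x y].
  have gqI : injective (g \o q) by apply: inj_comp => //; apply: can_inj qK.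
  by exists (perm gqI); rewrite ?inE //; apply/ffunP => x; rewrite ffunE permE /= pK.
by rewrite !ffunE => /perm_inj/pI.
Qed.

Definition twoperm (al : 'S_a) (be : 'S_b) (x : T) : T :=
  match x with inl i => inl (al i) | inr j => inr (be j) end.

Lemma twoperm_inj al be : injective (twoperm al be).
Proof. by move=> [i|i] [j|j] //= [] /perm_inj ->. Qed.

Lemma sum_inj_twoperm (R : nmodType) (F : {ffun T -> 'I_d} -> R) al be :
  \sum_(g : {ffun T -> 'I_d} | injectiveb g) F g =
  \sum_(g : {ffun T -> 'I_d} | injectiveb g) F [ffun x => g (twoperm al be x)].
Proof.
have [q tK qK] := injF_bij (@twoperm_inj al be).
rewrite (reindex_onto (fun g : {ffun T -> 'I_d} => [ffun x => g (twoperm al be x)])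
  (fun g => [ffun x => g (q x)])) /=; last first.
  by move=> g _; apply/ffunP => x; rewrite !ffunE tK.
apply: eq_bigl => g; apply/andP/injectiveP => [[/injectiveP gI _]|gI].
  by move=> x y gxy; apply: (can_inj qK); apply: gI; rewrite !ffunE !qK.
split; first by apply/injectiveP => x y; rewrite !ffunE => /gI/twoperm_inj.
by apply/eqP/ffunP => x; rewrite !ffunE qK.
Qed.

(* Summing over all orderings of the variables is, up to a scalar, summing over
   their partitions into blocks of sizes a and b. *)
Lemma sum_inj_lblock (F : {set 'I_d} -> rat) :
  \sum_(p : {ffun T -> 'I_d} | shuffle p) \sum_(g : {ffun T -> 'I_d} | injectiveb g) F (lblock g) =
  (\sum_(J : {set 'I_d} | #|J| == a) F J) *+ #|'S_d|.
Proof.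
transitivity (\sum_(p : {ffun T -> 'I_d} | shuffle p) \sum_(s : 'S_d) F (s @: lblock p)).
  apply: eq_bigr => p /shuffleP[pI _ _]; rewrite (sum_perm_inj _ pI).
  apply: eq_bigr => s _; congr F; rewrite /lblock -imset_comp.
  by apply: eq_imset => i /=; rewrite ffunE.
rewrite exchange_big /= -sumr_const; apply: eq_bigr => s _.
rewrite (sum_shuffle dE (fun J => F (s @: J))).
rewrite [RHS](reindex_inj (imset_inj (@perm_inj _ s))) /=.
by apply: eq_bigl => J; rewrite card_imset //; apply: perm_inj.
Qed.

End Orderings.

Section Decomposables.
Variable m : nat.
Local Notation H := coha.
Local Notation "x ** y" := (hmul m x y) (at level 40, left associativity).

Definition decomp : set H := [set h | exists i j x y,
  [/\ (0 < i)%N, (0 < j)%N, hdeg i x, hdeg j y & h = x ** y]]%classic.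

Section Fixed.
Variable d : nat.

(** Decomposability is tracked through functions on tuples of distinct points, because the terms of
    the sums below have denominators when [m = 0]. *)
Definition decval (c : ('I_d -> rat) -> rat) : Prop := exists z,
  [/\ z \in lspan decomp, hdeg d z & forall v, injective v -> (val (z d)).@[v] = c v].

Lemma decval_eq c c' : (forall v, injective v -> c v = c' v) -> decval c -> decval c'.
Proof. by move=> cc [z [zD zd zc]]; exists z; split=> // v vI; rewrite -cc // zc. Qed.

Lemma decval0 : decval (fun=> 0).
Proof. by exists 0; split=> //; [exact: rpred0|move=> v _; rewrite meval0]. Qed.

Lemma decvalD c c' : decval c -> decval c' -> decval (fun v => c v + c' v).
Proof.
move=> [z [zD zd zc]] [z' [zD' zd' zc']]; exists (z + z'); split; first exact: rpredD.
  by move=> i id; rewrite -[LHS]/(z i + z' i) zd // zd' // addr0.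
by move=> v vI; rewrite -zc // -zc' // -mevalD.
Qed.

Lemma decvalZ a c : decval c -> decval (fun v => a * c v).
Proof.
move=> [z [zD zd zc]]; exists (a *: z); split; first exact: rpredZ.
  by move=> i id; rewrite -[LHS]/(a *: z i) zd // scaler0.
by move=> v vI; rewrite -zc // -mevalZ.
Qed.

Lemma decval_sum I (r : seq I) (P : pred I) (C : I -> ('I_d -> rat) -> rat) :
  (forall i, P i -> decval (C i)) -> decval (fun v => \sum_(i <- r | P i) C i v).
Proof.
move=> CP; elim: r => [|i r IH].
  by apply: decval_eq decval0 => v _; rewrite big_nil.
have [Pi|Pi] := boolP (P i); last by apply: decval_eq IH => v _; rewrite big_cons (negPf Pi).
by apply: decval_eq (decvalD (CP i Pi) IH) => v _; rewrite big_cons Pi.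
Qed.

Lemma decvalK a c : a != 0 -> decval (fun v => a * c v) -> decval c.
Proof. by move=> a0 /(decvalZ a^-1); apply: decval_eq => v _; rewrite mulKf. Qed.

Lemma decval_prod a b (f : Hd a) (g : Hd b) : d = (a + b)%N -> (0 < a)%N -> (0 < b)%N ->
  decval (hsum m (val f) (val g) (n := d)).
Proof.
move=> dE a0 b0; exists (dinj Hd a f ** dinj Hd b g); split.
- by apply: lspan_gen; exists a, b, (dinj Hd a f), (dinj Hd b g); split=> //; apply: hdeg_dinj.
- by rewrite dE; apply: hdeg_hmul; apply: hdeg_dinj.
move=> v vI; rewrite -evT ev_hmul // /conv /hsum big_mkcond [RHS]big_mkcond /=.
apply: eq_bigr => J _; rewrite subsetT setTD !ev_dinj.
case: eqP => [Ja|_]; last by rewrite !mul0r.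
have -> : #|~: J| = b.
  by have := cardsC J; rewrite [X in _ = X]card_ord Ja; move: #|~: J| => k; lia.
by rewrite eqxx.
Qed.

Lemma symsum_sym k (p : {mpoly rat[k]}) : \sum_(s : 'S_k) msym s p \is symmetric.
Proof.
apply/issymP => t; rewrite raddf_sum /= [RHS](reindex_inj (mulIg t)) /=.
by apply: eq_bigr => s _; rewrite msymMm.
Qed.

(** The monomial is a product of a monomial [u] in the variables of [I] and a monomial [w] in the
    others; the sum is, up to a scalar, the product in H of their symmetrisations. *)
Lemma decval_mono (I : {set 'I_d}) (k : 'X_{1..d}) : I != set0 -> I != setT ->
  decval (fun v => \sum_(s : 'S_d) 'X_[k].@[v \o s] *
    crossprod (hker m v) (s @: I) (~: (s @: I))).
Proof.
move=> I0 IT; set a := #|I|; set b := #|~: I|.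
have dE : d = (a + b)%N by rewrite -[LHS]card_ord -(cardsC I).
have [p0 ps pI] := shuffle_of_set dE (erefl : #|I| = a).
have [p0I _ _] := shuffleP _ ps.
pose u : {mpoly rat[a]} := 'X_[[multinom k (p0 (inl i)) | i < a]].
pose w : {mpoly rat[b]} := 'X_[[multinom k (p0 (inr i)) | i < b]].
pose f : Hd a := insp (symsum_sym u : _ \in sympol (d := a)).
pose g : Hd b := insp (symsum_sym w : _ \in sympol (d := b)).
have a0 : (0 < a)%N by rewrite card_gt0.
have b0 : (0 < b)%N.
  by rewrite card_gt0; apply: contraNneq IT => C0; rewrite -[I]setCK C0 setC0.
pose K (v : 'I_d -> rat) (J : {set 'I_d}) := crossprod (hker m v) J (~: J).
pose nsh := #|[pred p : {ffun 'I_a + 'I_b -> 'I_d} | shuffle p]|.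
have nsh0 : nsh%:R != 0 :> rat.
  by rewrite pnatr_eq0 -lt0n; apply/card_gt0P; exists p0.
have pab : (#|'S_a| * #|'S_b| * nsh)%:R != 0 :> rat.
  rewrite natrM mulf_neq0 // natrM mulf_neq0 // pnatr_eq0 -lt0n.
    by apply/card_gt0P; exists 1%g.
  by apply/card_gt0P; exists 1%g.
(* Symmetrising [u] and [w] contributes the orders of the two smaller groups; [nsh] and the order of
   the full group come from replacing blocks by orderings in [sum_inj_lblock]. *)
apply: (@decvalK (#|'S_a| * #|'S_b| * nsh)%:R) => //.
apply: decval_eq (decvalZ #|'S_d|%:R (decval_prod f g dE a0 b0)) => v vI.
pose F J := pev (val f) (pts v J) * pev (val g) (pts v (~: J)) * K v J.
pose Phi (h : {ffun 'I_a + 'I_b -> 'I_d}) := u.@[fun i => v (h (inl i))] *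
  w.@[fun j => v (h (inr j))] * K v (lblock h).
have FPhi (h : {ffun 'I_a + 'I_b -> 'I_d}) : injectiveb h -> F (lblock h) =
    \sum_(al : 'S_a) \sum_(be : 'S_b) Phi [ffun x => h (twoperm al be x)].
  move=> /injectiveP hI; rewrite /F -(lblock_pev v (valP f) hI) -(rblock_pev dE v (valP g) hI) /=.
  rewrite !raddf_sum /= mulr_suml mulr_suml; apply: eq_bigr => al _.
  rewrite mulr_sumr mulr_suml; apply: eq_bigr => be _; rewrite /Phi !meval_msym.
  congr (_ * _ * K v _); try by apply: meval_eq => i; rewrite ffunE.
  apply/setP => x; apply/imsetP/imsetP => -[i _ ->].
    by exists ((al^-1)%g i); rewrite ?inE // ffunE /= permKV.
  by exists (al i); rewrite ?inE // ffunE.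
have sumPhi : \sum_(h : {ffun 'I_a + 'I_b -> 'I_d} | injectiveb h) F (lblock h) =
    (#|'S_a| * #|'S_b|)%:R * \sum_(s : 'S_d) 'X_[k].@[v \o s] * K v (s @: I).
  rewrite (eq_bigr _ FPhi) exchange_big /=.
  under eq_bigr => al _ do rewrite exchange_big /=.
  under eq_bigr => al _ do under eq_bigr => be _ do rewrite -sum_inj_twoperm.
  rewrite !sumr_const -mulrnA mulnC -[LHS]mulr_natl; congr (_ * _).
  rewrite (sum_perm_inj dE _ p0I); apply: eq_bigr => s _; rewrite /Phi.
  congr (_ * K v _); last first.
    rewrite -pI /lblock -imset_comp; apply: eq_imset => i /=; by rewrite ffunE.
  rewrite !mevalX (bigID (fun x => x \in lblock p0)) /=; congr (_ * _).
    rewrite [RHS]big_imset /=; last by move=> i j _ _ /p0I[].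
    by apply: eq_big => [i|i _]; rewrite ?inE // mnmE ffunE.
  transitivity (\prod_(x in ~: lblock p0) (v \o s) x ^+ k x); last first.
    by apply: eq_bigl => x; rewrite inE.
  rewrite (rblockE dE p0I) [RHS]big_imset /=; last by move=> i j _ _ /p0I[].
  by apply: eq_big => [i|i _]; rewrite ?inE // mnmE ffunE.
rewrite mulr_natl -[hsum _ _ _ _]/(\sum_(J : {set 'I_d} | #|J| == a) F J) -(sum_inj_lblock dE).
by rewrite sumr_const -[#|_|]/nsh sumPhi natrM -mulr_natl; ring.
Qed.

Lemma decval_symm (I : {set 'I_d}) (h : {mpoly rat[d]}) : I != set0 -> I != setT ->
  decval (fun v => \sum_(s : 'S_d) h.@[v \o s] * crossprod (hker m v) (s @: I) (~: (s @: I))).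
Proof.
move=> I0 IT; elim/mpolyind: h => [|c k h _ _ IH].
  by apply: decval_eq decval0 => v _; rewrite big1 // => s _; rewrite meval0 mul0r.
apply: decval_eq (decvalD (decvalZ c (decval_mono k I0 IT)) IH) => v _.
rewrite mulr_sumr -big_split /=; apply: eq_bigr => s _.
by rewrite mevalD mevalZ; ring.
Qed.

Definition proper_block (I : {set 'I_d}) := (I != set0) && (I != setT).

(** The identity is summed over all permutations of the variables. Dividing by the Vandermonde
    determinant turns [kerpoly m I] into the kernel of the block [I], so a positive multiple of [f]
    is a sum of functions that are decomposable by [decval_symm]. *)
Lemma decomp_crit (f : Hd d) (h : {set 'I_d} -> {mpoly rat[d]}) :
  val f * vdm d = \sum_(I | proper_block I) h I * kerpoly m I -> dinj Hd d f \in lspan decomp.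
Proof.
move=> fE; suff [z [zD zd zf]] : decval (fun v => (val f).@[v]).
  rewrite (_ : dinj Hd d f = z) // (hdegE zd); congr dinj; apply/val_inj.
  by apply: (meval_ext_generic (vdm_neq0 d)) => v /vdm_neq0_inj vI; rewrite zf.
have d0 : #|'S_d|%:R != 0 :> rat.
  by rewrite pnatr_eq0 -lt0n; apply/card_gt0P; exists 1%g.
apply: (decvalK d0).
have dec : decval (fun v => \sum_(I | proper_block I)
    \sum_(s : 'S_d) (h I).@[v \o s] * crossprod (hker m v) (s @: I) (~: (s @: I))).
  by apply: decval_sum => I /andP[I0 IT]; apply: decval_symm.
apply: decval_eq dec => v vI; rewrite exchange_big /= mulr_natl -sumr_const.
apply: eq_bigr => s _; have /sym_mevalP/(_ s v) <- : val f \is symmetric := valP f.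
have vsI : injective (v \o s) by apply: inj_comp => //; apply: perm_inj.
apply: (mulIf (vdm_meval_neq0 vsI)); rewrite -mevalM fE raddf_sum mulr_suml.
apply: eq_bigr => I _; rewrite /= mevalM meval_kerpoly // mulrA; congr (_ * _ * _).
have -> : ~: (s @: I) = s @: (~: I).
  apply/setP => i; rewrite -[i](permKV s) inE !mem_imset ?inE //; exact: perm_inj.
by rewrite -crossprod_imset //; apply: perm_inj.
Qed.

End Fixed.
End Decomposables.

(** * Cancelling linear factors modulo the ideal of kernels *)

Section Derivation.
Variable d : nat.
Implicit Types p q : {mpoly rat[d]}.

(** The infinitesimal form of simultaneous translation of all variables; it kills every function of
    their differences, in particular [kerpoly]. *)
Definition dsumv p : {mpoly rat[d]} := \sum_i p^`M(i).

Lemma dsumv_is_linear : linear dsumv.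
Proof.
move=> a p q; rewrite /dsumv scaler_sumr -big_split /=; apply: eq_bigr => i _.
by rewrite mderivD mderivZ.
Qed.

HB.instance Definition _ :=
  GRing.isLinear.Build rat {mpoly rat[d]} {mpoly rat[d]} *:%R dsumv dsumv_is_linear.

Lemma dsumvM p q : dsumv (p * q) = dsumv p * q + p * dsumv q.
Proof.
rewrite /dsumv mulr_suml mulr_sumr -big_split /=; apply: eq_bigr => i _.
by rewrite mderivM.
Qed.

Lemma dsumvX i : dsumv 'X_i = 1.
Proof.
rewrite /dsumv (bigD1 i) //= mderivX mnm1E eqxx scale1r big1 => [|j ji].
  rewrite addr0 (_ : (U_(i) - U_(i))%MM = 0%MM) ?mpolyX0 //.
  by apply/mnmP => k; rewrite mnmBE subnn mnm0E.
by rewrite mderivX mnm1E eq_sym (negPf ji) scale0r.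
Qed.

Lemma dsumv1 : dsumv 1 = 0.
Proof. by rewrite /dsumv big1 // => i _; rewrite -mpolyC1 mderivC. Qed.

Lemma dsumv_prod0 I (r : seq I) (P : pred I) (F : I -> {mpoly rat[d]}) :
  (forall i, P i -> dsumv (F i) = 0) -> dsumv (\prod_(i <- r | P i) F i) = 0.
Proof.
move=> F0; apply: (big_ind (fun p => dsumv p = 0)) => //; first exact: dsumv1.
by move=> p q p0 q0; rewrite dsumvM p0 q0 mul0r mulr0 addr0.
Qed.

Lemma dsumv_expr0 p k : dsumv p = 0 -> dsumv (p ^+ k) = 0.
Proof.
move=> p0; elim: k => [|k IH]; first exact: dsumv1.
by rewrite exprS dsumvM p0 IH mul0r mulr0 addr0.
Qed.

Lemma dsumv_nilp p : exists k, iter k dsumv p = 0.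
Proof.
suff nil k q : (forall l : 'X_{1..d}, (k <= mdeg l)%N -> q@_l = 0) -> iter k dsumv q = 0.
  exists (msize p); apply: nil => l /msize_mdeg_ge; exact: memN_msupp_eq0.
elim: k q => [|k IH] q ql; first by apply/mpolyP => l; rewrite ql // mcoeff0.
rewrite iterSr IH // => l kl; rewrite raddf_sum /= big1 // => i _.
by rewrite mcoeff_deriv ql ?mul0rn // mdegD mdeg1 addn1.
Qed.

Lemma iter_dsumvM p l (c : rat) k : dsumv l = c%:MP ->
  iter k.+1 dsumv (l * p) = (k.+1%:R * c) *: iter k dsumv p + l * iter k.+1 dsumv p.
Proof.
move=> lc; elim: k => [|k IH]; first by rewrite /= dsumvM lc mul1r mul_mpolyC.
rewrite iterS IH linearD linearZ /= dsumvM lc mul_mpolyC addrA -scalerDl.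
congr (_ *: _ + _); rewrite -[in RHS]addn1 natrD; ring.
Qed.

Variable m : nat.

(** By [decomp_crit], a symmetric [f] is decomposable as soon as [f * vdm d] satisfies this. *)
Definition inJ p : Prop := exists h : {set 'I_d} -> {mpoly rat[d]},
  p = \sum_(I | proper_block I) h I * kerpoly m I.

Lemma inJ0 : inJ 0.
Proof. by exists (fun=> 0); rewrite big1 // => I _; rewrite mul0r. Qed.

Lemma inJD p q : inJ p -> inJ q -> inJ (p + q).
Proof.
move=> [h ->] [k ->]; exists (fun I => h I + k I); rewrite -big_split /=.
by apply: eq_bigr => I _; rewrite mulrDl.
Qed.

Lemma inJM p q : inJ q -> inJ (p * q).
Proof.
move=> [h ->]; exists (fun I => p * h I); rewrite mulr_sumr.
by apply: eq_bigr => I _; rewrite mulrA.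
Qed.

Lemma inJZ a p : inJ p -> inJ (a *: p).
Proof. by rewrite -mul_mpolyC; apply: inJM. Qed.

Lemma dsumv_kerpoly I : dsumv (kerpoly m I) = 0.
Proof.
have X0 (j k : 'I_d) : dsumv ('X_k - 'X_j) = 0 by rewrite linearB /= !dsumvX subrr.
have M0 p q : dsumv p = 0 -> dsumv q = 0 -> dsumv (p * q) = 0.
  by move=> p0 q0; rewrite dsumvM p0 q0 mul0r mulr0 addr0.
apply: (M0); first by apply: dsumv_expr0; apply: dsumv_prod0 => i _; apply: dsumv_prod0.
apply: (M0); first by apply: (M0); apply: dsumv_prod0.
apply: dsumv_prod0 => i _; apply: dsumv_prod0 => j _; case: ifP => _; first exact: dsumv1.
by rewrite linearN /= dsumv1 oppr0.
Qed.

Lemma inJ_dsumv p : inJ p -> inJ (dsumv p).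
Proof.
move=> [h ->]; exists (fun I => dsumv (h I)); rewrite linear_sum.
by apply: eq_bigr => I _; rewrite /= dsumvM dsumv_kerpoly mulr0 addr0.
Qed.

(* J is stable under D, the sum of the partial derivatives. When D l is a nonzero
   constant, D^(k+1) (l p) = (k+1) (D l) D^k p + l D^(k+1) p, and D is locally
   nilpotent, so l p in J yields D^k p in J by descending induction on k. *)
Lemma inJ_cancel p l (c : rat) : c != 0 -> dsumv l = c%:MP -> inJ (l * p) -> inJ p.
Proof.
move=> c0 lc lp; have [K pK] := dsumv_nilp p.
suff down k : (k <= K)%N -> inJ (iter (K - k) dsumv p).
  by have := down K (leqnn K); rewrite subnn.
elim: k => [|k IH] kK; first by rewrite subn0 pK; apply: inJ0.
have := IH (ltnW kK); have -> : (K - k = (K - k.+1).+1)%N by lia.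
set j := (K - k.+1)%N => pj.
have lj : inJ (iter j.+1 dsumv (l * p)).
  by elim: j.+1 => [|i]; [|rewrite iterS; apply: inJ_dsumv].
have a0 : j.+1%:R * c != 0 by rewrite mulf_neq0 // pnatr_eq0.
rewrite -[iter j _ _](scalerK a0); apply: inJZ.
have -> : (j.+1%:R * c) *: iter j dsumv p =
    iter j.+1 dsumv (l * p) + (- l) * iter j.+1 dsumv p.
  by rewrite (iter_dsumvM _ _ lc) mulNr addrK.
by apply: inJD => //; apply: inJM.
Qed.

Definition nzdiv q : Prop := forall p, inJ (q * p) -> inJ p.

Lemma nzdiv_prod I (r : seq I) (P : pred I) (F : I -> {mpoly rat[d]}) :
  (forall i, P i -> nzdiv (F i)) -> nzdiv (\prod_(i <- r | P i) F i).
Proof.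
move=> Fn; apply: (big_ind nzdiv) => //; first by move=> p; rewrite mul1r.
by move=> q q' qn qn' p; rewrite -mulrA => /qn /qn'.
Qed.

Lemma nzdiv_expr q k : nzdiv q -> nzdiv (q ^+ k).
Proof.
move=> qn; elim: k => [|k IH] p; first by rewrite mul1r.
by rewrite exprS -mulrA => /qn /IH.
Qed.

Lemma nzdivX i : nzdiv (- 'X_i).
Proof.
move=> p; apply: (@inJ_cancel _ _ (-1)); first by rewrite oppr_eq0 oner_eq0.
by rewrite linearN /= dsumvX mpolyCN.
Qed.

Lemma nzdivXX i j : nzdiv (- 'X_i - 'X_j).
Proof.
move=> p; apply: (@inJ_cancel _ _ (-2%:R)); first by rewrite oppr_eq0 pnatr_eq0.
by rewrite linearB linearN /= !dsumvX mpolyCN mpolyC_nat -opprD -mulr2n.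
Qed.

End Derivation.

Section PolynomialFunctions.
Variable n : nat.
Implicit Types phi psi : ('I_n -> rat) -> rat.

(** Records that denominators have been cleared without naming the polynomial; agreement is asked
    only where no pole can occur. *)
Definition polyfun phi : Prop := exists p : {mpoly rat[n]}, forall v, gen v -> phi v = p.@[v].

Lemma polyfun_eq phi psi : (forall v, gen v -> phi v = psi v) -> polyfun psi -> polyfun phi.
Proof. by move=> pp [p pE]; exists p => v gv; rewrite pp // pE. Qed.

Lemma polyfunC c : polyfun (fun=> c).
Proof. by exists c%:MP => v _; rewrite mevalC. Qed.

Lemma polyfunX i : polyfun (fun v => v i).
Proof. by exists 'X_i => v _; rewrite mevalXU. Qed.

Lemma polyfunD phi psi : polyfun phi -> polyfun psi -> polyfun (fun v => phi v + psi v).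
Proof. by move=> [p pE] [q qE]; exists (p + q) => v gv; rewrite pE // qE // mevalD. Qed.

Lemma polyfunM phi psi : polyfun phi -> polyfun psi -> polyfun (fun v => phi v * psi v).
Proof. by move=> [p pE] [q qE]; exists (p * q) => v gv; rewrite pE // qE // mevalM. Qed.

Lemma polyfunN phi : polyfun phi -> polyfun (fun v => - phi v).
Proof. by move=> [p pE]; exists (- p) => v gv; rewrite pE // mevalN. Qed.

Lemma polyfunB phi psi : polyfun phi -> polyfun psi -> polyfun (fun v => phi v - psi v).
Proof. by move=> p q; apply: polyfunD => //; apply: polyfunN. Qed.

Lemma polyfun_expr phi k : polyfun phi -> polyfun (fun v => phi v ^+ k).
Proof. by move=> [p pE]; exists (p ^+ k) => v gv; rewrite pE // rmorphXn. Qed.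

Lemma polyfun_prod I (r : seq I) (P : pred I) (F : I -> ('I_n -> rat) -> rat) :
  (forall i, P i -> polyfun (F i)) -> polyfun (fun v => \prod_(i <- r | P i) F i v).
Proof.
move=> FP; elim: r => [|i r IH].
  by apply: polyfun_eq (polyfunC 1) => v _; rewrite big_nil.
have [Pi|Pi] := boolP (P i); last by apply: polyfun_eq IH => v _; rewrite big_cons (negPf Pi).
by apply: polyfun_eq (polyfunM (FP i Pi) IH) => v _; rewrite big_cons Pi.
Qed.

Lemma polyfun_flip (p : {mpoly rat[n]}) E : polyfun (fun v => p.@[flip E v]).
Proof.
exists (p \mPo [tuple if i \in E then - 'X_i else 'X_i | i < n]) => v _.
rewrite comp_mpoly_meval; apply: meval_eq => i; rewrite tnth_mktuple /flip.
by case: ifP; rewrite ?mevalN mevalXU.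
Qed.

End PolynomialFunctions.

Section RhoDecomposable.
Variables (m N : nat) (c : rat).
Hypothesis c0 : c != 0.
Local Notation H := coha.
Local Notation "x ** y" := (hmul m x y) (at level 40, left associativity).
Local Notation rv := (rhov m N c).
Local Notation rt := (rhoterm m N).

(** In the value of a product the empty and the full block drop out, both factors having positive
    degree. *)
Lemma lspan_decomp_values d (z : H) : z \in lspan (decomp m) ->
  exists h : {set 'I_d} -> {mpoly rat[d]}, forall v, injective v -> (val (z d)).@[v] =
    \sum_(I | proper_block I) (h I).@[v] * crossprod (hker m v) I (~: I).
Proof.
move: z; apply: lspan_ind.
  by exists (fun=> 0) => v _ /=; rewrite meval0 big1 // => I _; rewrite mul0r.
move=> a z z' [i [j [x [y [i0 j0 xi yj ->]]]]] [h hE].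
exists (fun I : {set 'I_d} => a *: (polblock (val (x #|I|)) I * polblock (val (y #|~: I|)) (~: I)) + h I).
move=> v vI; rewrite -evT evD evZ (evT v z') hE // ev_hmul // /conv mulr_sumr.
rewrite (bigID (@proper_block d)) /= [X in _ + X + _]big1 ?addr0 => [|I /andP[_ nI]]; last first.
  have [I0|I0] := eqVneq I set0.
    have Ii : #|I| <> i by rewrite I0 cards0 => e; rewrite -e in i0.
    by rewrite (ev_hdeg v xi Ii) !mul0r mulr0.
  have IT : I = setT by apply/eqP; move: nI; rewrite /proper_block I0 /= negbK.
  have Ij : #|setT :\: I| <> j by rewrite IT finset.setDv cards0 => e; rewrite -e in j0.
  by rewrite (ev_hdeg v yj Ij) mulr0 mul0r mulr0.
rewrite (eq_bigl (@proper_block d)) => [|I]; last by rewrite subsetT.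
rewrite -big_split /=; apply: eq_bigr => I _.
by rewrite mevalD mevalZ mevalM !meval_polblock setTD mulrDl mulrA.
Qed.

Lemma crossprodC n (k : 'I_n -> 'I_n -> rat) (I J : {set 'I_n}) :
  crossprod k I J = crossprod (fun i j => k j i) J I.
Proof. by rewrite /crossprod exchange_big. Qed.

Lemma hker_sqv n (v : 'I_n -> rat) (I J : {set 'I_n}) : crossprod (hker m (sqv v)) I J =
  crossprod (hker m v) I J * crossprod (fun j k => (v k + v j) ^ (m%:Z - 1)) I J.
Proof.
rewrite -crossprodM; apply: eq_crossprod => i j _ _.
by rewrite /hker -expfzMl /sqv; congr (_ ^ _); ring.
Qed.

(** The inverse of [rhoterm] for [m = N = 0], hence a common denominator for it in all cases. *)
Definition linfac n (v : 'I_n -> rat) (I : {set 'I_n}) : rat :=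
  \prod_(i in I) (- v i) * pairprod (fun i j => - v i - v j) I.

Lemma linfac_split n (v : 'I_n -> rat) (I : {set 'I_n}) :
  linfac v setT = linfac v I * linfac v (~: I) * crossprod (fun i j => - v i - v j) I (~: I).
Proof.
rewrite /linfac (pairprod_split _ (subsetT I)) (big_setID I) /= setTI setTD.
rewrite (@eq_crossprod _ _ _ (fun i j => - v i - v j)); first by ring.
by move=> i j _ _; case: ifP => // _; rewrite addrC.
Qed.

Lemma polyfun_linfac n (I : {set 'I_n}) : polyfun (fun v => linfac v I).
Proof.
apply: polyfunM; apply: polyfun_prod => i _; first by apply: polyfunN; apply: polyfunX.
by apply: polyfunB; [apply: polyfunN|]; apply: polyfunX.
Qed.

Lemma rhoterm_linfac n (v : 'I_n -> rat) (I : {set 'I_n}) : gen v -> rt v I * linfac v I =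
  \prod_(i in I) (- v i) ^+ N * pairprod (fun i j => (- v i - v j) ^+ m) I.
Proof.
move=> gv; rewrite /rhoterm /linfac mulrACA -big_split -pairprodM /=; congr (_ * _).
  by apply: eq_bigr => i _; rewrite exprz_mulX // oppr_eq0 gv.1.
by apply: eq_pairprod => i j _ _; rewrite exprz_mulX // gen_sum_neq0.
Qed.

Lemma polyfun_rhoterm_linfac n (I : {set 'I_n}) : polyfun (fun v => rt v I * linfac v I).
Proof.
apply: (polyfun_eq (fun v gv => rhoterm_linfac I gv)).
apply: polyfunM; apply: polyfun_prod => i _; apply: polyfun_expr.
  by apply: polyfunN; apply: polyfunX.
by apply: polyfunB; [apply: polyfunN|]; apply: polyfunX.
Qed.

Lemma polyfun_opp n (phi : ('I_n -> rat) -> rat) :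
  polyfun phi -> polyfun (fun v => phi (fun i => - v i)).
Proof.
move=> [p pE]; have [q qE] := polyfun_flip p setT; exists q => v gv.
have gN : gen (fun i => - v i).
  split=> [i|i j]; first by rewrite oppr_eq0 gv.1.
  by rewrite /sqv !sqrrN; apply: gv.2.
rewrite -qE // pE //.
by apply: meval_eq => i; rewrite /flip inE.
Qed.

Lemma linfac_opp n (I : {set 'I_n}) :
  exists a, forall v, linfac v I = a * linfac (fun i => - v i) I.
Proof.
exists (\prod_(i in I) (-1) * pairprod (fun _ _ => -1) I) => v.
rewrite /linfac mulrACA -big_split -pairprodM /=; congr (_ * _).
  by apply: eq_bigr => i _; rewrite mulN1r !opprK.
by apply: eq_pairprod => i j _ _; ring.
Qed.

(** Off [I] all coordinates are negated, which changes [linfac] there by a constant factor only; so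
    the parts of [linfac] on [I] and on its complement clear the two weights. *)
Lemma polyfun_flip_block n (p : {mpoly rat[n]}) (I : {set 'I_n}) : polyfun (fun v =>
  p.@[flip (~: I) v] * (rt (flip (~: I) v) I * rt (flip (~: I) v) (~: I)) * linfac v setT).
Proof.
have [a aE] := linfac_opp (~: I).
have pf : polyfun (fun v => p.@[flip (~: I) v] * (rt v I * linfac v I) *
    (a * (rt (fun i => - v i) (~: I) * linfac (fun i => - v i) (~: I))) *
    crossprod (fun i j => - v i - v j) I (~: I)).
  apply: polyfunM; last first.
    apply: polyfun_prod => i _; apply: polyfun_prod => j _.
    by apply: polyfunB; [apply: polyfunN|]; apply: polyfunX.
  apply: polyfunM; last first.
    apply: polyfunM; first exact: polyfunC.
    exact: (polyfun_opp (polyfun_rhoterm_linfac (~: I))).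
  apply: polyfunM; first exact: polyfun_flip.
  exact: polyfun_rhoterm_linfac.
apply: polyfun_eq pf => v gv; rewrite (linfac_split v I) aE.
rewrite (rhoterm_eq m N (w := v) (J := I)); last first.
  by move=> i iI; rewrite /flip inE iI.
rewrite (rhoterm_eq m N (w := fun i => - v i) (J := ~: I)); last first.
  by move=> i iI; rewrite /flip iI.
by ring.
Qed.

(** The mixed factors of [linfac] clear the denominators that the cross product has when [m = 0]. *)
Lemma polyfun_square_block n (p : {mpoly rat[n]}) (I : {set 'I_n}) : polyfun (fun v =>
  p.@[sqv v] * crossprod (fun j k => (v k + v j) ^ (m%:Z - 1)) I (~: I) * linfac v setT).
Proof.
have pf : polyfun (fun v => (sqpoly p).@[v] * (linfac v I * linfac v (~: I)) *
    crossprod (fun j k => - (v k + v j) ^+ m) I (~: I)).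
  apply: polyfunM.
    apply: polyfunM; first by exists (sqpoly p).
    by apply: polyfunM; apply: polyfun_linfac.
  apply: polyfun_prod => i _; apply: polyfun_prod => j _; apply: polyfunN.
  by apply: polyfun_expr; apply: polyfunD; apply: polyfunX.
apply: polyfun_eq pf => v gv; rewrite (linfac_split v I) meval_sqpoly.
have -> : crossprod (fun j k => - (v k + v j) ^+ m) I (~: I) =
    crossprod (fun j k => (v k + v j) ^ (m%:Z - 1)) I (~: I) *
    crossprod (fun i j => - v i - v j) I (~: I).
  rewrite -crossprodM; apply: eq_crossprod => i j _ _.
  have nz : v j + v i != 0 by rewrite -oppr_eq0 opprD gen_sum_neq0.
  by rewrite -(exprz_mulX m nz) -mulrN opprD addrC [- v j - _]addrC.
by ring.
Qed.

(** Changing no sign and changing all signs give the same summand, by the last hypothesis. For the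
    other choices [I] is the set of unchanged variables: [- w i - w j] with exactly one sign changed
    is a difference of coordinates of [v], which produces the kernel of H. *)
Lemma rhov_blocks d (f : {mpoly rat[d]}) v (a : rat) : (0 < d)%N -> gen v ->
  (forall w, f.@[fun i => - w i] = a * f.@[w]) ->
  a * (((-1) ^ (N%:Z - 1)) ^+ d * ((-1) ^ (m%:Z - 1)) ^+ 'C(d, 2)) = 1 ->
  rv f v setT = c ^+ d * (2%:R * (f.@[v] * rt v setT) +
    \sum_(I | proper_block I) f.@[flip (~: I) v] *
      (rt (flip (~: I) v) I * rt (flip (~: I) v) (~: I)) * crossprod (hker m v) I (~: I)).
Proof.
move=> d0 gv fa aE; rewrite /rhov; congr (_ * _).
rewrite (bigD1 set0) ?sub0set //= (bigD1 setT) /=; last first.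
  rewrite subsetT /=; apply/eqP => e; have := cardsT 'I_d; rewrite e cards0 card_ord => e'.
  by rewrite -e' in d0.
have f0 : flip set0 v =1 v by move=> i; rewrite /flip inE.
have fT : flip setT v =1 fun i => - v i by move=> i; rewrite /flip inE.
rewrite !meval_pts (meval_eq _ f0) (meval_eq _ fT) fa.
rewrite (rhoterm_eq m N (fun i _ => f0 i)) (rhoterm_eq m N (fun i _ => fT i)) rhoterm_opp.
rewrite addrA; congr (_ + _).
  move: aE; set k := _ ^+ d * _ => aE.
  by rewrite mulr2n mulrDl mul1r; congr (_ + _); rewrite -[RHS]mul1r -aE; ring.
rewrite [RHS](reindex_inj (can_inj (@setCK _))) /=.
apply: eq_big => [E|E _].
  rewrite subsetT /= /proper_block andbC -(inj_eq (can_inj (@setCK _)) E) setCT.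
  by rewrite -(inj_eq (can_inj (@setCK _)) E set0) setC0.
rewrite setCK meval_pts (rhoterm_split m N _ (subsetT E)) setTD mulrA.
rewrite [rt _ (~: E) * rt _ E]mulrC; congr (_ * _ * _).
rewrite crossprodC; apply: eq_crossprod => i j iE jE; rewrite /hker /flip jE.
by move: iE; rewrite inE => /negPf ->; rewrite opprK addrC.
Qed.

(* Modulo the ideal generated by the kernels of the proper blocks, rho f is twice
   the common summand f rhoterm of the two constant choices of signs, and rhoterm
   is up to denominators a product of linear factors, which can be cancelled. *)
Lemma rho_decomp d (f : Hd d) (a : rat) : (0 < d)%N ->
  (forall w, (val f).@[fun i => - w i] = a * (val f).@[w]) ->
  a * (((-1) ^ (N%:Z - 1)) ^+ d * ((-1) ^ (m%:Z - 1)) ^+ 'C(d, 2)) = 1 ->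
  rho m N c0 (dinj Hd d f) \in lspan (decomp m) -> dinj Hd d f \in lspan (decomp m).
Proof.
move=> d0 fa aE /(lspan_decomp_values d)[h hE].
pose cd := c ^+ d; have cd0 : cd != 0 by rewrite expf_neq0.
(* [phi I] times the kernel of [I] is the contribution of the block [I] after multiplication by
   [linfac]: its term in the decomposition of [rho f], where the kernel at the squares is the kernel
   at [v] times a product of sums, minus the summand of [rho f] that changes the signs off [I]. *)
pose phi (I : {set 'I_d}) (v : 'I_d -> rat) :=
  (h I).@[sqv v] * crossprod (fun j k => (v k + v j) ^ (m%:Z - 1)) I (~: I) * linfac v setT -
  cd * ((val f).@[flip (~: I) v] * (rt (flip (~: I) v) I * rt (flip (~: I) v) (~: I)) *
    linfac v setT).
have /choice[B BE] I : polyfun (phi I).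
  apply: polyfunB; first exact: polyfun_square_block.
  by apply: polyfunM; [apply: polyfunC|apply: polyfun_flip_block].
pose U : {mpoly rat[d]} := (\prod_(i in [set: 'I_d]) (- 'X_i) ^+ N) *
  pairprod (fun i j => (- 'X_i - 'X_j) ^+ m) setT.
have UE v : U.@[v] = \prod_(i in [set: 'I_d]) (- v i) ^+ N *
    pairprod (fun i j => (- v i - v j) ^+ m) setT.
  rewrite mevalM (rmorph_prod (meval v)) (rmorph_pairprod (meval v)); congr (_ * _).
    by apply: eq_bigr => i _; rewrite rmorphXn /= mevalN mevalXU.
  by apply: eq_pairprod => i j _ _; rewrite rmorphXn /= mevalB mevalN !mevalXU.
have Un : nzdiv m U.
  move=> p; rewrite -mulrA => Up; move: p Up.
  suff Un1 : nzdiv m (\prod_(i in [set: 'I_d]) (- 'X_i) ^+ N : {mpoly rat[d]}).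
    move=> p /Un1; apply: nzdiv_prod => -[i j] _ /=.
    by apply: nzdiv_expr; apply: nzdivXX.
  by apply: nzdiv_prod => i _; apply: nzdiv_expr; apply: nzdivX.
suff [k kE] : inJ m (val f * vdm d) by apply: (decomp_crit kE).
apply: Un; rewrite -[U * _](@scalerK _ _ (2%:R * cd)); last by rewrite mulf_neq0.
apply: inJZ; exists B; apply: (meval_ext_generic (genpoly_neq0 _)) => v /genpolyP gv.
have vI := gen_inj gv.
have := hE _ gv.2; rewrite -[rho _ _ _ _ _]/(rho_comp m N c (dinj Hd d f d)) dinjE rho_compE //.
rewrite (rhov_blocks d0 gv fa aE) => rE.
rewrite mevalZ mevalM UE mevalM -rhoterm_linfac // raddf_sum /=.
under eq_bigr => I _ do rewrite mevalM meval_kerpoly // -BE // /phi.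
have -> : 2%:R * cd * (rt v setT * linfac v setT * ((val f).@[v] * (vdm d).@[v])) =
  (cd * (2%:R * ((val f).@[v] * rt v setT) + \sum_(I | proper_block I)
    (val f).@[flip (~: I) v] * (rt (flip (~: I) v) I * rt (flip (~: I) v) (~: I)) *
      crossprod (hker m v) I (~: I)) - cd * \sum_(I | proper_block I)
    (val f).@[flip (~: I) v] * (rt (flip (~: I) v) I * rt (flip (~: I) v) (~: I)) *
      crossprod (hker m v) I (~: I)) * (linfac v setT * (vdm d).@[v]) by ring.
rewrite rE mulr_sumr -sumrB mulr_suml; apply: eq_bigr => I _.
by rewrite hker_sqv; ring.
Qed.

End RhoDecomposable.

(** * Words in the generators *)

Opaque hmul star.

Section Parity.
Variable m : nat.
Local Notation H := coha.
Local Notation "x ** y" := (hmul m x y) (at level 40, left associativity).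
Implicit Types (x y z v w : H).

Definition hpar (d : nat) : bool := odd (m.+1 * d).

Lemma odd_euler d : odd `|euler m d d|%N = hpar d.
Proof.
have E : odd `|1 - m%:Z|%N = odd m.+1.
  case: m => // k; have -> : 1 - k.+1%:Z = - k%:Z by lia.
  by rewrite abszN /= negbK.
by rewrite /euler abszM absz_nat oddM E oddM andbb /hpar oddM.
Qed.

Lemma ksignE d d' : ksign m d d' = (-1) ^+ (hpar d && hpar d').
Proof.
rewrite /ksign -signr_odd; congr (_ ^+ nat_of_bool _).
by rewrite /hpar !oddM; case: (odd m.+1); case: (odd d).
Qed.

Lemma par_hpar i v d : coha_par m i v -> v d != 0 -> hpar d = i.
Proof. by move=> vi /vi <-; rewrite odd_euler. Qed.

Lemma kap_par j w d : coha_par m j w -> kap m d w = (-1) ^+ (hpar d && j) *: w.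
Proof.
move=> wj; apply: dsumP => e; rewrite dscaleE -[RHS]/(_ *: w e) ksignE.
by have [->|/(par_hpar wj)->] := eqVneq (w e) 0; rewrite ?scaler0.
Qed.

Lemma par_supercomm i j v w : coha_par m i v -> coha_par m j w ->
  v ** w = (-1) ^+ (i && j) *: (w ** v).
Proof.
move=> vi wj; have [B [vB _]] := dsum_bound2 v w.
rewrite (dsum_decomp vB) hmul_suml hmul_sumr scaler_sumr; apply: eq_bigr => d _.
have [v0|vd] := eqVneq (v d) 0; first by rewrite v0 linear0 hmul0l hmul0r scaler0.
rewrite (hmul_kap m w (hdeg_dinj (v d))) (kap_par _ wj) hmulZl.
by rewrite (par_hpar vi vd).
Qed.

End Parity.

Section DerivationSign.
Variables (m d : nat).
Local Notation H := coha.
Local Notation "x ** y" := (hmul m x y) (at level 40, left associativity).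

(** This compatibility with supercommutation lets a right superderivation defined on words descend
    to H. In use [lv] and [lw] depend on one component of degree [d], so a nonzero value forces the
    parity of the letter. *)
Lemma right_deriv_super (i j : bool) (v w a x : H) (lv lw : rat) :
  coha_par m i v -> coha_par m j w -> (lv != 0 -> hpar m d = i) -> (lw != 0 -> hpar m d = j) ->
  v ** (w ** a + lw *: kap m d x) + lv *: kap m d (w ** x) =
  (-1) ^+ (i && j) *: (w ** (v ** a + lv *: kap m d x) + lw *: kap m d (v ** x)).
Proof.
move=> vi wj lvi lwj; set s := (-1) ^+ (i && j).
have e : v ** w = s *: (w ** v) by apply: par_supercomm.
have E1 : v ** (w ** a) = s *: (w ** (v ** a)) by rewrite hmulA e hmulZl -hmulA.
have E2 : lv *: kap m d (w ** x) = s *: (w ** (lv *: kap m d x)).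
  rewrite kapM (kap_par d wj) hmulZl hmulZr !scalerA; congr (_ *: _).
  by have [->|/lvi->] := eqVneq lv 0; rewrite ?mul0r ?mulr0 // mulrC.
have E3 : v ** (lw *: kap m d x) = s *: (lw *: kap m d (v ** x)).
  rewrite kapM (kap_par d vi) hmulZl hmulZr !scalerA; congr (_ *: _).
  have [->|/lwj->] := eqVneq lw 0; first by rewrite mulr0 mul0r.
  by rewrite [j && i]andbC mulrAC -/s -expr2 sqrr_sign mul1r.
by rewrite hmulDr E1 E2 E3 hmulDr -scalerDr -scalerDr addrAC.
Qed.

End DerivationSign.

Section Words.
Variables (m : nat) (Vprim : forall d, submodClosed (Hd d)).
Hypothesis hV : primitive_generators m Vprim.
Local Notation H := coha.
Local Notation "x ** y" := (hmul m x y) (at level 40, left associativity).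
Local Notation V := (subsp (Vgen Vprim)).
Local Notation par := (fun i => [set v : V | coha_par m i (val v)]%classic).

Definition wp (q : seq H) : H := foldr (hmul m) hone q.

Definition wpv (q : seq V) : H := foldr (fun v => hmul m (val v)) hone q.

Lemma wp_cons v q : wp (v :: q) = v ** wp q.
Proof. exact: erefl. Qed.

Lemma wpvE q : wpv q = wp [seq val v | v <- q].
Proof.
elim: q => [|v q IH]; first exact: erefl.
by rewrite -[LHS]/(val v ** wpv q) IH.
Qed.

Lemma wp_cat p q : wp (p ++ q) = wp p ** wp q.
Proof.
elim: p => [|x p IH]; first by rewrite hmul1l.
by rewrite -[LHS]/(x ** wp (p ++ q)) IH hmulA.
Qed.

Lemma wpv_cat p q : wpv (p ++ q) = wpv p ** wpv q.
Proof. by rewrite !wpvE map_cat wp_cat. Qed.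

Section Extension.
Variables (X : lmodType rat) (L : seq V -> X).
Hypothesis L_linear : forall p q a v w,
  L (p ++ (a *: v + w) :: q) = a *: L (p ++ v :: q) + L (p ++ w :: q).
Hypothesis L_super : forall p q i j v w, par i v -> par j w ->
  L (p ++ v :: w :: q) = (-1) ^+ (i && j) *: L (p ++ w :: v :: q).

Lemma sSym_rel_kill r : sSym_rel par r -> free_lift L r = 0.
Proof.
have lin := free_lift_linear L.
have liftB x y : free_lift L (x - y) = free_lift L x - free_lift L y.
  by rewrite addrC -scaleN1r lin scaleN1r addrC.
have liftZ a x : free_lift L (a *: x) = a *: free_lift L x.
  have lift0 : free_lift L 0 = 0.
    by have := lin (-1) 0 0; rewrite !scaleN1r !addNr.
  by rewrite -[a *: x]addr0 lin lift0 addr0.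
move=> [[p [q [a [v [w ->]]]]]|[p [q [i [j [v [w [vi wj ->]]]]]]]].
  by rewrite liftB lin !free_lift_fgen L_linear subrr.
by rewrite liftB liftZ !free_lift_fgen (L_super _ _ vi wj) subrr.
Qed.

Lemma sSym_lquot_lift (r : freemod (seq V)) :
  free_lift L (repr (\pi_(lquot (sSym_rel par)) r)) = free_lift L r.
Proof.
apply: (@lquot_lift _ _ (sSym_rel par) (free_lift L)); last exact: sSym_rel_kill.
exact: free_lift_linear.
Qed.

End Extension.

Lemma wpv_cons v q : wpv (v :: q) = val v ** wpv q.
Proof. exact: erefl. Qed.

Lemma wpv_linear p q a v w :
  wpv (p ++ (a *: v + w) :: q) = a *: wpv (p ++ v :: q) + wpv (p ++ w :: q).
Proof. by rewrite !wpv_cat !wpv_cons hmulDl hmulZl hmulDr hmulZr. Qed.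

Lemma wpv_super p q i j v w : par i v -> par j w ->
  wpv (p ++ v :: w :: q) = (-1) ^+ (i && j) *: wpv (p ++ w :: v :: q).
Proof.
move=> vi wj; rewrite !wpv_cat !wpv_cons (hmulA m (val v)) (par_supercomm vi wj).
by rewrite hmulZl hmulZr -hmulA.
Qed.

Local Notation lift := (sSym_lift (par := par) hone (@hmul m) val).

Lemma liftE r : lift (\pi_(lquot (sSym_rel par)) r) = free_lift wpv r.
Proof. exact: (sSym_lquot_lift wpv_linear wpv_super). Qed.

Lemma free_wpv_surj x : exists r, free_lift wpv r = x.
Proof.
have [g _ gK] := hV.2; exists (repr (g x)); rewrite -[RHS]gK; exact: erefl.
Qed.

(** The universal property of the free supercommutative algebra, carried over to H by the bijection
    in [hV]. *)
Lemma word_ext (X : lmodType rat) (L : seq V -> X) :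
  (forall p q a v w, L (p ++ (a *: v + w) :: q) = a *: L (p ++ v :: q) + L (p ++ w :: q)) ->
  (forall p q i j v w, par i v -> par j w ->
    L (p ++ v :: w :: q) = (-1) ^+ (i && j) *: L (p ++ w :: v :: q)) ->
  exists2 F : H -> X, linear F & forall q, F (wpv q) = L q.
Proof.
move=> Ll Ls; have [g gK Kg] := hV.2.
pose F x := free_lift L (repr (g x)).
have FE r : F (free_lift wpv r) = free_lift L r.
  by rewrite /F -liftE gK sSym_lquot_lift.
exists F => [a x y|q]; last by rewrite -(free_lift_fgen wpv) FE free_lift_fgen.
have [r <-] := free_wpv_surj x; have [t <-] := free_wpv_surj y.
by rewrite -free_lift_linear !FE free_lift_linear.
Qed.

Lemma word_span x : x \in lspan [set y | exists q : seq V, y = wpv q]%classic.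
Proof.
have [r <-] := free_wpv_surj x; have /asboolP rfin := dsum_fin r.
rewrite (@free_liftE _ _ wpv r _ rfin) //; apply: rpred_sum => q _.
by rewrite rpredZ //; apply: lspan_gen; exists q.
Qed.

Definition inV (q : seq H) : Prop := forall v, v \in q -> v \in Vgen Vprim.

Lemma inV_wpv q : inV q -> exists q' : seq V, wp q = wpv q' /\ size q' = size q.
Proof.
elim: q => [|v q IH] qV; first by exists [::].
have [|q' [qE sq]] := IH; first by move=> w wq; apply: qV; rewrite inE wq orbT.
have vV : v \in Vgen Vprim by apply: qV; rewrite inE eqxx.
by exists (insp vV :: q'); rewrite wp_cons wpv_cons -qE /= sq.
Qed.

(** The relations between words preserve their length, so H is graded by length. *)
Lemma length_proj : exists P : nat -> H -> H, (forall k, linear (P k)) /\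
  forall k q, inV q -> P k (wp q) = if size q == k then wp q else 0.
Proof.
have PE k : exists F : H -> H, linear F /\ forall q, F (wpv q) = if size q == k then wpv q else 0.
  have [||F Fl FE] := @word_ext H (fun q => if size q == k then wpv q else 0).
  - move=> p q a v w; rewrite !size_cat /=; case: ifP => _; first exact: wpv_linear.
    by rewrite scaler0 addr0.
  - move=> p q i j v w vi wj; rewrite !size_cat /=; case: ifP => _; first exact: wpv_super.
    by rewrite scaler0.
  by exists F.
have [P PP] := choice PE; exists P; split=> k; first exact: (PP k).1.
by move=> q /inV_wpv[q' [-> <-]]; rewrite (PP k).2.
Qed.

(** The recursion removes one letter in all possible ways, with the Koszul sign of the letters to
    its right; it respects the relations by [right_deriv_super]. *)
Lemma right_deriv d (lam : Hd d -> rat) : linear (lam : Hd d -> rat^o) ->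
  exists D : H -> H, [/\ linear D, D hone = 0 & forall v x, v \in Vgen Vprim ->
    D (v ** x) = v ** D x + lam (v d) *: kap m d x].
Proof.
move=> lam_lin.
have lam0 : lam 0 = 0 by have := lam_lin (-1) 0 0; rewrite !scaleN1r !addNr.
pose L := fix L (q : seq V) : H := if q is v :: q' then
  val v ** L q' + lam (val v d) *: kap m d (wpv q') else 0.
have [||F Fl FE] := @word_ext H L.
- move=> p q a v w; elim: p => [|u p IH] /=.
    rewrite hmulDl hmulZl lam_lin scalerDl -scalerA scalerDr addrACA.
    by congr (_ + _ + (_ + _)).
  by rewrite IH wpv_linear hmulDr hmulZr linearP scalerDr scalerDr !scalerA mulrC addrACA.
- move=> p q i j v w vi wj; elim: p => [|u p IH]; last first.
    rewrite !cat_cons [LHS]/= IH (wpv_super _ _ vi wj) hmulZr linearZ [RHS]/= scalerDr !scalerA.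
    by rewrite [lam _ * _]mulrC.
  apply: right_deriv_super => //; first by move=> v0; apply: (par_hpar vi); apply: contraNneq v0 => ->; rewrite lam0.
  by move=> w0; apply: (par_hpar wj); apply: contraNneq w0 => ->; rewrite lam0.
have F0 : F hone = 0 by rewrite -[hone]/(wpv [::]) FE.
have FZ a x : F (a *: x) = a *: F x.
  have F00 : F 0 = 0 by have := Fl (-1) 0 0; rewrite !scaleN1r !addNr.
  by rewrite -[a *: x]addr0 Fl F00 addr0.
exists F; split=> // v x vV; have := word_span x; move: x.
apply: lspan_ind => [|a x y [q ->] IH].
  have F00 : F 0 = 0 by have := Fl (-1) 0 0; rewrite !scaleN1r !addNr.
  by rewrite hmul0r F00 hmul0r linear0 scaler0 addr0.
have -> : v ** (a *: wpv q + y) = a *: (v ** wpv q) + v ** y by rewrite hmulDr hmulZr.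
have FE1 : F (v ** wpv q) = v ** F (wpv q) + lam (v d) *: kap m d (wpv q).
  by rewrite -[v ** wpv q]/(wpv (insp vV :: q)) !FE.
have -> : kap m d (a *: wpv q + y) = a *: kap m d (wpv q) + kap m d y by rewrite linearP.
rewrite !Fl IH FE1 hmulDr hmulZr !scalerDr !scalerA [lam _ * a]mulrC.
exact: addrACA.
Qed.

End Words.

(** * Degree formulas and the sign of the twist *)

Section Degrees.
Variables (m : nat) (s : int) (tau : 'I_m -> int).
Hypotheses (hs : s = 1 \/ s = -1) (htau : forall k : 'I_m, tau k = 1 \/ tau k = -1).

Lemma bin2_int (d : nat) : d%:Z * (d%:Z - 1) = 'C(d, 2)%:Z * 2.
Proof. by elim: d => // d IH; rewrite binS bin1; lia. Qed.

Lemma divz_bin2 (d : nat) : (d%:Z * (d%:Z - 1) %/ 2)%Z = 'C(d, 2)%:Z.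
Proof. by rewrite bin2_int mulzK. Qed.

Lemma divz_bin2D (d : nat) : (d%:Z * (d%:Z + 1) %/ 2)%Z = 'C(d, 2)%:Z + d%:Z.
Proof.
have -> : d%:Z * (d%:Z + 1) = ('C(d, 2)%:Z + d%:Z) * 2 by have := bin2_int d; lia.
by rewrite mulzK.
Qed.

Lemma tau_plus_minus : (tau_plus tau + tau_minus tau)%N = m.
Proof.
rewrite /tau_plus /tau_minus -[RHS]card_ord -[RHS](cardC [pred k | tau k == 1]).
congr (_ + _)%N; apply: eq_card => k; rewrite !inE.
by case: (htau k) => ->.
Qed.

Lemma sum_tau (F : int -> int) :
  \sum_(k < m) F (tau k) = (tau_plus tau)%:Z * F 1 + (tau_minus tau)%:Z * F (-1).
Proof.
rewrite (bigID [pred k | tau k == 1]) /=; congr (_ + _).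
  rewrite (eq_bigr (fun=> F 1)) => [|k /eqP->//].
  by rewrite sumr_const -mulr_natl natz.
rewrite (eq_bigl [pred k | tau k == -1]) => [|k]; last by case: (htau k) => /= ->.
rewrite (eq_bigr (fun=> F (-1))) => [|k /eqP->//].
by rewrite sumr_const -mulr_natl natz.
Qed.

Lemma EcalE (d : nat) : Ecal s tau d = (1 - m%:Z) * 'C(d, 2)%:Z +
  (if s == 1 then - (tau_plus tau)%:Z else 1 - (tau_minus tau)%:Z) * d%:Z.
Proof.
rewrite /Ecal (sum_tau (fun t => (d%:Z * (d%:Z + t * s) %/ 2)%Z)).
have tm : m%:Z = (tau_plus tau)%:Z + (tau_minus tau)%:Z by rewrite -PoszD tau_plus_minus.
case: hs => ->; rewrite ?mulr1 ?mul1r ?mulrN1 ?mulN1r ?opprK ?divz_bin2 ?divz_bin2D.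
  by rewrite eqxx tm; ring.
by rewrite /= tm; ring.
Qed.

Lemma star_exp_formula (b : bool) : admissible s b -> star_exp s tau b =
  (m%:Z - 1) * b%:Z - (if s == 1 then - (tau_plus tau)%:Z else 1 - (tau_minus tau)%:Z).
Proof.
rewrite /star_exp /admissible oddb; case: hs => ->; case: b => //= _; lia.
Qed.

(** The right-hand side is minus the degree of [rhoterm], in which [d] factors have exponent
    [star_exp] and ['C(d, 2)] factors have exponent [m - 1]. *)
Lemma euler_Ecal (b : bool) (d : nat) : admissible s b ->
  euler m b d + Ecal s tau d = - (star_exp s tau b * d%:Z + (m%:Z - 1) * 'C(d, 2)%:Z).
Proof.
move=> /star_exp_formula->; rewrite EcalE /euler PoszM; set t := (if _ then _ else _).
ring.
Qed.

(** The subtracted term is twice the polynomial degree of the kernel of the action; with the shifts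
    by [euler] and [Ecal] the action is therefore additive in degree. *)
Lemma Ecal_star (d e : nat) : admissible s e ->
  Ecal s tau (d.*2 + e) = euler m d d + Ecal s tau e - 2 *
    (star_exp s tau e * d%:Z + (m%:Z - 1) * ('C(d, 2)%:Z + 2 * (d * e./2)%N%:Z)).
Proof.
move=> ae; have -> : star_exp s tau e = star_exp s tau (odd e) by rewrite /star_exp oddb.
rewrite star_exp_formula; last by move: ae; rewrite /admissible oddb.
have [B1 B2] := (bin2_int d, bin2_int e); have B3 := bin2_int (d.*2 + e).
have eE : e%:Z = (odd e)%:Z + 2 * (e./2)%:Z by rewrite -{1}[e]odd_double_half PoszD -mul2n PoszM.
have dE : (d.*2 + e)%N%:Z = 2 * d%:Z + e%:Z by rewrite PoszD -mul2n PoszM.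
rewrite !EcalE /euler; set t := (if _ then _ else _).
have B4 : 'C(d.*2 + e, 2)%:Z = 'C(e, 2)%:Z + 2 * (d%:Z * d%:Z) + 2 * (d%:Z * e%:Z) - d%:Z.
  apply: (@mulIf _ 2) => //; rewrite -B3 dE !mulrDl -B2 mulNr; ring.
rewrite B4 dE !PoszM; apply/eqP; rewrite -subr_eq0; apply/eqP.
transitivity ((1 - m%:Z) * (d%:Z * d%:Z - d%:Z - 'C(d, 2)%:Z * 2) +
   2 * (1 - m%:Z) * d%:Z * (e%:Z - ((odd e)%:Z + 2 * (e./2)%:Z))); first by ring.
by rewrite -eE -B1; ring.
Qed.

(** The right-hand side is the factor by which [rhoterm] changes in [rhoterm_opp], when all signs
    are changed. *)
Lemma sign_formula (b : bool) (d : nat) : admissible s b ->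
  (-1) ^ (euler m b d + Ecal s tau d) =
  ((-1) ^ ((Nexp s tau b)%:Z - 1)) ^+ d * ((-1) ^ (m%:Z - 1)) ^+ 'C(d, 2) :> rat.
Proof.
move=> ab; rewrite euler_Ecal // -star_expE.
have E (z : int) (k : nat) : ((-1) ^ z) ^+ k = (-1) ^ (z * k%:Z) :> rat.
  by rewrite -[LHS]/(((-1) ^ z) ^ k%:Z) exprz_exp.
rewrite !E -expfzDr ?oppr_eq0 ?oner_eq0 // -invr_expz; set z := _ + _.
by case: z => k; rewrite /exprz ?invrK invr_sign.
Qed.

End Degrees.

Lemma meval_ext n (p q : {mpoly rat[n]}) : (forall v, p.@[v] = q.@[v]) -> p = q.
Proof. by move=> pq; apply: (meval_ext_generic (vdm_neq0 n)) => v _. Qed.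

Lemma homog_scale n k (p : {mpoly rat[k]}) (a : rat) v : p \is n.-homog ->
  p.@[fun i => a * v i] = a ^+ n * p.@[v].
Proof.
move=> /dhomogP ph; rewrite !mevalE mulr_sumr !big_seq; apply: eq_bigr => l /ph ln.
rewrite mulrCA; congr (_ * _); under eq_bigr do rewrite exprMn.
by rewrite big_split /= prodrXr -mdegE ln.
Qed.

Lemma nat_dsum_linear (V : nat -> lmodType rat) (F : forall d, V d -> V d) :
  (forall d, linear (F d)) -> forall x : dsum V,
  forall i, (\sum_(d \in [set: nat]%classic) dinj V d (F d (x d))) i = F i (x i).
Proof.
move=> Fl x i; have F0 d : F d 0 = 0 by have := Fl d (-1) 0 0; rewrite !scaleN1r !addNr.
have [B xB] := dsum_bound x; rewrite (@fsum_nat _ _ (maxn B i.+1)); last first.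
  by move=> d; rewrite geq_max => /andP[/xB-> _]; rewrite F0 linear0.
have iB : (i < maxn B i.+1)%N by rewrite leq_max ltnSn orbT.
rewrite dsum_sumE (bigD1 (Ordinal iB)) // dinjE big1 => [|d di]; first exact: addr0.
by rewrite dinj_neq // => e; case/negP: di; apply/eqP/val_inj.
Qed.

Section Twist.
Variables (m : nat) (s : int) (tau : 'I_m -> int).

Lemma meval_SH d (p : Hd d) v : (val (SH p)).@[v] = (val p).@[fun i => - v i].
Proof.
rewrite comp_mpoly_meval; apply: meval_eq => i.
by rewrite tnth_mktuple mevalN mevalXU.
Qed.

Lemma SH_is_linear d : linear (@SH d).
Proof.
move=> a p q; apply/val_inj/meval_ext => v.
rewrite meval_SH -[val (a *: p + q)]/(a *: val p + val q) mevalD mevalZ -!meval_SH.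
by rewrite -mevalZ -mevalD.
Qed.

Lemma twistE e f d : twist s tau e f d = (-1) ^ (euler m e d + Ecal s tau d) *: SH (f d).
Proof.
rewrite /twist (nat_dsum_linear
  (F := fun d x => (-1) ^ (euler m e d + Ecal s tau d) *: SH x)) // => i a x y.
by rewrite SH_is_linear scalerDr !scalerA mulrC.
Qed.

Lemma twist_is_linear e : linear (twist s tau e).
Proof.
move=> a x y; apply: dsumP => d; rewrite -[RHS]/(a *: twist s tau e x d + twist s tau e y d).
by rewrite !twistE SH_is_linear scalerDr !scalerA mulrC.
Qed.

Lemma twist_odd e f : twist s tau e f = twist s tau (odd e) f.
Proof.
apply: dsumP => d; rewrite !twistE; congr (_ *: _).
have -> : euler m e d + Ecal s tau d = euler m (odd e) d + Ecal s tau d +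
    2 * ((1 - m%:Z) * (e./2)%:Z * d%:Z).
  rewrite /euler -{1}[e]odd_double_half mulnDl PoszD !PoszM -mul2n PoszM; ring.
by rewrite expfzDr ?oppr_eq0 ?oner_eq0 // -exprz_exp exp1rz mulr1.
Qed.

Lemma twist_dinj e d (p : Hd d) : twist s tau e (dinj Hd d p) =
  dinj Hd d ((-1) ^ (euler m e d + Ecal s tau d) *: SH p).
Proof.
apply: dsumP => i; rewrite twistE; have [<-|di] := pselect (d = i); first by rewrite !dinjE.
rewrite !dinj_neq //; have := SH_is_linear (-1) (0 : Hd i) 0.
by rewrite !scaleN1r !addNr => ->; rewrite scaler0.
Qed.

Lemma SH_homog d (p : Hd d) n : val p \is n.-homog -> SH p = (-1) ^+ n *: p.
Proof.
move=> pn; apply/val_inj/meval_ext => v; rewrite meval_SH mevalZ -(homog_scale _ _ pn).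
by apply: meval_eq => i; rewrite mulN1r.
Qed.

Lemma signz_cases (z : int) : (-1) ^ z = 1 :> rat \/ (-1) ^ z = -1 :> rat.
Proof.
by case: z => k; rewrite /exprz ?invr_sign -signr_odd; case: odd; [right|left|right|left].
Qed.

Lemma twist_homog e d (p : Hd d) n : val p \is n.-homog ->
  twist s tau e (dinj Hd d p) = dinj Hd d p \/ twist s tau e (dinj Hd d p) = - dinj Hd d p.
Proof.
move=> pn; rewrite twist_dinj (SH_homog pn) scalerA -[(-1) ^+ n]/((-1) ^ n%:Z).
rewrite -expfzDr ?oppr_eq0 ?oner_eq0 //.
by case: (signz_cases (euler m e d + Ecal s tau d + n%:Z)) => ->;
  [left; rewrite scale1r|right; rewrite scaleN1r linearN].
Qed.

Section RhoTwist.
Variable b : bool.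
Hypotheses (hs : s = 1 \/ s = -1) (htau : forall k : 'I_m, tau k = 1 \/ tau k = -1).
Hypothesis ab : admissible s b.

Local Notation sg d := ((-1) ^ (euler m b d + Ecal s tau d) : rat).

Lemma twist_eigen d (p : Hd d) (a : rat) : twist s tau b (dinj Hd d p) = a *: dinj Hd d p ->
  forall v, (val p).@[fun i => - v i] = (a * sg d) * (val p).@[v].
Proof.
rewrite twist_dinj -linearZ => /dinj_inj /(congr1 val) /= e v.
have := congr1 (meval v) e; rewrite !mevalZ meval_SH mulrAC => <-.
by rewrite mulrAC; case: (signz_cases (euler m b d + Ecal s tau d)) => ->;
  rewrite ?mul1r ?mulrNN ?mul1r.
Qed.

Lemma sg_sq d : sg d * sg d = 1.
Proof.
by case: (signz_cases (euler m b d + Ecal s tau d)) => ->; rewrite ?mul1r ?mulrNN ?mul1r.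
Qed.

Lemma rho_antitwist d (p : Hd d) : twist s tau b (dinj Hd d p) = - dinj Hd d p ->
  rhob s tau b (dinj Hd d p) = 0.
Proof.
rewrite -scaleN1r => /twist_eigen pE.
have r0 : rho_comp m (Nexp s tau b) (cst s tau) p = 0.
  apply: (rho_comp_odd (cst_neq0 s tau) pE); rewrite -sign_formula // -mulrA sg_sq mulr1 //.
apply: dsumP => i; rewrite -[LHS]/(rho_comp m (Nexp s tau b) (cst s tau) (dinj Hd d p i)).
have [<-|di] := pselect (d = i); first by rewrite dinjE r0.
by rewrite dinj_neq // linear0 //; apply: cst_neq0.
Qed.

Lemma rho_twist_decomp d (p : Hd d) : (0 < d)%N ->
  twist s tau b (dinj Hd d p) = dinj Hd d p ->
  rhob s tau b (dinj Hd d p) \in lspan (decomp m) -> dinj Hd d p \in lspan (decomp m).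
Proof.
move=> d0; rewrite -{2}[dinj Hd d p]scale1r => /twist_eigen pE.
by apply: (rho_decomp d0 pE); rewrite -sign_formula // mul1r sg_sq.
Qed.

End RhoTwist.
End Twist.

Section Letters.
Variables (m : nat) (Vprim : forall d, submodClosed (Hd d)).
Hypothesis hV : primitive_generators m Vprim.
Local Notation H := coha.
Local Notation "x ** y" := (hmul m x y) (at level 40, left associativity).

Definition homV (v : H) : Prop := v \in Vgen Vprim /\ exists d n (p : Hd d),
  [/\ (0 < d)%N, v = dinj Hd d p & val p \is n.-homog].

Lemma sigma_homog d k : sigma d ^+ k \is k.-homog.
Proof.
have s1 : sigma d \is 1.-homog.
  by apply: rpred_sum => i _; rewrite dhomogX /= mdeg1.
by have := dhomogMn k s1; rewrite mul1n.
Qed.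

(** The spaces [Vprim d] are graded and the powers of [sigma d] are homogeneous. *)
Lemma Vgen_homV v : v \in Vgen Vprim -> v \in lspan homV.
Proof.
move: v; apply: lspan_ind => [|a x y [d [v [q [d0 vV ->]]]] yH]; first exact: rpred0.
apply: rpredD => //; apply: rpredZ.
have [/(_ v vV) grd _ _] := hV.1 d d0; move: v grd {vV}.
have lin q' : linear (fun v : Hd d => dinj Hd d (sigma_mul v q')).
  move=> b v w; rewrite -linearP; congr dinj; apply/val_inj => /=.
  by rewrite mulrDl scalerAl.
apply: lspan_ind => [|b v w [vV [D vD]] IH].
  have := lin q (-1) 0 0; rewrite !scaleN1r !addNr => ->; exact: rpred0.
rewrite lin rpredD // rpredZ //.
have [n vn] : exists n, val v \is n.-homog.
  by case: vD => [->|[n [vn _]]]; [exists 0%N; apply: rpred0|exists n].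
rewrite -[q]coefK poly_def.
have -> : sigma_mul v (\sum_(i < size q) q`_i *: 'X^i) = \sum_(i < size q) q`_i *: sigma_mul v 'X^i.
  apply/val_inj; rewrite raddf_sum /= linear_sum mulr_sumr; apply: eq_bigr => i _ /=.
  by rewrite linearZ /= mulr_algl -scalerAr.
rewrite linear_sum; apply: rpred_sum => i _; rewrite linearZ rpredZ //.
apply: lspan_gen; split; first by apply: lspan_gen; exists d, v, 'X^i.
exists d, (n + i)%N, (sigma_mul v 'X^i); split=> //=.
by rewrite rmorphXn /= horner_algX; apply: dhomogM => //; apply: sigma_homog.
Qed.

Lemma homV_deg0 v : homV v -> v 0%N = 0.
Proof. by move=> [_ [d [n [p [d0 -> _]]]]]; rewrite dinj_neq // => e; rewrite e in d0. Qed.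

Lemma Vgen_deg0 v : v \in Vgen Vprim -> v 0%N = 0.
Proof.
move=> /Vgen_homV; move: v; apply: lspan_ind => // a x y /homV_deg0 x0 y0.
by rewrite -[LHS]/(a *: x 0%N + y 0%N) x0 y0 scaler0 addr0.
Qed.

Lemma Vgen_comp d v : v \in Vgen Vprim -> dinj Hd d (v d) \in Vgen Vprim.
Proof.
move: v; apply: lspan_ind => [|a x y [i [v [q [i0 vV ->]]]] yV].
  by rewrite linear0 rpred0.
rewrite -[(_ + y) d]/(a *: dinj Hd i (sigma_mul v q) d + y d) linearP rpredD ?rpredZ //.
have [<-|id] := pselect (i = d); last by rewrite dinj_neq // linear0 rpred0.
by rewrite dinjE; apply: lspan_gen; exists i, v, q.
Qed.

Lemma lspan_hmul (A B C : set H) x y : (forall a b, A a -> B b -> a ** b \in lspan C) ->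
  x \in lspan A -> y \in lspan B -> x ** y \in lspan C.
Proof.
move=> AB xA yB; move: x xA; apply: lspan_ind => [|a x x' Ax IH]; first by rewrite hmul0l rpred0.
rewrite hmulDl hmulZl; apply: rpredD; [apply: rpredZ|exact: IH]; move: y yB {IH}.
apply: lspan_ind => [|b y y' By IH]; first by rewrite hmul0r rpred0.
by rewrite hmulDr hmulZr; apply: rpredD; [apply: rpredZ; apply: AB|exact: IH].
Qed.

Definition words (S : H -> Prop) : set H :=
  [set x | exists q, (forall v, v \in q -> S v) /\ x = wp m q]%classic.

Lemma words_cons (S : H -> Prop) v q : S v -> (forall w, w \in q -> S w) ->
  forall w, w \in v :: q -> S w.
Proof. by move=> Sv Sq w; rewrite inE => /orP[/eqP->|/Sq]. Qed.

Lemma word_span_homV x : x \in lspan (words homV).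
Proof.
have := word_span hV x; apply: lspan_sub => {x} _ [q ->].
elim: q => [|v q IH]; first by apply: lspan_gen; exists [::].
apply: (lspan_hmul _ (Vgen_homV (valP v)) IH) => a _ aV [q' [qV ->]].
by apply: lspan_gen; exists (a :: q'); split=> //; apply: words_cons.
Qed.

End Letters.

(** * Superderivations *)

Lemma linear_bundle (U W : lmodType rat) (f : U -> W) : linear f ->
  exists g : {linear U -> W}, forall x, g x = f x.
Proof.
move=> fl; pose mx := GRing.isLinear.Build rat U W *:%R f fl.
by exists (HB.pack f mx : {linear U -> W}).
Qed.

Lemma kap_hdeg m d e x : hdeg e x -> kap m d x = ksign m d e *: x.
Proof. exact: dscale_hdeg. Qed.

Section Low.
Variable m : nat.
Local Notation H := coha.
Local Notation "x ** y" := (hmul m x y) (at level 40, left associativity).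

Definition low (V : nat -> lmodType rat) c (x : dsum V) : Prop :=
  forall i, (i < c)%N -> x i = 0.

Lemma low0 (V : nat -> lmodType rat) c : low c (0 : dsum V).
Proof. by []. Qed.

Lemma lowP (V : nat -> lmodType rat) c a (x y : dsum V) : low c x -> low c y -> low c (a *: x + y).
Proof. by move=> xc yc i ic; rewrite -[LHS]/(a *: x i + y i) xc // yc // scaler0 addr0. Qed.

Lemma low_le (V : nat -> lmodType rat) c c' (x : dsum V) : (c' <= c)%N -> low c x -> low c' x.
Proof. by move=> cc xc i ic; apply: xc; apply: leq_trans cc. Qed.

Lemma low_kap c d (x : H) : low c x -> low c (kap m d x).
Proof. by move=> xc i /xc xi; rewrite dscaleE xi scaler0. Qed.

Lemma hdeg_low (V : nat -> lmodType rat) d (x : dsum V) : hdeg d x -> low d x.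
Proof. by move=> xd i id; apply: xd => e; rewrite e ltnn in id. Qed.

Lemma low_hmul c e (x y : H) : low c x -> low e y -> low (c + e) (x ** y).
Proof.
move=> xc ye n nce; rewrite -[RHS]/((0 : H) n); apply: comp_ext => v vI.
rewrite ev0 ev_hmul //; apply: big1 => J JT.
have [Jc|Jc] := ltnP #|J| c; first by rewrite {1}/ev (xc _ Jc) /pev /= meval0 !mul0r.
have Je : (#|setT :\: J| < e)%N.
  have := cardsID J setT; have /setIidPr -> := JT.
  rewrite cardsT card_ord; lia.
by rewrite [ev v y _]/ev (ye _ Je) /pev /= meval0 mulr0 mul0r.
Qed.

End Low.

Section Derivations.
Variables (m : nat) (Vprim : forall d, submodClosed (Hd d)).
Hypothesis hV : primitive_generators m Vprim.
Local Notation H := coha.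
Local Notation "x ** y" := (hmul m x y) (at level 40, left associativity).
Local Notation inVg v := (v \in Vgen Vprim).

(** The sign is counted against the factors to the right; in [lderiv] it is counted against those to
    the left. Both occur because [rhob] reverses products: [rderiv] acts on its target, [lderiv] on
    its source. *)
Definition rderiv d (lam : Hd d -> rat) (D : {linear H -> H}) : Prop :=
  D hone = 0 /\ forall v x, inVg v -> D (v ** x) = v ** D x + lam (v d) *: kap m d x.

Definition lderiv d (lam : Hd d -> rat) (D : {linear H -> H}) : Prop :=
  D hone = 0 /\ forall v x, inVg v -> D (v ** x) = lam (v d) *: x + kap m d v ** D x.

Lemma rderiv_ex d (lam : Hd d -> rat) : linear (lam : Hd d -> rat^o) -> exists D, rderiv lam D.
Proof.
move=> /(right_deriv hV)[F [Fl F1 FM]]; have [D DE] := linear_bundle Fl.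
by exists D; split=> [|v x vV]; rewrite !DE // FM.
Qed.

(** A right superderivation composed with [kap m d] becomes a left one; the factor [ksign m d d]
    undoes the sign that [kap] puts on the removed letter. *)
Lemma lderiv_ex d (lam : Hd d -> rat) : linear (lam : Hd d -> rat^o) -> exists D, lderiv lam D.
Proof.
move=> lam_lin; have [D [D1 DM]] := rderiv_ex lam_lin.
have lamZ a p : lam (a *: p) = a * lam p.
  have lam0 : lam 0 = 0 by have := lam_lin (-1) 0 0; rewrite !scaleN1r !addNr.
  by rewrite -[a *: p]addr0 lam_lin lam0 addr0.
have [E EE] : exists E : {linear H -> H}, forall x, E x = ksign m d d *: D (kap m d x).
  by apply: linear_bundle => a x y; rewrite !linearP.
exists E; split=> [|v x vV]; first by rewrite EE kap1 D1 scaler0.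
have kV : inVg (kap m d v).
  have [B vB] := dsum_bound v; rewrite (dsum_decomp vB) linear_sum; apply: rpred_sum => i _.
  by rewrite /= (kap_hdeg _ _ (hdeg_dinj _)) rpredZ // Vgen_comp.
rewrite !EE kapM DM // kapK dscaleE lamZ scalerDr hmulZr addrC; congr (_ + _).
by rewrite scalerA mulrA ksignK mul1r.
Qed.

Lemma wp_inVg_span x : x \in lspan (words m (fun v => inVg v)).
Proof.
have := word_span_homV hV x; apply: lspan_sub => {x} _ [q [qV ->]].
by apply: lspan_gen; exists q; split=> // v /qV[].
Qed.

Lemma rderivM d (lam : Hd d -> rat) D x y : rderiv lam D ->
  D (x ** y) = x ** D y + D x ** kap m d y.
Proof.
move=> [D1 DM]; have := wp_inVg_span x; move: x; apply: lspan_ind => [|a x x' [q [qV ->]] IH].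
  by rewrite hmul0l !linear0 !hmul0l addr0.
rewrite hmulDl hmulZl !linearP /= IH !hmulDl !hmulZl addrACA; congr (_ + _).
rewrite -scalerDr; congr (_ *: _); elim: q qV => [|v q IHq] qV.
  by rewrite D1 !hmul1l hmul0l addr0.
have vV : inVg v by apply: qV; rewrite inE eqxx.
have {}IHq := IHq (fun w wq => qV w (mem_behead (s := v :: q) wq)).
rewrite wp_cons -(hmulA m v (wp m q) y) (DM v _ vV) IHq (DM v _ vV) kapM.
rewrite (hmulDl m (v ** _)) hmulZl (hmulDr m v) (hmulA m v (wp m q)) (hmulA m v (D _)).
exact/esym/addrA.
Qed.

Section LengthProjection.
Variable P : nat -> {linear H -> H}.
Hypothesis PE : forall k q, inV Vprim q -> P k (wp m q) = if size q == k then wp m q else 0.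

Lemma inV_homV q : (forall v, v \in q -> homV Vprim v) -> inV Vprim q.
Proof. by move=> qV v /qV[]. Qed.

Lemma hdeg_wp q : (forall v, v \in q -> exists d, (0 < d)%N /\ hdeg d v) ->
  exists d, hdeg d (wp m q) /\ (q != [::] -> 0 < d)%N.
Proof.
elim: q => [|v q IH] qV; first by exists 0%N; split=> //; apply: hdeg_dinj.
have [|d [qd _]] := IH; first by move=> w wq; apply: qV; rewrite inE wq orbT.
have [e [e0 ve]] := qV v (mem_head _ _).
by exists (e + d)%N; split=> [|_]; [apply: hdeg_hmul|rewrite addn_gt0 e0].
Qed.

Lemma homV_hdeg v : homV Vprim v -> exists d, (0 < d)%N /\ hdeg d v.
Proof. by move=> [_ [d [n [p [d0 -> _]]]]]; exists d; split=> //; apply: hdeg_dinj. Qed.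

Lemma length_comp k d (x : H) : P k (dinj Hd d (x d)) = dinj Hd d (P k x d).
Proof.
rewrite -!dscale_delta.
have := word_span_homV hV x; move: x; apply: lspan_ind => [|a x y [q [qV ->]] IH].
  by rewrite !linear0.
rewrite !linearP IH /=; congr (_ *: _ + _).
have [e [qe _]] := hdeg_wp (fun v vq => homV_hdeg (qV v vq)).
have Pe : hdeg e (P k (wp m q)) by rewrite PE; [case: ifP|exact: inV_homV].
by rewrite (dscale_hdeg _ qe) (dscale_hdeg _ Pe) linearZ.
Qed.

Lemma length_hdeg k d x : hdeg d x -> hdeg d (P k x).
Proof. by move=> xd; rewrite {1}(hdegE xd) length_comp; apply: hdeg_dinj. Qed.

(** On a word of length at least two every term of the derivation keeps a letter, and letters have
    no component of degree 0; so the constant term of [D x] comes from the part of length one. *)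
Lemma rderiv_length1 d (lam : Hd d -> rat) D x : linear (lam : Hd d -> rat^o) ->
  rderiv lam D -> low 1 (D x - lam (P 1%N x d) *: hone).
Proof.
move=> lam_lin [D1 DM].
have lam0 : lam 0 = 0 by have := lam_lin (-1) 0 0; rewrite !scaleN1r !addNr.
have := wp_inVg_span x; move: x; apply: lspan_ind => [|a x y [q [qV ->]] IH].
  by rewrite !linear0 lam0 scale0r subrr; apply: low0.
have -> : D (a *: wp m q + y) - lam (P 1%N (a *: wp m q + y) d) *: hone =
    a *: (D (wp m q) - lam (P 1%N (wp m q) d) *: hone) + (D y - lam (P 1%N y d) *: hone).
  have -> : lam (P 1%N (a *: wp m q + y) d) = a * lam (P 1%N (wp m q) d) + lam (P 1%N y d).
    by rewrite linearP; apply: lam_lin.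
  by rewrite linearP scalerBr scalerA [in LHS]scalerDl opprD addrACA.
apply: lowP => // {IH}; rewrite PE //; case: q qV => [|v [|w q]] qV.
- by rewrite /= D1 lam0 scale0r subrr; apply: low0.
- have vV : inVg v by apply: qV; rewrite mem_head.
  rewrite /= DM // D1 hmul0r add0r kap1 hmul1r subrr; apply: low0.
have vV : inVg v by apply: qV; rewrite mem_head.
have wV : inVg w by apply: qV; rewrite !inE eqxx orbT.
rewrite -[(0 : H) d]/(0 : Hd d) lam0 scale0r subr0 !wp_cons (DM v _ vV) addrC.
have l1 u z : inVg u -> low 1 (u ** z).
  move=> uV; rewrite -[1%N]addn0; apply: low_hmul => // -[|//] _.
  exact: (Vgen_deg0 hV).
by apply: lowP; [apply: low_kap|]; apply: l1.
Qed.

End LengthProjection.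
End Derivations.

(** * The length filtration *)

Section Filtration.
Variables (m : nat) (s : int) (tau : 'I_m -> int) (Vprim : forall d, submodClosed (Hd d)).
Hypothesis hV : primitive_generators m Vprim.
Hypotheses (hs : s = 1 \/ s = -1) (htau : forall k : 'I_m, tau k = 1 \/ tau k = -1).
Variable b : bool.
Hypothesis ab : admissible s b.
Local Notation H := coha.
Local Notation "x ** y" := (hmul m x y) (at level 40, left associativity).
Local Notation inVg v := (v \in Vgen Vprim).
Local Notation rh := (rhob s tau b).

(* The twist-invariant homogeneous generators; on the others rh vanishes. *)
Definition letter (v : H) : Prop :=
  [/\ inVg v, (exists d, (0 < d)%N /\ hdeg d v) & twist s tau b v = v].

Lemma letter_inVg v : letter v -> inVg v. Proof. by case. Qed.

Lemma rhM x y : rh (x ** y) = rh y ** rh x.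
Proof. exact: rho_hmul. Qed.

Lemma rh1 : rh hone = hone.
Proof. exact: rho1. Qed.

Lemma rh_kap d x : rh (kap m d x) = kap m d (rh x).
Proof. exact: rho_kap. Qed.

Lemma rh_hdeg d x : hdeg d x -> hdeg d (rh x).
Proof. exact: hdeg_rho. Qed.

Lemma rh_comp d (x : H) : rh (dinj Hd d (x d)) = dinj Hd d (rh x d).
Proof. by rewrite -!dscale_delta; apply: rho_dscale. Qed.

Definition wordsn k : set H := [set x | exists q,
  [/\ forall v, v \in q -> letter v, size q = k & x = wp m q]]%classic.

(* The elements that are negligible when one compares the components of length k
   in H(e) and of degree c in W. *)
Definition Zset k c : set H := [set z | exists x q, [/\ forall v, v \in q -> letter v,
  (k < size q)%N \/ (k <= size q)%N /\ low c.+1 x & z = x ** rh (wp m q)]]%classic.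

Lemma letter_hdeg q : (forall v, v \in q -> letter v) -> exists d, hdeg d (wp m q) /\ (q != [::] -> 0 < d)%N.
Proof. by move=> qp; apply: hdeg_wp => v /qp[]. Qed.

Lemma wordsn_kap d k x : x \in lspan (wordsn k) -> kap m d x \in lspan (wordsn k).
Proof.
apply: lspan_image => {}x [q [qp qk ->]]; have [e [qe _]] := letter_hdeg qp.
by rewrite /= (kap_hdeg _ _ qe) rpredZ //; apply: lspan_gen; exists q.
Qed.

Lemma Z_mull k c x z : z \in lspan (Zset k c) -> x ** z \in lspan (Zset k c).
Proof.
apply: (lspan_image (f := hmul m x)) => {}z [y [q [qp qk ->]]] /=.
rewrite hmulA; apply: lspan_gen; exists (x ** y), q; split=> //.
case: qk => [?|[? yc]]; [by left|right; split=> //].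
by rewrite -[c.+1]add0n; apply: low_hmul.
Qed.

Lemma Z_mull_low k c x z : low c x -> z \in lspan (Zset k 0) -> x ** z \in lspan (Zset k c).
Proof.
move=> xc; apply: (lspan_image (f := hmul m x)) => {}z [y [q [qp qk ->]]] /=.
rewrite hmulA; apply: lspan_gen; exists (x ** y), q; split=> //.
case: qk => [?|[? yc]]; [by left|right; split=> //].
by rewrite -addn1; apply: low_hmul.
Qed.

Lemma Z_mono k k' c c' z : (k' <= k)%N -> (k' < k)%N || (c' <= c)%N ->
  z \in lspan (Zset k c) -> z \in lspan (Zset k' c').
Proof.
move=> kk cc; apply: lspan_sub => _ [x [q [qp qk ->]]]; apply: lspan_gen; exists x, q; split=> //.
case: qk => [lt|[le xc]]; first by left; apply: leq_ltn_trans lt.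
case/orP: cc => [lt|lt]; first by left; apply: leq_trans le.
by right; split; [apply: leq_trans le|apply: low_le xc].
Qed.

Variable P : nat -> {linear H -> H}.
Hypothesis PE : forall k q, inV Vprim q -> P k (wp m q) = if size q == k then wp m q else 0.

(* lam of the indecomposable part P 1 (rh x) of rh x. *)
Definition lamH d (lam : Hd d -> rat) (p : Hd d) : rat := lam (P 1%N (rh (dinj Hd d p)) d).

Lemma lamH_linear d (lam : Hd d -> rat) : linear (lam : Hd d -> rat^o) ->
  linear (lamH lam : Hd d -> rat^o).
Proof. by move=> ll a x y; rewrite /lamH !linearP /=; apply: ll. Qed.

Lemma lamHE d (lam : Hd d -> rat) (x : H) : lamH lam (x d) = lam (P 1%N (rh x) d).
Proof. by rewrite /lamH rh_comp (length_comp hV PE) dinjE. Qed.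

Section OneDerivation.
Variables (d : nat) (lam : Hd d -> rat) (D E : {linear H -> H}).
Hypotheses (lam_lin : linear (lam : Hd d -> rat^o)) (DP : rderiv m Vprim lam D)
  (EP : lderiv m Vprim (lamH lam) E).

Lemma E_wordsn k x : x \in lspan (wordsn k.+1) -> E x \in lspan (wordsn k).
Proof.
apply: lspan_image => {}x [q [qp qk ->]]; elim: k q qp qk => [|k IH] [|v q] // qp [qk].
  have vV := letter_inVg (qp v (mem_head _ _)).
  case: q qp qk => // qp _; rewrite wp_cons EP.2 // EP.1 hmul0r addr0 rpredZ //.
  by apply: lspan_gen; exists [::].
have vp := qp v (mem_head _ _).
have {}qp w : w \in q -> letter w by move=> wq; apply: qp; rewrite inE wq orbT.
rewrite wp_cons EP.2; last exact: letter_inVg.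
apply: rpredD; first by rewrite rpredZ //; apply: lspan_gen; exists q.
have [_ [e [_ ve]] _] := vp; rewrite (kap_hdeg _ _ ve) hmulZl rpredZ //.
have := IH q qp qk; apply: (lspan_image (f := hmul m v)) => _ [q' [qp' qk' ->]].
apply: lspan_gen; exists (v :: q'); split=> //=; last by rewrite qk'.
exact: words_cons.
Qed.

(** Induction on the word. Its first letter [v] becomes the last factor [rh v], on which [D] yields
    the constant by which [E] is defined on [v], plus a remainder [y] of positive degree; next to
    the remaining letters this remainder is negligible. *)
Lemma deriv_defect k q : (forall v, v \in q -> letter v) -> size q = k.+1 ->
  D (rh (wp m q)) - rh (E (wp m q)) \in lspan (Zset k 0).
Proof.
elim: k q => [|k IH] [|v q] // qp [qk]; have [vV [e [e0 ve]] _] := qp v (mem_head _ _);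
  have vp := qp v (mem_head _ _);
  have {}qp w : w \in q -> letter w by move=> wq; apply: qp; rewrite inE wq orbT.
  case: q qp qk => // _ _; have -> : E (wp m [:: v]) = lamH lam (v d) *: hone.
    by rewrite wp_cons EP.2 // EP.1 hmul0r addr0.
  have -> : wp m [:: v] = v by apply: hmul1r.
  rewrite linearZ /= rh1 lamHE.
  have := rderiv_length1 hV PE (rh v) lam_lin DP; set y := _ - _ => yl.
  apply: lspan_gen; exists y, [::]; split=> //; first by right.
  by rewrite rh1 hmul1r.
have [dq [qd _]] := letter_hdeg qp.
rewrite wp_cons rhM (rderivM hV _ _ DP) EP.2 // linearD linearZ /= rhM rh_kap lamHE.
set y := D (rh v) - lam (P 1%N (rh v) d) *: hone.
have yl := rderiv_length1 hV PE (rh v) lam_lin DP; rewrite -/y in yl.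
have -> : rh (wp m q) ** D (rh v) + D (rh (wp m q)) ** kap m d (rh v) -
    (lam (P 1%N (rh v) d) *: rh (wp m q) + rh (E (wp m q)) ** kap m d (rh v)) =
    rh (wp m q) ** y + (D (rh (wp m q)) - rh (E (wp m q))) ** kap m d (rh v).
  rewrite /y !(linearB, hmulDl) /= hmulZr hmul1r opprD addrACA -!/(_ - _).
  congr (_ + (_ + _)); rewrite -scaleN1r hmulZl scaleN1r //.
apply: rpredD.
  (* The remainder is moved to the left, where [Zset] expects the coefficient. *)
  rewrite (hmul_kap m y (rh_hdeg qd)); apply: lspan_gen.
  exists (kap m dq y), q; split=> //; right; split; first by rewrite qk.
  exact: low_kap.
rewrite (kap_hdeg _ _ (rh_hdeg ve)) hmulZr rpredZ //.
have := IH q qp qk; set z := D _ - _; clearbody z.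
apply: (lspan_image (f := hmulr m (rh v))) => _ [x [q' [qp' qk' ->]]].
apply: lspan_gen; exists x, (v :: q'); split; first exact: words_cons.
  by case: qk' => [?|[? ?]]; [left|right].
by rewrite wp_cons rhM hmulA.
Qed.

(** [D] costs at most one letter, and only when it falls on the word; then the degree bound on the
    coefficient is kept. When it falls on the coefficient all letters survive. *)
Lemma D_Z k c z : z \in lspan (Zset k.+1 c) -> D z \in lspan (Zset k c).
Proof.
apply: lspan_image => _ [x [q [qp qk ->]]]; rewrite (rderivM hV _ _ DP).
have sq : (k < size q)%N by case: qk => [/ltnW|[]].
have [dq [qd _]] := letter_hdeg qp.
apply: rpredD; last first.
  rewrite (kap_hdeg _ _ (rh_hdeg qd)) hmulZr rpredZ //.
  by apply: lspan_gen; exists (D x), q; split=> //; left.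
have [k' k'E] : exists k', size q = k'.+1 by case: (size q) sq => // k'; exists k'.
have def := deriv_defect qp k'E.
rewrite -[D (rh _)](subrK (rh (E (wp m q)))) linearD; apply: rpredD.
  case: qk => [lt|[le xc]].
    by rewrite k'E ltnS in lt; apply: Z_mull; apply: Z_mono def; rewrite ?lt //; apply: ltnW.
  apply: (Z_mull_low (low_le (leqnSn c) xc)); apply: Z_mono def => //; last by rewrite leqnn orbT.
  by rewrite k'E in le.
have : E (wp m q) \in lspan (wordsn k') by apply: E_wordsn; apply: lspan_gen; exists q.
move: (E _); apply: lspan_ind => [|a y y' [q' [qp' qk' ->]] IH].
  by rewrite linear0 ?hmul0r ?linear0 rpred0.
rewrite linearP linearP; apply: rpredD; [apply: rpredZ|exact: IH].
apply: lspan_gen; exists x, q'; split=> //.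
rewrite qk'; case: qk => [lt|[le xc]]; first by left; rewrite k'E in lt.
by right; split=> //; rewrite k'E in le.
Qed.

(** Where [D] falls on [w] all [k + 1] letters survive, which is negligible at length [k]; on [rh r]
    the error is that of [deriv_defect]. *)
Lemma D_leading k c r w : r \in lspan (wordsn k.+1) -> low c w ->
  D (w ** rh r) - w ** rh (E r) \in lspan (Zset k c).
Proof.
move=> rk wc; rewrite (rderivM hV _ _ DP) addrAC -(linearB (hmul m w)); apply: rpredD; last first.
  rewrite -rh_kap; have := wordsn_kap d rk; move: (kap m d r); apply: lspan_ind.
    by rewrite linear0 ?hmul0r ?linear0 rpred0.
  move=> a x y [q [qp qk ->]] IH; rewrite !linearP; apply: rpredD; [apply: rpredZ|exact: IH].
  by apply: lspan_gen; exists (D w), q; split=> //; left; rewrite qk.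
move: r rk; apply: lspan_ind => [|a x y [q [qp qk ->]] IH].
  by rewrite !linear0 ?subrr ?oppr0 ?addr0 ?linear0 ?hmul0r rpred0.
have -> : D (rh (a *: wp m q + y)) - rh (E (a *: wp m q + y)) =
    a *: (D (rh (wp m q)) - rh (E (wp m q))) + (D (rh y) - rh (E y)).
  rewrite (linearP E) (linearP rh) (linearP D) (linearP rh) scalerBr opprD.
  exact: addrACA.
rewrite linearP; apply: rpredD; [apply: rpredZ|exact: IH].
by apply: (Z_mull_low wc); apply: deriv_defect.
Qed.

End OneDerivation.
End Filtration.

(** Gram-Schmidt without a metric: the part of each new vector that the projection does not yet
    reproduce is adjoined, with a functional separating it. The degrees in [K] and [F] are carried
    along because the functionals to be used each factor through one component. *)
Lemma dual_family (X : lmodType rat) (K : nat -> X -> Prop) (F : nat -> (X -> rat) -> Prop) :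
  (forall d a x y, K d x -> K d y -> K d (a *: x + y)) ->
  (forall d a f g, F d f -> F d g -> F d (fun x => a * f x + g x)) ->
  (forall d f, F d f -> linear (f : X -> rat^o)) ->
  (forall d d' f x, F d f -> K d' x -> d <> d' -> f x = 0) ->
  (forall d x, K d x -> x <> 0 -> exists2 f, F d f & f x = 1) ->
  forall S : seq X, (forall x, x \in S -> exists d, K d x) ->
  exists n (u : nat -> X) (f : nat -> X -> rat),
    (forall i, (i < n)%N -> exists2 d, K d (u i) & F d (f i)) /\
    forall x, x \in S -> \sum_(i < n) f i x *: u i = x.
Proof.
move=> Klin Flin Fl Fdeg sep S SK.
(* The second clause makes the projection idempotent, which the induction needs in order to adjoin a
   vector. *)
suff [n [u [f [uf _ fS]]]] : exists n (u : nat -> X) (f : nat -> X -> rat),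
    [/\ forall i, (i < n)%N -> exists2 d, K d (u i) & F d (f i),
        forall i x, (i < n)%N -> f i (\sum_(j < n) f j x *: u j) = f i x &
        forall x, x \in S -> \sum_(i < n) f i x *: u i = x].
  by exists n, u, f.
elim: S SK => [|v S IH] SK; first by exists 0%N, (fun=> 0), (fun _ _ => 0).
have [|n [u [f [uf ff fS]]]] := IH; first by move=> x xS; apply: SK; rewrite inE xS orbT.
have [d vd] := SK v (mem_head _ _).
pose p x := \sum_(i < n) f i x *: u i.
have fl i : (i < n)%N -> linear (f i : X -> rat^o) by move=> /uf[d' _ /Fl].
have f0 i : (i < n)%N -> f i 0 = 0.
  by move=> /fl l; have := l (-1) 0 0; rewrite !scaleN1r !addNr.
have pl : linear p.
  move=> a x y; rewrite /p scaler_sumr -big_split; apply: eq_bigr => i _ /=.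
  by rewrite fl // scalerDl scalerA.
have pp x : p (p x) = p x by apply: eq_bigr => i _; rewrite ff.
have K0 e x : K e x -> K e 0 by move=> xe; rewrite -[0](addNr x) -scaleN1r; apply: Klin.
have pK e x : K e x -> K e (p x).
  move=> xe; rewrite /p; elim/big_ind: _ => [|y z ye ze|[i i_n] _ /=]; first exact: K0 xe.
    by rewrite -[y]scale1r; apply: Klin.
  have [e' ue' fe'] := uf i i_n; have [<-|ne] := pselect (e' = e).
    by rewrite -[_ *: _]addr0; apply: Klin ue' (K0 _ _ ue').
  by rewrite (Fdeg _ _ _ _ fe' xe ne) scale0r; apply: K0 xe.
have [v0|v0] := pselect (v - p v = 0).
  exists n, u, f; split=> // x; rewrite inE => /orP[/eqP->|/fS//].
  by rewrite -/(p v) -[RHS](subrK (p v)) v0 add0r.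
have v'd : K d (v - p v) by rewrite addrC -scaleN1r; apply: Klin => //; apply: pK.
have [g gd gv] := sep d _ v'd v0.
(* [h] is [g] corrected to vanish on the image of [p]. It keeps degree [d], because [g] vanishes on
   the [u i] of other degrees. *)
have gl := Fl _ _ gd; pose h x := g x - g (p x).
have g0 : g 0 = 0 by have := gl (-1) 0 0; rewrite !scaleN1r !addNr.
have gB x y : g (x - y) = g x - g y.
  by rewrite addrC -scaleN1r; have /= -> := gl (-1) y x; rewrite scaleN1r addrC.
have hd : F d h.
  have hE x : h x = g x - \sum_(i < n) g (u i) * f i x.
    rewrite /h; congr (_ - _); rewrite /p.
    have gD x1 x2 : g (x1 + x2) = g x1 + g x2.
      by have /= := gl 1 x1 x2; rewrite !scale1r.
    rewrite (big_morph g gD g0); apply: eq_bigr => i _.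
    by rewrite -[f i x *: u i]addr0 (gl _ _ _) g0 addr0 mulrC.
  have -> : h = fun x => g x - \sum_(i < n) g (u i) * f i x by apply: funext.
  elim: (n) uf {ff fS p pl pp pK v0 v'd gv h hE fl f0} => [|k IHk] uf.
    suff -> : (fun x => g x - \sum_(i < 0) g (u i) * f i x) = g by [].
    by apply: funext => x; rewrite big_ord0 subr0.
  have {}IHk := IHk (fun i ik => uf i (ltnW ik)).
  have -> : (fun x => g x - \sum_(i < k.+1) g (u i) * f i x) =
      (fun x => - g (u k) * f k x + (g x - \sum_(i < k) g (u i) * f i x)).
    by apply: funext => x; rewrite big_ord_recr /= mulNr; ring.
  have [e ue fe] := uf k (ltnSn k); have [ed|ne] := pselect (e = d).
    by rewrite ed in fe; apply: (Flin _ _ _ _ fe IHk).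
  rewrite (Fdeg _ _ _ _ gd ue (fun E => ne (esym E))).
  by under eq_fun do rewrite oppr0 mul0r add0r.
exists n.+1, (fun i => if i == n then v - p v else u i), (fun i => if i == n then h else f i).
have sE x : \sum_(i < n.+1) (if i == n :> nat then h else f i) x *:
    (if i == n :> nat then v - p v else u i) = p x + h x *: (v - p v).
  rewrite big_ord_recr /= eqxx; congr (_ + _); apply: eq_bigr => i _.
  by rewrite ltn_eqF.
have pv' : p (v - p v) = 0.
  by have := pl (-1) (p v) v; rewrite !scaleN1r pp addNr addrC.
have fv' i : (i < n)%N -> f i (v - p v) = 0.
  move=> i_n; rewrite -(ff _ _ i_n) -/(p _) pv'; exact: f0.
have hv' : h v = 1 by rewrite /h -gB.
have pE x : p (p x + h x *: (v - p v)) = p x by rewrite addrC pl pp pv' scaler0 add0r.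
split=> [i|i x|x].
- rewrite ltnS leq_eqVlt; case: eqP => [_ _|_ /= i_n]; first by exists d.
  by rewrite ?ltn_eqF //; apply: uf.
- rewrite sE ltnS leq_eqVlt; case: (altP eqP) => [_ _|_ /= i_n].
    rewrite [LHS]/h pE -gB [p x + _]addrC addrK -[_ *: _]addr0 (gl _ _ _) g0 gv addr0.
    exact: mulr1.
  by rewrite addrC (fl i i_n) fv' // scaler0 add0r -/(p x) /p ff.
rewrite inE sE => /orP[/eqP->|xS]; first by rewrite hv' scale1r addrC subrK.
by rewrite /h /p fS // subrr scale0r addr0.
Qed.

(** * Linear independence of words under the action *)

Section Injectivity.
Variables (m : nat) (s : int) (tau : 'I_m -> int) (Vprim : forall d, submodClosed (Hd d)).
Hypothesis hV : primitive_generators m Vprim.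
Hypotheses (hs : s = 1 \/ s = -1) (htau : forall k : 'I_m, tau k = 1 \/ tau k = -1).
Variable b : bool.
Hypothesis ab : admissible s b.
Local Notation H := coha.
Local Notation "x ** y" := (hmul m x y) (at level 40, left associativity).
Local Notation inVg v := (v \in Vgen Vprim).
Local Notation rh := (rhob s tau b).
Local Notation letter := (letter s tau Vprim b).
Local Notation wordsn := (wordsn s tau Vprim b).

Variable P : nat -> {linear H -> H}.
Hypothesis PE : forall k q, inV Vprim q -> P k (wp m q) = if size q == k then wp m q else 0.
Local Notation lamH := (lamH s tau b P).

Definition words1 : set H := [set x | exists v q, [/\ homV Vprim v,
  forall w, w \in q -> homV Vprim w & x = wp m (v :: q)]]%classic.

Lemma words1_span d x : (0 < d)%N -> hdeg d x -> x \in lspan words1.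
Proof.
move=> d0 xd; rewrite (hdegE xd) -dscale_delta; have := word_span_homV hV x.
apply: (lspan_image (f := dscale _)) => _ [[|v q] [qV ->]].
  rewrite -[X in X \in _]/(dscale (fun i => (i == d)%:R) hone) dscale_delta.
  by rewrite /hone dinj_neq ?linear0 ?rpred0 // => e; rewrite -e in d0.
have [e [qe _]] := hdeg_wp m (fun w wq => homV_hdeg (qV w wq)).
rewrite -[X in X \in _]/(dscale (fun i => (i == d)%:R) (wp m (v :: q))) (dscale_hdeg _ qe).
apply: rpredZ; apply: lspan_gen; exists v, q; split=> //.
  by apply: qV; rewrite mem_head.
by move=> w wq; apply: qV; rewrite inE wq orbT.
Qed.

Lemma length1_decomp x : x \in lspan (decomp m) -> P 1%N x = 0.
Proof.
move: x; apply: lspan_ind => [|a x y [i [j [z [t [i0 j0 zi tj ->]]]]] IH]; first exact: linear0.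
rewrite linearP IH addr0.
suff -> : P 1%N (z ** t) = 0 by rewrite scaler0.
have := words1_span j0 tj; have := words1_span i0 zi; move: z {zi}.
apply: lspan_ind => [|a' z z' [v [q [vV qV ->]]] IHz] tw; first by rewrite hmul0l linear0.
rewrite (hmulDl m) (hmulZl m) linearP (IHz tw) addr0.
suff -> : P 1%N (wp m (v :: q) ** t) = 0 by rewrite scaler0.
move: t tw {tj IH IHz}; apply: lspan_ind => [|b' t t' [v' [q' [vV' qV' ->]]] IH]; first by rewrite hmul0r linear0.
rewrite hmulDr hmulZr linearP IH addr0 -wp_cat PE; last first.
  apply: inV_homV => w; rewrite mem_cat => /orP[]; rewrite inE => /orP[/eqP->//|]; by [apply: qV|apply: qV'].
by rewrite size_cat /= addnS scaler0.
Qed.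

(** With [length1_decomp]: in positive degree the decomposable elements form the kernel of the
    projection to length one. *)
Lemma length1_kernel d x : (0 < d)%N -> hdeg d x -> P 1%N x = 0 -> x \in lspan (decomp m).
Proof.
move=> d0 xd x0; rewrite -[x]subr0 -x0; have := words1_span d0 xd; move: {d d0 xd x0} x.
apply: lspan_ind => [|a x y [v [q [vV qV ->]]] IH]; first by rewrite linear0 subr0 rpred0.
rewrite linearP opprD addrACA -scalerBr; apply: rpredD; [apply: rpredZ|exact: IH].
have vqV : inV Vprim (v :: q) by apply: inV_homV; apply: words_cons.
rewrite PE //; case: q qV {vqV} => [|w q] qV; first by rewrite subrr rpred0.
rewrite subr0 wp_cons; apply: lspan_gen.
have [i [i0 vi]] := homV_hdeg vV.
have [j [qj j0]] := hdeg_wp m (fun w wq => homV_hdeg (qV w wq)).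
by exists i, j, v, (wp m (w :: q)); split=> //; apply: j0.
Qed.

Lemma length1_id v : inVg v -> P 1%N v = v.
Proof.
move=> vV; have := @PE 1 [:: v]; rewrite /= hmul1r; apply.
by move=> w; rewrite inE => /eqP->.
Qed.

(** If [rh v] has no part of length one it is decomposable, hence so is [v]; but [v] is its own part
    of length one. *)
Lemma letter_inj d v : letter v -> hdeg d v -> P 1%N (rh v) = 0 -> v = 0.
Proof.
move=> [vV _ vt] vd r0; have [d0|d0] := leqP d 0.
  move: d0 vd; rewrite leqn0 => /eqP-> vd.
  by rewrite (hdegE vd) (Vgen_deg0 hV vV) linear0.
rewrite -(length1_id vV); apply: length1_decomp; rewrite (hdegE vd).
apply: (rho_twist_decomp hs htau ab d0); first by rewrite -(hdegE vd).
by rewrite -(hdegE vd); apply: (length1_kernel d0) r0; apply: rh_hdeg.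
Qed.

Lemma letters_dual (S : seq H) : (forall v, v \in S -> letter v) ->
  exists n (u : nat -> H) (d : nat -> nat) (lam : forall i, Hd (d i) -> rat),
    (forall i, (i < n)%N -> [/\ letter (u i), hdeg (d i) (u i) & linear (lam i : Hd (d i) -> rat^o)]) /\
    forall v, v \in S -> \sum_(i < n) lamH (lam i) (v (d i)) *: u i = v.
Proof.
(* [v = 0] is allowed in every degree to make each [K d] a subspace; nonzero vectors have positive
   degree. *)
move=> Sp; pose K d v := inVg v /\ hdeg d v /\ twist s tau b v = v /\ (v = 0 \/ (0 < d)%N).
pose F d (f : H -> rat) := exists2 lam : Hd d -> rat, linear (lam : Hd d -> rat^o) &
  forall x : H, f x = lamH lam (x d).
have lam0 d (lam : Hd d -> rat) : linear (lam : Hd d -> rat^o) -> lam 0 = 0.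
  by move=> l; have := l (-1) 0 0; rewrite !scaleN1r !addNr.
have [|||||v vS|n [u [f [uf fS]]]] := @dual_family H K F _ _ _ _ _ S.
- move=> d a x y [xV [xd [xt x0]]] [yV [yd [yt y0]]]; split; [|split; [|split]].
  + by rewrite rpredD // rpredZ.
  + move=> i id; rewrite -[LHS]/(a *: x i + y i) xd // yd // scaler0 addr0 //.
  + by rewrite (twist_is_linear s tau b) xt yt.
  case: x0 => [->|]; last by right.
  case: y0 => [->|]; last by right.
  by left; rewrite scaler0 addr0.
- move=> d a f g [l ll lE] [l' ll' lE']; exists (fun p => a * l p + l' p).
    move=> c p q; rewrite ll ll'.
    change (a * (c * l p + l q) + (c * l' p + l' q) = c * (a * l p + l' p) + (a * l q + l' q)).
    ring.
  by move=> x; rewrite lE lE'.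
- move=> d f [l ll lE] a x y; rewrite !lE; exact: lamH_linear.
- move=> d d' f x [l ll lE] [_ [xd _]] dd; rewrite lE xd; first exact: (lam0 _ _ (lamH_linear s tau b P ll)).
  by move=> e; apply: dd.
- move=> d v [vV [vd [vt v0]]] vn; case: v0 => // d0.
  have vp : letter v by split=> //; exists d.
  have y0 : P 1%N (rh v) d <> 0.
    move=> y0; apply: vn; apply: (letter_inj vp vd).
    by rewrite (hdegE (length_hdeg hV PE 1 (rh_hdeg s tau b vd))) y0 linear0.
  (* The separating functional is a coefficient that is nonzero on [P 1 (rh v)], normalised by its
     value there. *)
  have [mm cmm] : exists mm, (val (P 1%N (rh v) d))@_mm != 0.
    apply: contrapT => ne; apply: y0; apply/val_inj/mpolyP => mm; rewrite mcoeff0.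
    by apply/eqP; apply: contrapT => /negP cm; apply: ne; exists mm.
  exists (fun x : H => lamH (fun p : Hd d => (val p)@_mm / (val (P 1%N (rh v) d))@_mm) (x d)).
    exists (fun p : Hd d => (val p)@_mm / (val (P 1%N (rh v) d))@_mm) => //.
    move=> a p q; rewrite mcoeffD mcoeffZ mulrDl -mulrA; done.
  by rewrite (lamHE s tau hV b PE) ?divff.
- have [vV [d [d0 vd]] vt] := Sp v vS; exists d; split=> //; split=> //; split=> //; by right.
have ex i : exists dl : {d : nat & Hd d -> rat}, (i < n)%N ->
    [/\ K (tag dl) (u i), linear (tagged dl : Hd (tag dl) -> rat^o) &
        forall x : H, f i x = lamH (tagged dl) (x (tag dl))].
  have [i_n|_] := ltnP i n; last by exists (Tagged (fun d => Hd d -> rat) (fun _ : Hd 0 => 0)).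
  have [d Kd [l ll lE]] := uf i i_n; exists (Tagged (fun d => Hd d -> rat) l); split=> //.
have [G GP] := choice ex.
(* Zero vectors are discarded, as their recorded degree may be 0 and letters are to have positive
   degree. *)
pose I := [seq i <- iota 0 n | `[< u i <> 0 >]].
have In i : i \in I -> (i < n)%N /\ u i <> 0.
  by rewrite mem_filter mem_iota => /andP[/asboolP un /= ->].
exists (size I), (fun j => u (nth 0%N I j)), (fun j => tag (G (nth 0%N I j))), (fun j => tagged (G (nth 0%N I j))).
split=> [j jI|v vS].
  have [i_n un] := In _ (mem_nth 0%N jI).
  have [[uV [ud [ut u0]]] ll lE] := GP _ i_n; split=> //; split=> //.
  by exists (tag (G (nth 0%N I j))); split=> //; case: u0.
rewrite -[RHS](fS v vS) -(big_mkord xpredT (fun i => f i v *: u i)).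
rewrite (bigID (fun i => `[< u i <> 0 >])) /= [X in _ + X]big1 ?addr0; last first.
  by move=> i /asboolPn /contrapT ->; rewrite scaler0.
rewrite -[RHS]big_filter /index_iota subn0 -/I (big_nth 0%N) big_mkord.
apply: eq_bigr => j _; have [i_n un] := In _ (mem_nth 0%N (ltn_ord j)).
by have [_ _ ->] := GP _ i_n.
Qed.

(* Euler's identity: sum_i u_i E_i multiplies words of length k by k, for dual
   families of letters u_i and derivations E_i. *)
Lemma lderiv_separate k r : r \in lspan (wordsn k.+1) ->
  (forall d (lam : Hd d -> rat) E, linear (lam : Hd d -> rat^o) -> lderiv m Vprim (lamH lam) E -> E r = 0) ->
  r = 0.
Proof.
move=> /asboolP[n [c [x [xw rE]]]] Er0.
have [q qP] := choice xw.
have Sp v : v \in flatten [seq q i | i <- enum 'I_n] -> letter v.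
  by move=> /flatten_mapP[i _ vi]; have [qp _ _] := qP i; apply: qp.
have [n' [u [d [lam [uP uS]]]]] := letters_dual Sp.
have [E EP] : exists E : nat -> {linear H -> H}, forall i, (i < n')%N -> lderiv m Vprim (lamH (lam i)) (E i).
  have ex i : exists E, (i < n')%N -> lderiv m Vprim (lamH (lam i)) E.
    have [/uP[_ _ ll]|_] := ltnP i n'; last by exists (P 0).
    by have [E EP] := lderiv_ex hV (lamH_linear s tau b P ll); exists E.
  by have [E EE] := choice ex; exists E.
have eul q' : (forall v, v \in q' -> v \in flatten [seq q i | i <- enum 'I_n]) ->
    \sum_(i < n') u i ** E i (wp m q') = (size q')%:R *: wp m q'.
  elim: q' => [|v q' IH] qS.
    rewrite scale0r big1 // => i _; have [E1 _] := EP i (ltn_ord i).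
    by rewrite -[wp m [::]]/(hone) E1 hmul0r.
  have vS := qS v (mem_head _ _); have [vV _ _] := Sp v vS.
  have {}IH := IH (fun w wq => qS w (mem_behead (s := v :: q') wq)).
  have -> : \sum_(i < n') u i ** E i (wp m (v :: q')) =
      \sum_(i < n') (lamH (lam i) (v (d i)) *: u i) ** wp m q' + \sum_(i < n') v ** (u i ** E i (wp m q')).
    rewrite -big_split; apply: eq_bigr => i _; rewrite [RHS]/=.
    have [_ ud _] := uP i (ltn_ord i); have [_ EM] := EP i (ltn_ord i).
    rewrite wp_cons EM // hmulDr hmulZr hmulZl (hmulA m (u i)) (hmul_kap m (kap m (d i) v) ud) kapK.
    by rewrite (hmulA m v).
  rewrite -hmul_suml -hmul_sumr uS // IH hmulZr -wp_cons -[X in X + _]scale1r -scalerDl.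
  by rewrite -natr1 addrC.
have r0 : \sum_(i < n') u i ** E i r = k.+1%:R *: r.
  have -> : \sum_(i < n') u i ** E i r = \sum_j c j *: \sum_(i < n') u i ** E i (x j).
    under [RHS]eq_bigr do rewrite scaler_sumr.
    rewrite exchange_big; apply: eq_bigr => i _; rewrite rE linear_sum hmul_sumr.
    by apply: eq_bigr => j _; rewrite linearZ hmulZr.
  rewrite rE scaler_sumr; apply: eq_bigr => j _; have [_ qk ->] := qP j.
  rewrite eul => [|v vj]; first by rewrite qk !scalerA mulrC.
  by apply/flatten_mapP; exists j; rewrite // mem_enum.
apply/eqP; have := esym r0; rewrite big1 => [/eqP|i _].
  by rewrite scaler_eq0 pnatr_eq0.
have [_ _ ll] := uP i (ltn_ord i); rewrite (Er0 _ _ _ ll (EP i (ltn_ord i))); exact: hmul0r.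
Qed.

(** Under [unsq] the decomposable part of M corresponds to the span of these elements. *)
Definition rhoideal : set H := [set x | exists y f : H, f 0%N = 0 /\ x = y ** rh f]%classic.

(* A superderivation D of H shortens rh r by a letter, since D (rh r) = rh (E r)
   up to negligible terms. *)
Lemma action_inj k c n (w r : 'I_n -> H) :
  (forall a z, z \in lspan rhoideal ->
     \sum_i a i *: w i = dinj Hd c (z c) -> forall i, a i = 0) ->
  (forall i, hdeg c (w i)) -> (forall i, r i \in lspan (wordsn k)) ->
  \sum_i w i ** rh (r i) \in lspan (Zset s tau Vprim b k c) -> forall i, r i = 0.
Proof.
move=> wI wc; elim: k r => [|k IH] r rk wr.
  (* A word of length 0 is the unit, so the [r i] are scalars and the independence of the [w i]
     modulo the decomposable part applies. *)
  have ex i : exists a, r i = a *: hone.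
    have := rk i; move: (r i); apply: lspan_ind => [|a x y [q [_ /size0nil-> ->]] [a' ->]].
      by exists 0; rewrite scale0r.
    by exists (a + a'); rewrite scalerDl.
  have [a aE] := choice ex.
  have wE : \sum_i a i *: w i = dinj Hd c ((\sum_i w i ** rh (r i)) c).
    have -> : \sum_i w i ** rh (r i) = \sum_i a i *: w i.
      by apply: eq_bigr => i _; rewrite aE linearZ /= rh1 hmulZr hmul1r.
    apply: hdegE => j jc; rewrite dsum_sumE big1 // => i _.
    by rewrite -[LHS]/(a i *: w i j) wc // scaler0.
  suff [z zI zc] : exists2 z, z \in lspan rhoideal &
      (\sum_i w i ** rh (r i)) c = z c.
    by move=> i; rewrite aE (wI a z zI) ?scale0r // wE zc.
  (* Of the negligible terms, those with a nonempty word lie in the span of [rhoideal], and those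
     with a coefficient of degree above [c] have no component of degree [c]. *)
  move: (\sum_i _) wr {wE}; apply: lspan_ind => [|a' x y [x' [q [qp qk ->]]] [z zI zc]].
    by exists 0; rewrite ?rpred0.
  case: qk => [q0|[_ xc]]; last first.
    exists z => //; rewrite -[LHS]/(a' *: (x' ** rh (wp m q)) c + y c) zc.
    have l0 : low 0 (rh (wp m q)) by [].
    by have /(_ c) := low_hmul m xc l0; rewrite addn0 => ->; rewrite // scaler0 add0r.
  exists (a' *: (x' ** rh (wp m q)) + z).
    apply: rpredD => //; apply: rpredZ; apply: lspan_gen; exists x', (wp m q); split=> //.
    have [d [qd d0]] := letter_hdeg qp.
    by apply: qd => e; move: d0; rewrite -e; case: (q) q0 => [//|v' q'] _ /(_ isT).
  by rewrite -[LHS]/(_ *: _ + y c) zc.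
(* It suffices that every derivation [E] kills [r i]; applying [D] to the relation gives a relation
   between the [E (r j)], one letter shorter. *)
move=> i; apply: (lderiv_separate (rk i)) => d lam E ll EP.
have [D DP] := rderiv_ex hV ll.
apply: (IH (fun j => E (r j))) => [j|]; first exact: (E_wordsn EP (rk j)).
have Dz := D_Z hV PE ll DP EP wr.
have -> : \sum_j w j ** rh (E (r j)) = D (\sum_j w j ** rh (r j)) -
    \sum_j (D (w j ** rh (r j)) - w j ** rh (E (r j))).
  rewrite linear_sum -sumrB; apply: eq_bigr => j _ /=; rewrite opprB addrC subrK //.
apply: rpredB => //; apply: rpred_sum => j _.
exact: (D_leading hV PE ll DP EP (rk j) (hdeg_low (wc j))).
Qed.

End Injectivity.

Section MixedLengths.
Variables (m : nat) (s : int) (tau : 'I_m -> int) (Vprim : forall d, submodClosed (Hd d)).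
Hypothesis hV : primitive_generators m Vprim.
Hypotheses (hs : s = 1 \/ s = -1) (htau : forall k : 'I_m, tau k = 1 \/ tau k = -1).
Variable b : bool.
Hypothesis ab : admissible s b.
Local Notation H := coha.
Local Notation "x ** y" := (hmul m x y) (at level 40, left associativity).
Local Notation rh := (rhob s tau b).
Local Notation letter := (letter s tau Vprim b).
Local Notation wordsn := (wordsn s tau Vprim b).

(** The letters depend on [e] only through its parity; together with [words_letter_He] this makes
    H(e) the span of the words in them. *)
Lemma He_words e f : odd e = b -> f \in He s tau Vprim e -> f \in lspan (words m letter).
Proof.
move=> eb /asboolP; elim=> {f} [f [fV ft]| |f g _ fW _ gW|a f g _ fW _ gW].
- have [B fB] := dsum_bound f; rewrite (dsum_decomp fB); apply: rpred_sum => d _.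
  have [d0|d0] := posnP d; first by rewrite d0 (Vgen_deg0 hV fV) linear0 rpred0.
  apply: lspan_gen; exists [:: dinj Hd d (f d)]; split; last exact/esym/hmul1r.
  move=> v; rewrite inE => /eqP->; split; first exact: Vgen_comp.
    by exists d; split=> //; apply: hdeg_dinj.
  by rewrite twist_dinj -twistE -eb -twist_odd ft.
- by apply: lspan_gen; exists [::].
- apply: (lspan_hmul _ fW gW) => _ _ [p [pP ->]] [q [qP ->]].
  apply: lspan_gen; exists (p ++ q); split; last by rewrite wp_cat.
  by move=> v; rewrite mem_cat => /orP[/pP|/qP].
by apply: rpredD => //; apply: rpredZ.
Qed.

Lemma words_letter_He e q : odd e = b -> (forall v, v \in q -> letter v) -> wp m q \in He s tau Vprim e.
Proof.
move=> eb; elim: q => [|v q IH] qP; first by apply/asboolP; apply: subalg1.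
have [vV _ vt] := qP v (mem_head _ _).
have /asboolP qH := IH (fun w wq => qP w (mem_behead (s := v :: q) wq)).
apply/asboolP; rewrite wp_cons; apply: subalgM => //; apply: subalg_gen.
by split=> //; rewrite twist_odd eb.
Qed.

Variable P : nat -> {linear H -> H}.
Hypothesis PE : forall k q, inV Vprim q -> P k (wp m q) = if size q == k then wp m q else 0.

Lemma letter_inV q : (forall v, v \in q -> letter v) -> inV Vprim q.
Proof. by move=> qp v /qp[]. Qed.

Lemma length_wordsn k f : f \in lspan (words m letter) -> P k f \in lspan (wordsn k).
Proof.
apply: lspan_image => _ [q [qp ->]]; rewrite PE; last exact: letter_inV.
by case: eqP => [qk|_]; [apply: lspan_gen; exists q|apply: rpred0].
Qed.

Lemma length_tail k f : f \in lspan (words m letter) -> (forall j, (j < k)%N -> P j f = 0) ->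
  f - P k f \in lspan [set x | exists2 q, forall v, v \in q -> letter v & (k < size q)%N /\ x = wp m q]%classic.
Proof.
move=> fW f0; have -> : f - P k f = f - \sum_(j < k.+1) P j f.
  by rewrite big_ord_recr big1 /= ?add0r // => j _; apply: f0.
move: f fW {f0}; apply: lspan_ind => [|a x y [q [qp ->]] IH].
  by rewrite big1 ?subr0 ?rpred0 // => j _; apply: linear0.
have -> : \sum_(j < k.+1) P j (a *: wp m q + y) = a *: \sum_(j < k.+1) P j (wp m q) + \sum_(j < k.+1) P j y.
  rewrite scaler_sumr -big_split; apply: eq_bigr => j _; exact: linearP.
rewrite opprD addrACA -scalerBr; apply: rpredD; [apply: rpredZ|exact: IH].
have PEq j := PE j (letter_inV qp).
have [kq|qk] := ltnP k (size q).
  rewrite big1 ?subr0 => [|j _]; first by apply: lspan_gen; exists q.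
  by rewrite PEq gtn_eqF // (leq_trans _ kq) // ltn_ord.
rewrite (bigD1 (Ordinal (qk : (size q < k.+1)%N))) // big1 => [|j jq].
  by rewrite PEq [_ == _]eqxx [X in _ - X]addr0 subrr rpred0.
by rewrite PEq; case: eqP => // e; case/eqP: jq; apply/val_inj.
Qed.

Lemma length_zero f : f \in lspan (words m letter) -> (forall k, P k f = 0) -> f = 0.
Proof.
move=> fW f0; suff [K fE] : exists K, f = \sum_(k < K) P k f by rewrite fE big1.
suff [K fE] : exists K, forall K', (K <= K')%N -> f = \sum_(k < K') P k f by exists K; apply: fE.
move: f fW {f0}; apply: lspan_ind => [|a x y [q [qp ->]] [K yK]].
  by exists 0%N => K' _; rewrite big1 // => k _; apply: linear0.
exists (maxn K (size q).+1) => K'; rewrite geq_max => /andP[KK' qK'].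
have -> : \sum_(j < K') P j (a *: wp m q + y) = a *: \sum_(j < K') P j (wp m q) + \sum_(j < K') P j y.
  rewrite scaler_sumr -big_split; apply: eq_bigr => j _; exact: linearP.
rewrite -yK //; congr (_ *: _ + _).
rewrite (bigD1 (Ordinal qK')) // big1 => [|j jq]; first by rewrite (PE _ (letter_inV qp)) [_ == _]eqxx; exact/esym/addr0.
by rewrite PE; [case: eqP => // e; case/eqP: jq; apply/val_inj|apply: letter_inV].
Qed.

(** Induction on the length [k], then on the degree [c]. At [(k, c)] longer words are negligible and
    shorter ones vanish already; words of length [k] next to a [w] of another degree vanish if that
    degree is smaller and are negligible if it is larger. *)
Lemma rho_action_inj B (n : nat -> nat) (w f : forall c, 'I_(n c) -> H) :
  (forall c i, hdeg c (w c i)) ->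
  (forall c a z, z \in lspan (rhoideal s tau b) ->
     \sum_(i < n c) a i *: w c i = dinj Hd c (z c) -> forall i, a i = 0) ->
  (forall c i, f c i \in lspan (words m letter)) ->
  \sum_(c < B) \sum_(i < n c) w c i ** rh (f c i) = 0 ->
  forall c i, (c < B)%N -> f c i = 0.
Proof.
move=> wc wI fW wf0 c i cB; apply: (length_zero (fW c i)) => k.
move: k c i cB; elim/ltn_ind=> k IHk; elim/ltn_ind=> c IHc i cB.
have H0 := @action_inj _ _ _ _ hV hs htau b ab P PE k c (n c) (w c) (fun i => P k (f c i)).
apply: (H0 (wI c) (wc c) (fun i => length_wordsn k (fW c i))) => {H0 i}.
have tail x c' i : (c' < B)%N -> x ** rh (f c' i - P k (f c' i)) \in lspan (Zset s tau Vprim b k c).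
  move=> c'B; have := length_tail (fW c' i) (fun j jk => IHk j jk c' i c'B); move: (f c' i - _).
  apply: lspan_ind => [|a y z [q qp [kq ->]] IH]; first by rewrite linear0 hmul0r rpred0.
  rewrite linearP hmulDr hmulZr; apply: rpredD; [apply: rpredZ|exact: IH].
  by apply: lspan_gen; exists x, q; split=> //; left.
have {}wf0 : \sum_(i < n c) w c i ** rh (f c i) +
    \sum_(c' < B | c' != Ordinal cB) \sum_(i < n c') w c' i ** rh (f c' i) = 0.
  by move: wf0; rewrite (bigD1 (Ordinal cB)).
rewrite -[\sum_i _]subr0 -[X in _ - X]wf0 opprD addrA -sumrB.
apply: rpredB.
  apply: rpred_sum => i _; rewrite -opprB -linearB -linearB; rewrite rpredN; exact: tail.
apply: rpred_sum => c' c'c; apply: rpred_sum => i _.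
rewrite -[f c' i](subrK (P k (f c' i))) linearD hmulDr.
apply: rpredD; first exact: tail.
have [lt|] := ltnP c' c; first by rewrite IHc // linear0 hmul0r rpred0.
rewrite leq_eqVlt => /orP[/eqP e|lt]; first by case/eqP: c'c; apply/val_inj.
have := length_wordsn k (fW c' i); move: (P k _).
apply: lspan_ind => [|a y z [q [qp qk ->]] IH]; first by rewrite linear0 hmul0r rpred0.
rewrite linearP hmulDr hmulZr; apply: rpredD; [apply: rpredZ|exact: IH].
apply: lspan_gen; exists (w c' i), q; split=> //; right; split; first by rewrite qk.
exact: low_le (hdeg_low (wc _ _)).
Qed.

End MixedLengths.

(** * Homogeneity and spanning *)

Lemma pev_scale n (p : {mpoly rat[n]}) k a t : p \is k.-homog ->
  pev p [seq a * x | x <- t] = a ^+ k * pev p t.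
Proof.
move=> pk; rewrite /pev -homog_scale //; apply: meval_eq => i.
have [it|it] := ltnP i (size t); first by rewrite (nth_map 0).
by rewrite !nth_default ?size_map // mulr0.
Qed.

Lemma pts_scale n (v : 'I_n -> rat) a J : pts (fun i => a * v i) J = [seq a * x | x <- pts v J].
Proof. by rewrite /pts -map_comp. Qed.

Lemma flip_scale n (v : 'I_n -> rat) a E : flip E (fun i => a * v i) = fun i => a * flip E v i.
Proof. by apply: funext => i; rewrite /flip; case: ifP => _; rewrite ?mulrN. Qed.

Lemma pairprod_const n (c : rat) (J : {set 'I_n}) : pairprod (fun _ _ => c) J = c ^+ 'C(#|J|, 2).
Proof.
have [phi phiI <-] := enum_map (erefl #|J|); rewrite (pairprod_imset (h := fun _ _ => c)) // card_imset // cardsT card_ord.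
rewrite /pairprod (eq_bigl (fun x : 'I__ * 'I__ => (x.1 < x.2)%N)) => [|x]; last by rewrite !in_setT.
rewrite -(pair_big_dep xpredT (fun i j : 'I__ => i < j)%N (fun _ _ => c)) /=.
rewrite (exchange_big_dep xpredT) //= -bin2_sum big_mkord -prodrXr.
apply: eq_bigr => j _; rewrite prodr_const; congr (_ ^+ _).
rewrite -sum1_card (eq_bigl (fun i : 'I__ => (i < j)%N)) // (big_ord_narrow (ltnW (ltn_ord j))).
by rewrite sum1_card card_ord.
Qed.

Section Scaling.
Variables (m : nat) (s : int) (tau : 'I_m -> int) (a : rat).
Hypothesis a0 : a != 0.

Lemma rhoterm_scale N n (w : 'I_n -> rat) (J : {set 'I_n}) :
  rhoterm m N (fun i => a * w i) J =
  a ^ ((N%:Z - 1) * #|J|%:Z + (m%:Z - 1) * 'C(#|J|, 2)%:Z) * rhoterm m N w J.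
Proof.
rewrite /rhoterm expfzDr // -!exprz_exp -!exprnP mulrACA; congr (_ * _).
  by rewrite -prodr_const -big_split; apply: eq_bigr => i _ /=; rewrite -mulrN expfzMl.
rewrite -pairprod_const /pairprod -big_split; apply: eq_bigr => x _ /=.
by rewrite -mulrN -mulrBr expfzMl.
Qed.

Lemma rhov_scale N c n (v : 'I_n -> rat) d (f : {mpoly rat[d]}) k (J : {set 'I_n}) : f \is k.-homog ->
  rhov m N c f (fun i => a * v i) J =
  a ^ (k%:Z + ((N%:Z - 1) * #|J|%:Z + (m%:Z - 1) * 'C(#|J|, 2)%:Z)) * rhov m N c f v J.
Proof.
move=> fk; rewrite /rhov [RHS]mulrCA; congr (_ * _); rewrite mulr_sumr; apply: eq_bigr => E _.
by rewrite flip_scale pts_scale (pev_scale _ _ fk) rhoterm_scale [in RHS]expfzDr // -exprnP mulrACA.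
Qed.

Lemma crossprod_scale n (v : 'I_n -> rat) (I J : {set 'I_n}) :
  crossprod (hker m (sqv (fun i => a * v i))) I J =
  a ^ (2 * ((m%:Z - 1) * (#|J| * #|I|)%N%:Z)) * crossprod (hker m (sqv v)) I J.
Proof.
have -> : 2 * ((m%:Z - 1) * (#|J| * #|I|)%N%:Z) = 2 * (m%:Z - 1) * #|J|%:Z * #|I|%:Z.
  by rewrite PoszM; ring.
rewrite /crossprod -[a ^ _]exprz_exp -[a ^ (_ * #|J|%:Z)]exprz_exp -!exprnP.
rewrite -prodr_const -big_split; apply: eq_bigr => i _ /=.
rewrite -prodr_const -big_split; apply: eq_bigr => j _ /=.
by rewrite /hker /sqv !exprMn -mulrBr expfzMl -[a ^ (2 * _)]exprz_exp.
Qed.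

Lemma ssum_scale d e (f : {mpoly rat[d]}) (g : {mpoly rat[e./2]}) k l
    (v : 'I_((d.*2 + e)./2) -> rat) : f \is k.-homog -> g \is l.-homog ->
  ssum s tau f g (fun i => a * v i) =
  a ^ (k%:Z + l%:Z + (star_exp s tau e * d%:Z + (m%:Z - 1) * ('C(d, 2)%:Z + 2 * (d * e./2)%N%:Z))) *
  ssum s tau f g v.
Proof.
move=> fk gl; rewrite /ssum mulr_sumr; apply: eq_bigr => J /eqP Jd.
have Je : #|~: J| = e./2.
  by have := cardsC J; rewrite [X in _ = X]card_ord Jd; move: #|~: J| => c; have := half_star d e; lia.
rewrite (rhov_scale _ _ _ _ fk) pts_scale (pev_scale _ _ gl) crossprod_scale Jd Je.
have E x y z r p c : x * r * (y * p) * (z * c) = x * y * z * (r * p * c) :> rat by ring.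
rewrite E [a ^+ l]exprnP -!(expfzDr _ _ a0); congr (_ ^ _ * _); rewrite star_expE; ring.
Qed.

End Scaling.

(** Scaling by 2 acts on the homogeneous components by distinct powers of 2, so at most one
    component survives. [z] is an integer since the kernels can have negative degree. *)
Lemma homog_of_scale n (p : {mpoly rat[n]}) (z : int) :
  (forall v, gen v -> p.@[fun i => 2 * v i] = 2 ^ z * p.@[v]) ->
  p = 0 \/ exists2 k : nat, p \is k.-homog & k%:Z = z.
Proof.
move=> pz; have pE := pihomog_partitionE (leqnn (mmeasure mdeg p)).
set K := mmeasure _ _ in pE; pose q k := pihomog mdeg k p.
have qh k : q k \is k.-homog by apply: pihomogP.
have qz k : k%:Z = z \/ q k = 0.
  have S0 : \sum_(d < K) (2 ^+ d - 2 ^ z) *: q d = 0.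
    apply: (meval_ext_generic (genpoly_neq0 n)) => v /genpolyP gv.
    rewrite meval0 raddf_sum /=.
    under eq_bigr do rewrite mevalZ mulrBl -(homog_scale _ _ (qh _)).
    rewrite sumrB -mulr_sumr -!(raddf_sum (meval _)) /= -pE pz // subrr //.
  have [kK|Kk] := ltnP k K; last first.
    right; rewrite /q pE linear_sum big1 // => d _.
    by apply: (pihomog_ne0 _ (qh d)); rewrite ltn_eqF // (leq_trans (ltn_ord d)).
  have : (2 ^+ k - 2 ^ z) *: q k = 0 :> {mpoly rat[n]}.
    have := congr1 (pihomog mdeg k) S0; rewrite linear0 linear_sum (bigD1 (Ordinal kK)) //=.
    rewrite linearZ /= (pihomog_dE (qh k)) big1 ?addr0 // => d dk.
    rewrite linearZ /= (pihomog_ne0 _ (qh d)) ?scaler0 //.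
  move/eqP; rewrite scaler_eq0 subr_eq0 => /orP[/eqP|/eqP]; last by right.
  by rewrite exprnP => /ieexprIz -> //; left.
have [p0|/eqP p0] := eqVneq p 0; first by left.
have [k qk] : exists k, q k <> 0.
  apply: contrapT => q0; apply: p0; rewrite pE big1 // => k _.
  by apply: contrapT => qk; apply: q0; exists k.
have kz : k%:Z = z by case: (qz k).
right; exists k => //; suff -> : p = q k by [].
rewrite pE (bigID (fun d : 'I_K => d == k :> nat)) /= [X in _ + X]big1 ?addr0 => [|d dk]; last first.
  by case: (qz d) => // dz; case/negP: dk; apply/eqP; apply: (can_inj absz_nat); rewrite dz kz.
have [kK|Kk] := ltnP k K; first by rewrite (big_pred1 (Ordinal kK)).
exfalso; apply: qk; rewrite /q pE linear_sum big1 // => d _.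
by apply: (pihomog_ne0 _ (qh d)); rewrite ltn_eqF // (leq_trans (ltn_ord d)).
Qed.

Lemma sum_single (U : nmodType) (F : nat -> U) B d : (d < B)%N ->
  (forall i, i <> d -> F i = 0) -> \sum_(i < B) F i = F d.
Proof.
move=> dB F0; rewrite (bigD1 (Ordinal dB)) // big1 => [|i di]; first exact: addr0.
by apply: F0 => E; case/eqP: di; apply/val_inj.
Qed.

Section StarModule.
Variables (m : nat) (s : int) (tau : 'I_m -> int).
Local Notation H := coha.
Local Notation M := (cohm s).
Local Notation "x ** y" := (hmul m x y) (at level 40, left associativity).
Local Notation "x ★ g" := (star tau x g) (at level 40, left associativity).

Lemma cohm_ext (g h : M) : (forall b : bool, admissible s b -> unsq b g = unsq b h) -> g = h.
Proof.
move=> gh; apply: dsumP => e; case: (boolP (admissible s e)) => ae; last first.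
  by rewrite (Md_nadm (g e)) // (Md_nadm (h e)).
have ab : admissible s (odd e) by move: ae; rewrite /admissible oddb.
apply: subr0_eq; rewrite -[LHS]/((g - h) e).
have E : unsq (odd e) (g - h) = 0 by rewrite linearB /= (gh _ ab) subrr.
have := congr1 (fun x : H => x e./2) E.
by move=> /(unsqc_eq0 (half_bit _ _)); rewrite addnC odd_double_half.
Qed.

Lemma unsq_dinj b e (w : Md s e) : unsq b (dinj (Md s) e w) =
  if odd e == b then dinj Hd e./2 (unsqc e./2 w) else 0.
Proof.
apply: dsumP => n; rewrite -[LHS]/(unsqc n (dinj (Md s) e w (n.*2 + b)%N)).
case: eqP => [eb|eb].
  have [<-|ne] := pselect (e./2 = n).
    have E : (e./2.*2 + b)%N = e by rewrite addnC -eb odd_double_half.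
    by rewrite E !dinjE.
  rewrite !dinj_neq ?unsqc0 ?half_bit // => E; apply: ne.
  by rewrite E half_bit.
rewrite dinj_neq ?unsqc0 ?half_bit // => E; apply: eb.
by rewrite E oddD odd_double oddb.
Qed.

Lemma star_linearl (g : M) : linear (fun x : H => x ★ g).
Proof.
move=> a x y; apply: cohm_ext => b _; apply: etrans (unsq_star tau b (a *: x + y) g) _.
rewrite (linearP (rhob s tau b)) (hmulDr m) (hmulZr m) (linearP (unsq b)) /=.
by congr (_ *: _ + _); apply: esym; apply: unsq_star.
Qed.

Lemma star_linearr (x : H) : linear (star tau x : M -> M).
Proof.
move=> a g h; apply: cohm_ext => b _; apply: etrans (unsq_star tau b x (a *: g + h)) _.
rewrite (linearP (unsq b)) (hmulDl m) (hmulZl m) (linearP (unsq b)) /=.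
by congr (_ *: _ + _); apply: esym; apply: unsq_star.
Qed.

Lemma star0l (g : M) : 0 ★ g = 0.
Proof. by have := star_linearl g (-1) 0 0; rewrite !scaleN1r !addNr. Qed.

Lemma star0r (x : H) : x ★ 0 = 0 :> M.
Proof. by have := star_linearr x (-1) 0 0; rewrite !scaleN1r !addNr. Qed.

Lemma starM (x y : H) (g : M) : (x ** y) ★ g = x ★ (y ★ g).
Proof. 
apply: cohm_ext => b _; apply: etrans (unsq_star tau b (x ** y) g) _.
by rewrite rhM (hmulA m); apply: esym; apply: etrans (unsq_star tau b x _) _; rewrite unsq_star.
 Qed.

Lemma star1 (g : M) : hone ★ g = g.
Proof. by apply: cohm_ext => b _; rewrite !unsq_star rh1 hmul1r. Qed.

Lemma star_dinj d e (f : Hd d) (g : Md s e) :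
  dinj Hd d f ★ dinj (Md s) e g = dinj (Md s) (d.*2 + e)%N (star_comp tau f g).
Proof.
have fB i : ((maxn d e).+1 <= i)%N -> dinj Hd d f i = 0.
  by move=> le; rewrite dinj_neq // => E; move: le; rewrite -E ltnNge leq_maxl.
have gB i : ((maxn d e).+1 <= i)%N -> dinj (Md s) e g i = 0.
  by move=> le; rewrite dinj_neq // => E; move: le; rewrite -E ltnNge leq_maxr.
have dB : (d < (maxn d e).+1)%N by rewrite ltnS leq_maxl.
have eB : (e < (maxn d e).+1)%N by rewrite ltnS leq_maxr.
rewrite (star_bound tau fB gB).
rewrite (sum_single (F := fun i => \sum_(j < _) dinj (Md s) (i.*2 + j)%N
  (star_comp tau (dinj Hd d f i) (dinj (Md s) e g j))) dB) => [|i di].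
  rewrite (sum_single (F := fun j => dinj (Md s) (d.*2 + j)%N
    (star_comp tau (dinj Hd d f d) (dinj (Md s) e g j))) eB) => [|j ej]; first by rewrite !dinjE.
  by rewrite [dinj (Md s) e g j]dinj_neq ?star_comp0r ?linear0 // => E; apply: ej.
rewrite big1 // => j _; rewrite [dinj Hd d f i]dinj_neq ?star_comp0l ?linear0 // => E; exact: di.
Qed.

(** [ssum_scale] gives the polynomial degree, and [Ecal_star] the shift. *)
Lemma star_hom (hs : s = 1 \/ s = -1) (htau : forall k : 'I_m, tau k = 1 \/ tau k = -1)
    d e D1 D2 (f : H) (g : Md s e) : coha_hom m d D1 f -> Md_hom tau e D2 g ->
  cohm_hom tau (d.*2 + e) (D1 + D2) (f ★ dinj (Md s) e g).
Proof.
have hom0 D : cohm_hom tau (d.*2 + e) D (0 : M) by exists 0; [left|rewrite linear0].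
case: (boolP (admissible s e)) => ae; last first.
  by move=> _ _; rewrite (Md_nadm g) // linear0 star0r.
move=> [p [->|[k [pk ->]]] ->]; first by rewrite linear0 star0l.
move=> [->|[l [gl ->]]].
  by rewrite linear0 star0r.
rewrite star_dinj; exists (star_comp tau p g) => //.
pose z := k%:Z + l%:Z + (star_exp s tau e * d%:Z + (m%:Z - 1) * ('C(d, 2)%:Z + 2 * (d * e./2)%N%:Z)).
have [v gv|p0|[n pn nz]] := @homog_of_scale _ (val (star_comp tau p g)) z.
- have g2v : gen (fun i => 2 * v i).
    split=> [i|i j]; first by rewrite mulf_neq0 // gv.1.
    by rewrite /sqv !exprMn => /(mulfI _) E; apply: gv.2; apply: E.
  by rewrite !star_comp_val //; apply: ssum_scale.
- by left; apply/val_inj.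
right; exists n; split=> //; rewrite (Ecal_star hs htau) // nz /z; ring.
Qed.

End StarModule.

Section Homogeneity.
Variable m : nat.
Local Notation H := coha.
Local Notation "x ** y" := (hmul m x y) (at level 40, left associativity).

Lemma ev_scale d k (p : Hd d) n (v : 'I_n -> rat) a (I : {set 'I_n}) : val p \is k.-homog ->
  ev (fun i => a * v i) (dinj Hd d p) I = a ^+ k * ev v (dinj Hd d p) I.
Proof.
move=> pk; rewrite /ev pts_scale; have [<-|dI] := pselect (d = #|I|).
  by rewrite dinjE; apply: pev_scale.
by rewrite dinj_neq // /pev /= !meval0 mulr0.
Qed.

Lemma hmul_hom d1 d2 D1 D2 x y : coha_hom m d1 D1 x -> coha_hom m d2 D2 y ->
  coha_hom m (d1 + d2) (D1 + D2) (x ** y).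
Proof.
have hom0 D : coha_hom m (d1 + d2) D 0 by exists 0; [left|rewrite linear0].
move=> [p [->|[k [pk ->]]] ->]; first by rewrite linear0 hmul0l.
move=> [q [->|[l [ql ->]]] ->]; first by rewrite linear0 hmul0r.
have xyd := hdeg_hmul m (hdeg_dinj p) (hdeg_dinj q).
set z := dinj Hd d1 p ** _ in xyd *; exists (z (d1 + d2)%N); last exact: hdegE.
have evz n (v : 'I_n -> rat) (I : {set 'I_n}) : injective v ->
    ev (fun i => 2 * v i) z I = 2 ^ (k%:Z + l%:Z + (m%:Z - 1) * (d1 * d2)%N%:Z) * ev v z I.
  move=> vI; have v2I : injective (fun i => 2 * v i) by move=> i j /mulfI E; apply/vI/E.
  rewrite /z !ev_hmul // /conv mulr_sumr; apply: eq_bigr => J JI.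
  rewrite (ev_scale _ _ _ pk) (ev_scale _ _ _ ql).
  have [J1|J1] := pselect (d1 = #|J|); last first.
    by rewrite [ev v (dinj Hd d1 p) J]/ev dinj_neq // /pev /= meval0 !(mulr0, mul0r).
  have [J2|J2] := pselect (d2 = #|I :\: J|); last first.
    by rewrite [ev v (dinj Hd d2 q) _]/ev dinj_neq // /pev /= meval0 !(mulr0, mul0r).
  have -> : crossprod (hker m (fun i => 2 * v i)) J (I :\: J) =
      2 ^ ((m%:Z - 1) * (d1 * d2)%N%:Z) * crossprod (hker m v) J (I :\: J).
    have -> : (m%:Z - 1) * (d1 * d2)%N%:Z = (m%:Z - 1) * #|I :\: J|%:Z * #|J|%:Z.
      by rewrite -J1 -J2 PoszM; ring.
    rewrite /crossprod -!exprz_exp -!exprnP.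
    rewrite -prodr_const -big_split; apply: eq_bigr => i _ /=.
    rewrite -prodr_const -big_split; apply: eq_bigr => j _ /=.
    by rewrite /hker -mulrBr expfzMl.
  have E a b c r s t : a * r * (b * s) * (c * t) = a * b * c * (r * s * t) :> rat by ring.
  by rewrite E !exprnP -!expfzDr.
have [v gv|z0|[n zn nE]] := @homog_of_scale _ (val (z (d1 + d2)%N)) (k%:Z + l%:Z + (m%:Z - 1) * (d1 * d2)%N%:Z).
- by rewrite -!evT evz // => i j e; apply: gv.2; rewrite /sqv e.
- by left; apply/val_inj.
by right; exists n; split=> //; rewrite nE /euler !PoszM !PoszD; ring.
Qed.

Lemma hone_hom : coha_hom m 0 0 hone.
Proof.
exists (insp (sympol1 0)) => //; right; exists 0%N; split; last by rewrite /euler muln0 !mulr0.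
exact: dhomog1.
Qed.

Variable Vprim : forall d, submodClosed (Hd d).

Lemma word_hom q : (forall v, v \in q -> homV Vprim v) -> exists d D, coha_hom m d D (wp m q).
Proof.
elim: q => [|v q IH] qV; first by exists 0%N, 0; apply: hone_hom.
have [|d [D qD]] := IH; first by move=> w wq; apply: qV; rewrite inE wq orbT.
have [_ [d' [n [p [d0 vE pn]]]]] := qV v (mem_head _ _).
exists (d' + d)%N, (2 * n%:Z + euler m d' d' + D); rewrite wp_cons; apply: hmul_hom => //.
by exists p => //; right; exists n.
Qed.

End Homogeneity.

Section DecomposablePart.
Variables (m : nat) (s : int) (tau : 'I_m -> int).
Local Notation H := coha.
Local Notation M := (cohm s).
Local Notation "x ★ g" := (star tau x g) (at level 40, left associativity).

Definition decM : set M := [set h | exists (f : H) (g : M), f 0%N = 0 /\ h = f ★ g]%classic.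

Definition decMhom a : set M := [set h | exists d e (f : Hd d) (g : Md s e),
  [/\ (0 < d)%N, (d.*2 + e)%N = a & h = dinj Hd d f ★ dinj (Md s) e g]]%classic.

(** The decomposable part is graded by [e], and its components come from factors with [d > 0]; this
    is what makes the induction in [allactions_span] descend. *)
Lemma decM_comp a (h : M) : h \in lspan decM -> dinj (Md s) a (h a) \in lspan (decMhom a).
Proof.
rewrite -dscale_delta; apply: (lspan_image (f := dscale _)) => _ [f [g [f0 ->]]].
have [B [fB gB]] := dsum_bound2 f g; rewrite (star_bound tau fB gB) linear_sum.
apply: rpred_sum => d _; rewrite linear_sum; apply: rpred_sum => e _.
set h' := dinj _ _ _; have h'd : hdeg (d.*2 + e)%N h' by apply: hdeg_dinj.
rewrite -[X in X \in _]/(dscale (fun i => (i == a)%:R) h') (dscale_hdeg _ h'd).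
case: eqP => [da|_]; last by rewrite scale0r rpred0.
rewrite scale1r; have [d0|d0] := posnP (d : nat).
  by rewrite /h' d0 f0 star_comp0l linear0 rpred0.
by apply: lspan_gen; exists (d : nat), (e : nat), (f d), (g e); split=> //; rewrite star_dinj.
Qed.

Lemma decMhom_decM a (h : M) : h \in lspan (decMhom a) -> h \in lspan decM.
Proof.
apply: lspan_sub => _ [d [e [f [g [d0 _ ->]]]]]; apply: lspan_gen.
by exists (dinj Hd d f), (dinj (Md s) e g); split=> //; rewrite dinj_neq // => E; rewrite E in d0.
Qed.

End DecomposablePart.

Section Spanning.
Variables (m : nat) (s : int) (tau : 'I_m -> int).
Hypotheses (hs : s = 1 \/ s = -1) (htau : forall k : 'I_m, tau k = 1 \/ tau k = -1).
Variables (Vprim : forall d, submodClosed (Hd d)) (W : forall e, submodClosed (Md s e)).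
Hypotheses (hV : primitive_generators m Vprim) (hW : forall e : nat, admissible s e ->
  graded_sub (Md_hom tau e) (W e) /\ complement (W e) (decomposable tau e)).
Local Notation H := coha.
Local Notation M := (cohm s).
Local Notation "x ** y" := (hmul m x y) (at level 40, left associativity).
Local Notation "x ★ g" := (star tau x g) (at level 40, left associativity).

Definition actions a D : set M := [set h | exists e (f : H) (w : Md s e) d D1 D2,
  [/\ f \in He s tau Vprim e, coha_hom m d D1 f, w \in W e, Md_hom tau e D2 w &
      [/\ a = (d.*2 + e)%N, D = D1 + D2 & h = f ★ dinj (Md s) e w]]]%classic.

Definition allactions : set M := [set h | exists a D, actions a D h]%classic.

Lemma actions_hom a D h : actions a D h -> cohm_hom tau a D h.
Proof. by move=> [e [f [w [d [D1 [D2 [_ fh _ wh [-> -> ->]]]]]]]]; apply: star_hom. Qed.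

Lemma star_word0 e (q : seq H) v (w : Md s e) : v \in q -> rhob s tau (odd e) v = 0 ->
  wp m q ★ dinj (Md s) e w = 0.
Proof.
move=> vq v0; apply: cohm_ext => b _; rewrite unsq_star unsq_dinj linear0.
case: eqP => [<-|_]; last exact: hmul0l.
suff -> : rhob s tau (odd e) (wp m q) = 0 by rewrite hmul0r.
elim: q vq => // v' q IH; rewrite inE wp_cons rhM => /orP[/eqP<-|/IH->].
  by rewrite v0 hmul0r.
by rewrite hmul0l.
Qed.

Lemma star_actions e h (w : Md s e) D2 : w \in W e -> Md_hom tau e D2 w ->
  h ★ dinj (Md s) e w \in lspan allactions.
Proof.
move=> wW wh; case: (boolP (admissible s e)) => ae; last first.
  by rewrite (Md_nadm w) // linear0 star0r rpred0.
have ab : admissible s (odd e) by move: ae; rewrite /admissible oddb.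
move: (word_span_homV hV h); move: h; apply: lspan_ind => [|a x y [q [qV ->]] IH].
  by rewrite star0l rpred0.
rewrite (star_linearl tau (dinj (Md s) e w) a (wp m q) y).
apply: rpredD; [apply: rpredZ|exact: IH].
have [qt|qt] := pselect (forall v, v \in q -> twist s tau (odd e) v = v); last first.
  have [v [vq vt]] : exists v, v \in q /\ twist s tau (odd e) v <> v.
    by apply: contrapT => nv; apply: qt => v vq; apply: contrapT => vt; apply: nv; exists v.
  rewrite (star_word0 _ vq) ?rpred0 //.
  have [_ [d [n [p [d0 vE pn]]]]] := qV v vq.
  have [vt'|vt'] := twist_homog s tau (odd e) pn; rewrite -vE in vt' => //.
  by rewrite vE; apply: (rho_antitwist hs htau ab); rewrite -vE.
have [d [D qD]] := word_hom m qV.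
apply: lspan_gen; exists (d.*2 + e)%N, (D + D2), e, (wp m q), w, d, D, D2; split=> //.
apply: (words_letter_He (b := odd e)) => // v vq; split; [by case: (qV v vq)| |exact: qt].
by have [_ [d' [n [p [d0 -> _]]]]] := qV v vq; exists d'; split=> //; apply: hdeg_dinj.
Qed.

Lemma star_allactions (x : H) (t : M) : t \in lspan allactions -> x ★ t \in lspan allactions.
Proof.
move: t; apply: lspan_ind => [|a t t' [a' [D [e [f [w [d [D1 [D2 [_ _ wW wh [_ _ ->]]]]]]]]]] IH].
  by rewrite star0r rpred0.
rewrite (star_linearr tau x); apply: rpredD; [apply: rpredZ|exact: IH].
by rewrite -starM; apply: star_actions wh.
Qed.

Lemma allactions_span (x : M) : x \in lspan allactions.
Proof.
suff S a (p : Md s a) : dinj (Md s) a p \in lspan allactions.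
  by have [B xB] := dsum_bound x; rewrite (dsum_decomp xB); apply: rpred_sum => a _; apply: S.
elim/ltn_ind: a p => a IH p; case: (boolP (admissible s a)) => aa; last first.
  by rewrite (Md_nadm p) // linear0 rpred0.
have [gr [_ /(_ p)[y [z [yW zd ->]]]]] := hW aa; rewrite linearD; apply: rpredD.
  have yS := gr y yW; move: y yS {yW}; apply: lspan_ind => [|c x' y [xW [D xD]] IHy]; first by rewrite linear0 rpred0.
  rewrite linearP; apply: rpredD; [apply: rpredZ|exact: IHy].
  by have := star_actions hone xW xD; rewrite star1.
rewrite -[X in X \in _]/(dinj (Md s) a z); have := decM_comp a zd; rewrite dinjE.
move: (dinj (Md s) a z); apply: lspan_ind => [|c x' t [d [e [f [g [d0 de ->]]]]] IHt].
  exact: rpred0.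
apply: rpredD => //; apply: rpredZ; apply: star_allactions; apply: IH.
by rewrite -de -addnn; lia.
Qed.

Lemma Md_hom_eq e (D : int) k (g : Md s e) : Md_hom tau e D g -> D = 2 * k%:Z + Ecal s tau e -> val g \is k.-homog.
Proof.
move=> [->|[n [gn ->]]] E; first exact: rpred0.
by have -> : k = n by lia.
Qed.

(** [g] is a combination of homogeneous actions of all bidegrees; those of the bidegree of [g]
    already add up to it. *)
Lemma actions_span a D (g : M) : cohm_hom tau a D g -> g \in lspan (actions a D).
Proof.
move=> [p [->|[k [pk DE]]] gE]; first by rewrite gE linear0 rpred0.
have /asboolP[n [c [h [hA gS]]]] := allactions_span g.
have [l lP] := choice (fun i => let: ex_intro a' (ex_intro D' aP) := hA i in
  ex_intro (fun l : nat * int => actions l.1 l.2 (h i)) (a', D') aP).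
suff -> : g = \sum_(i | l i == (a, D)) c i *: h i.
  apply: rpred_sum => i /eqP li; apply: rpredZ; apply: lspan_gen; have := lP i.
  by rewrite li.
apply: dsumP => j; have hj i : exists2 q, Md_hom tau (l i).1 (l i).2 q & h i = dinj (Md s) _ q.
  exact: actions_hom (lP i).
have [ja|ja] := pselect (a = j); last first.
  rewrite gE dinj_neq // dsum_sumE big1 // => i /eqP li; have [q _ ->] := hj i.
  by rewrite -[LHS]/(c i *: dinj (Md s) _ q j) dinj_neq ?scaler0 // li.
subst j; apply/val_inj; rewrite -[LHS](pihomog_dE (mf := mdeg) (d := k)); last by rewrite gE dinjE.
rewrite {1}gS !dsum_sumE !(raddf_sum val) linear_sum [RHS]big_mkcond; apply: eq_bigr => i _ /=.
transitivity (c i *: pihomog mdeg k (val (h i a))); first exact: linearZ.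
case: eqP => [li|li].
  have := hj i; rewrite li => -[q qh hE]; rewrite pihomog_dE // hE dinjE.
  exact: Md_hom_eq qh DE.
have [q qh hE] := hj i.
have [ea|na] := pselect ((l i).1 = a); last by rewrite hE dinj_neq // pihomog0 scaler0.
have lD : (l i).2 <> D by move=> E; apply: li; rewrite -ea -E; case: (l i).
move: (l i).1 (l i).2 q qh hE ea lD {li} => a' D' q qh hE ea lD; subst a'.
rewrite hE dinjE; case: qh => [->|[n' [qn D'E]]]; first by rewrite pihomog0 scaler0.
by rewrite (pihomog_ne0 _ qn) ?scaler0 //; apply/eqP => E; apply: lD; rewrite D'E E.
Qed.

End Spanning.

(** * Tensor products *)

Section Tensors.
Variables U W : lmodType rat.

Lemma tens_piD x y : (\pi_(lquot (@tens_rel U W)) (x + y) : tens U W) =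
  (\pi_(lquot (@tens_rel U W)) x : tens U W) + (\pi_(lquot (@tens_rel U W)) y : tens U W).
Proof. exact: lquot_piD. Qed.

Lemma tens_piZ a x : (\pi_(lquot (@tens_rel U W)) (a *: x) : tens U W) =
  a *: (\pi_(lquot (@tens_rel U W)) x : tens U W).
Proof. exact: lquot_piZ. Qed.

Lemma pureDl a (u u' : U) (w : W) : pure (a *: u + u') w = a *: pure u w + pure u' w.
Proof.
rewrite /pure -tens_piZ -tens_piD; apply/lquotP; apply: lspan_gen; left.
by exists a, u, u', w.
Qed.

Lemma pureDr a (u : U) (w w' : W) : pure u (a *: w + w') = a *: pure u w + pure u w'.
Proof.
rewrite /pure -tens_piZ -tens_piD; apply/lquotP; apply: lspan_gen; right.
by exists a, u, w, w'.
Qed.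

Lemma freemod_decomp (K : choiceType) (r : freemod K) :
  exists n (c : 'I_n -> rat) (k : 'I_n -> K), r = \sum_i c i *: fgen (k i).
Proof.
have /asboolP rfin := dsum_fin r; pose A := fset_set [set k | r k <> 0]%classic.
exists (size (enum_fset A)), (fun i => r (tnth (in_tuple (enum_fset A)) i)),
  (fun i => tnth (in_tuple (enum_fset A)) i).
rewrite -(big_tnth _ _ _ xpredT (fun k => r k *: fgen k)); apply: dsumP => k.
rewrite dsum_sumE; have kE j : (r j *: fgen j) k = if j == k then r k else 0.
  rewrite -[LHS]/(r j *: fgen j k); case: eqP => [->|jk]; last by rewrite /fgen dinj_neq // scaler0.
  by rewrite /fgen dinjE; apply: mulr1.
rewrite (eq_bigr _ (fun j _ => kE j)) -big_mkcond /=.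
have [kA|kA] := boolP (k \in enum_fset A).
  rewrite -big_filter filter_pred1_uniq ?big_seq1 //; exact: fset_uniq.
rewrite big1_seq => [|j /andP[/eqP-> jA]]; last by rewrite jA in kA.
apply: contrapT => rk; case/negP: kA; rewrite -/(k \in A) in_fset_set //; exact/mem_set.
Qed.

Lemma tens_sum (t : tens U W) : exists n (u : 'I_n -> U) (w : 'I_n -> W), t = \sum_i pure (u i) (w i).
Proof.
have pure0 a (u : U) (w : W) : a *: pure u w = pure (a *: u) w.
  have p0 : pure (0 : U) w = 0.
    by have := pureDl (-1) 0 0 w; rewrite !scaleN1r !addNr.
  by have := pureDl a u 0 w; rewrite addr0 p0 addr0.
have [n [c [k rE]]] := freemod_decomp (repr (t : lquot (@tens_rel U W))).
exists n, (fun i => c i *: (k i).1), (fun i => (k i).2).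
rewrite -[t]reprK [in LHS]rE; elim/big_rec2: _ => [|i y1 y2 _ <-].
  by have := tens_piZ 0 0; rewrite !scale0r.
by rewrite tens_piD tens_piZ -pure0 /pure -surjective_pairing.
Qed.

Lemma tens_ind (Q : tens U W -> Prop) : Q 0 -> (forall t t', Q t -> Q t' -> Q (t + t')) ->
  (forall u w, Q (pure u w)) -> forall t, Q t.
Proof.
move=> Q0 QD Qp t; have [n [u [w ->]]] := tens_sum t.
by elim/big_ind: _ => // i _; apply: Qp.
Qed.

(** If the [w i] are dependent, some [w j] is a combination of the others and bilinearity absorbs
    its term into theirs, so the number of terms drops. *)
Lemma tens_reduced (t : tens U W) : exists n (u : 'I_n -> U) (w : 'I_n -> W),
  t = \sum_i pure (u i) (w i) /\ forall a : 'I_n -> rat, \sum_i a i *: w i = 0 -> forall i, a i = 0.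
Proof.
have [n [u [w ->]]] := tens_sum t; elim: n u w => [|n IH] u w.
  by exists 0%N, u, w; split=> // a _ [].
have [ind|dep] := pselect (forall a : 'I_n.+1 -> rat, \sum_i a i *: w i = 0 -> forall i, a i = 0).
  by exists n.+1, u, w.
have [a [aw [j aj]]] : exists a : 'I_n.+1 -> rat, \sum_i a i *: w i = 0 /\ exists j, a j != 0.
  apply: contrapT => na; apply: dep => a aw i; apply/eqP; apply: contrapT => /negP ai.
  by apply: na; exists a; split=> //; exists i.
suff -> : \sum_i pure (u i) (w i) =
    \sum_i pure (- (a (lift j i) / a j) *: u j + u (lift j i)) (w (lift j i)) by apply: IH.
have wj : w j = \sum_i - (a (lift j i) / a j) *: w (lift j i).
  have wE : w j = (a j)^-1 *: (a j *: w j) by rewrite scalerA mulVf // scale1r.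
  move: aw; rewrite (bigD1_ord j) //= => /eqP; rewrite addr_eq0 => /eqP awj.
  rewrite wE awj scalerN scaler_sumr -sumrN; apply: eq_bigr => i _.
  by rewrite scalerA -scaleNr mulrC.
have pureS (I : finType) (x : U) (c : I -> rat) (y : I -> W) :
    pure x (\sum_i c i *: y i) = \sum_i c i *: pure x (y i).
  elim/big_rec2: _ => [|i y1 y2 _ <-]; last exact: pureDr.
  by have := pureDr (-1) x 0 0; rewrite !scaleN1r !addNr.
rewrite (bigD1_ord j) //= wj pureS -big_split; apply: eq_bigr => i _ /=.
by rewrite pureDl.
Qed.

End Tensors.

(** * The action map *)

Lemma lin_inj (X Y : lmodType rat) (f : X -> Y) : linear f -> (forall x, f x = 0 -> x = 0) -> injective f.
Proof.
move=> fl f0 x y xy; apply: subr0_eq; apply: f0.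
by rewrite addrC -scaleN1r fl xy scaleN1r addNr.
Qed.

Lemma lin_sum (X Y : lmodType rat) (f : X -> Y) n (F : 'I_n -> X) : linear f ->
  f (\sum_i F i) = \sum_i f (F i).
Proof. by move=> /linear_bundle[g gE]; rewrite -gE linear_sum; apply: eq_bigr => i _; apply: gE. Qed.

Lemma lin0 (X Y : lmodType rat) (f : X -> Y) : linear f -> f 0 = 0.
Proof. by move=> /linear_bundle[g gE]; rewrite -gE linear0. Qed.

Lemma sum_parity (X : nmodType) (F : nat -> X) (b : bool) B :
  (forall e, odd e != b -> F e = 0) -> \sum_(e < B.*2) F e = \sum_(c < B) F (c.*2 + b)%N.
Proof.
move=> F0; elim: B => [|B IH]; first by rewrite !big_ord0.
rewrite doubleS !big_ord_recr /= IH -addrA; congr (_ + _); case: b F0 {IH} => F0.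
  by rewrite F0 ?odd_double // add0r addn1.
by rewrite [X in _ + X]F0 /= ?odd_double // addr0 addn0.
Qed.

Section ActionMap.
Variables (m : nat) (s : int) (tau : 'I_m -> int).
Hypotheses (hs : s = 1 \/ s = -1) (htau : forall k : 'I_m, tau k = 1 \/ tau k = -1).
Variables (Vprim : forall d, submodClosed (Hd d)) (W : forall e, submodClosed (Md s e)).
Hypotheses (hV : primitive_generators m Vprim) (hW : forall e : nat, admissible s e ->
  graded_sub (Md_hom tau e) (W e) /\ complement (W e) (decomposable tau e)).
Local Notation H := coha.
Local Notation M := (cohm s).
Local Notation "x ** y" := (hmul m x y) (at level 40, left associativity).
Local Notation "x ★ g" := (star tau x g) (at level 40, left associativity).
Local Notation He e := (He s tau Vprim e).
Local Notation T e := (tens (subsp (He e)) (subsp (W e))).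
Local Notation act e := (action_map_at tau Vprim e (W e)).
Local Notation src := (action_source tau Vprim W).
Local Notation actm := (action_map tau Vprim W).

Lemma act_bilinear e :
  (forall w : subsp (W e), linear (fun f : subsp (He e) => val f ★ dinj (Md s) e (val w))) /\
  (forall f : subsp (He e), linear (fun w : subsp (W e) => val f ★ dinj (Md s) e (val w))).
Proof.
split=> [w a f g|f a w w']; first exact: star_linearl.
by rewrite -star_linearr -linearP.
Qed.

Lemma act_linear e : linear (act e).
Proof. by have [bl br] := act_bilinear e; apply: tens_lift_linear. Qed.

Lemma act_pure e f w : act e (pure f w) = val f ★ dinj (Md s) e (val w).
Proof. by have [bl br] := act_bilinear e; apply: tens_lift_pure. Qed.

Lemma actm_bound B (t : src) : (forall e, (B <= e)%N -> t e = 0) -> actm t = \sum_(e < B) act e (t e).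
Proof.
move=> tB; rewrite /action_map; apply: fsum_nat => e /tB->; exact: (lin0 (@act_linear e)).
Qed.

Lemma actm_linear : linear actm.
Proof.
move=> a t t'; have [B [tB t'B]] := dsum_bound2 t t'.
rewrite (actm_bound tB) (actm_bound t'B) (@actm_bound B) => [|e Be]; last first.
  by rewrite -[LHS]/(a *: t e + t' e) tB // t'B // scaler0 addr0.
rewrite scaler_sumr -big_split; apply: eq_bigr => e _ /=.
exact: act_linear.
Qed.

Lemma actm_dinj e (t : T e) : actm (dinj _ e t) = act e t.
Proof.
rewrite (@actm_bound e.+1) => [|i ei]; last by rewrite dinj_neq // => E; rewrite E ltnn in ei.
rewrite (sum_single (F := fun i => act i (dinj _ e t i)) (ltnSn e)) ?dinjE // => i ie.
by rewrite dinj_neq ?lin0 //; [apply: act_linear|move=> E; apply: ie].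
Qed.

Lemma unsq_surj (b : bool) (y : H) : admissible s b -> exists g : M, unsq b g = y.
Proof.
move=> ab; have [B yB] := dsum_bound y.
have ex c : exists g : Md s (c.*2 + b), unsqc c g = y c.
  by apply: unsqc_surj; rewrite ?half_bit // admissibleD.
pose g c := projT1 (cid (ex c)).
exists (\sum_(c < B) dinj (Md s) (c.*2 + b)%N (g c)); rewrite linear_sum (dsum_decomp yB).
apply: eq_bigr => c _; rewrite [LHS]unsq_dinj oddD odd_double oddb eqxx.
have gE : unsqc c (g c) = y c by rewrite /g; case: cid.
by move: (g c) gE; rewrite half_bit => gc ->.
Qed.

Lemma rhoideal_lift (b : bool) z : admissible s b -> z \in lspan (rhoideal s tau b) ->
  exists2 g : M, g \in lspan (decM tau) & unsq b g = z.
Proof.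
move=> ab; move: z; apply: lspan_ind => [|a _ z [y [f [f0 ->]]] [g gD gz]].
  by exists 0; rewrite ?rpred0 ?linear0.
have [h hy] := unsq_surj y ab; exists (a *: (f ★ h) + g).
  by apply: rpredD => //; apply: rpredZ; apply: lspan_gen; exists f, h.
by rewrite linearP -gz /= unsq_star hy.
Qed.

(** [z] lifts to a decomposable element of M, whose component of degree [e] is [y] and is
    decomposable as well. *)
Lemma rhoideal_decomposable (b : bool) e (y : Md s e) z : odd e = b -> admissible s b ->
  z \in lspan (rhoideal s tau b) -> unsq b (dinj (Md s) e y) = dinj Hd e./2 (z e./2) ->
  decomposable tau e y.
Proof.
move=> eb ab /(rhoideal_lift ab)[g gD <-]; rewrite unsq_dinj eb eqxx => /dinj_inj yg.
have E : (e./2.*2 + b)%N = e by rewrite addnC -eb odd_double_half.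
suff <- : g e = y by apply: decMhom_decM (decM_comp e gD).
apply: subr0_eq; apply: (unsqc_eq0 (erefl e./2)).
have tl := unsqc_is_linear (erefl e./2).
have gE n : (n.*2 + b)%N = e -> unsqc n (g e) = unsq b g n by move=> <-.
have -> : g e - y = (-1) *: y + g e by rewrite scaleN1r addrC.
apply: etrans (tl s (-1) y (g e)) _.
apply: etrans (congr2 (fun p q => (-1) *: p + q) yg (gE _ E)) _.
rewrite scaleN1r; exact: addNr.
Qed.

Lemma actm_kernel (t : src) : actm t = 0 -> t = 0.
Proof.
move=> t0; have [B tB] := dsum_bound t.
(* With independent second factors in every degree, it remains to show that the first factors
   vanish. *)
have red e : exists nuw : {n : nat & (('I_n -> subsp (He e)) * ('I_n -> subsp (W e)))%type},
    t e = \sum_i pure ((tagged nuw).1 i) ((tagged nuw).2 i) /\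
    forall a : 'I_(tag nuw) -> rat, \sum_i a i *: (tagged nuw).2 i = 0 -> forall i, a i = 0.
  have [n [u [w uw]]] := tens_reduced (t e).
  by exists (Tagged (fun n => (('I_n -> subsp (He e)) * ('I_n -> subsp (W e)))%type) (u, w)).
pose R e := projT1 (cid (red e)).
pose n e := tag (R e); pose u e : 'I_(n e) -> subsp (He e) := (tagged (R e)).1.
pose w e : 'I_(n e) -> subsp (W e) := (tagged (R e)).2.
have tE e : t e = \sum_i pure (u e i) (w e i) by rewrite /u /w /n /R; case: cid => ? [].
have wI e a : \sum_i a i *: w e i = 0 -> forall i, a i = 0.
  by move: a; rewrite /w /n /R; case: cid => ? [].
have actE e : act e (t e) = \sum_i val (u e i) ★ dinj (Md s) e (val (w e i)).
  rewrite tE lin_sum; last exact: act_linear.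
  by apply: eq_bigr => i _; apply: act_pure.
apply: dsumP => e; have [Be|eB] := leqP B e./2.
  by apply: tB; apply: leq_trans Be _; rewrite -{2}[e]odd_double_half -addnn addnA leq_addl.
rewrite -[RHS]/(0 : T e) tE big1 // => i _.
have pure0l (x : subsp (W e)) : pure (0 : subsp (He e)) x = 0.
  by have := pureDl (-1) (0 : subsp (He e)) 0 x; rewrite !scaleN1r !addNr.
have pure0r (x : subsp (He e)) : pure x (0 : subsp (W e)) = 0.
  by have := pureDr (-1) x (0 : subsp (W e)) 0; rewrite !scaleN1r !addNr.
case: (boolP (admissible s e)) => ae; last first.
  by have -> : w e i = 0; [apply/val_inj; apply: Md_nadm|apply: pure0r].
suff -> : u e i = 0 by apply: pure0l.
(* Only the summands whose index has the parity of [e] are seen by [unsq b]; the others go to 0. *)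
have [b eb] : exists b : bool, odd e = b by exists (odd e).
have ab : admissible s b by move: ae; rewrite /admissible -eb oddb.
have [P [Plin PE]] := length_proj hV.
have [Pl PlE] : exists Pl : nat -> {linear H -> H}, forall k x, Pl k x = P k x.
  have ex k : exists g : {linear H -> H}, forall x, g x = P k x.
    exact: (linear_bundle (Plin k)).
  by have [g gE] := choice ex; exists g.
have PlE' k q : inV Vprim q -> Pl k (wp m q) = if size q == k then wp m q else 0.
  by move=> qV; rewrite PlE PE.
pose w' c (j : 'I_(n (c.*2 + b)%N)) : H := unsq b (dinj (Md s) (c.*2 + b)%N (val (w _ j))).
pose f' c (j : 'I_(n (c.*2 + b)%N)) : H := val (u _ j).
have par c : odd (c.*2 + b) = b by rewrite oddD odd_double oddb.
have w'deg c j : hdeg c (w' c j).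
  by rewrite /w' unsq_dinj par eqxx half_bit; apply: hdeg_dinj.
(* Independence in [W] becomes independence modulo the span of [rhoideal], as [W] meets the
   decomposable part in 0. *)
have w'I c a z : z \in lspan (rhoideal s tau b) ->
    \sum_(j < n (c.*2 + b)%N) a j *: w' c j = dinj Hd c (z c) -> forall j, a j = 0.
  move=> zI az; apply: wI.
  have ac : admissible s (c.*2 + b) by rewrite admissibleD.
  have [_ [dis _]] := hW ac; apply/val_inj; apply: dis; first exact: valP.
  apply: (rhoideal_decomposable (par c) ab zI); rewrite half_bit -az.
  rewrite (raddf_sum val) linear_sum linear_sum; apply: eq_bigr => j _.
  transitivity (unsq b (a j *: dinj (Md s) (c.*2 + b)%N (val (w _ j)))); last exact: linearZ.
  by congr (unsq b _); rewrite -linearZ.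
have f'W c j : f' c j \in lspan (words m (letter s tau Vprim b)).
  exact: He_words (par c) (valP (u _ j)).
have tB2 k : (B.*2 <= k)%N -> t k = 0.
  by move=> Bk; apply: tB; apply: leq_trans Bk; rewrite -addnn leq_addr.
have sum0 : \sum_(c < B) \sum_(j < n (c.*2 + b)%N) w' c j ** rhob s tau b (f' c j) = 0.
  have := congr1 (unsq b) t0; rewrite (actm_bound tB2) linear0 linear_sum.
  rewrite (sum_parity (F := fun k => unsq b (act k (t k))) (b := b)) => [S0|k kb].
    rewrite -[RHS]S0; apply: eq_bigr => c _; rewrite actE linear_sum; apply: eq_bigr => j _.
    exact/esym/unsq_star.
  rewrite actE linear_sum big1 // => j _; apply: etrans (unsq_star tau b _ _) _.
  by rewrite unsq_dinj (negbTE kb) hmul0l.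
have := rho_action_inj hV hs htau ab PlE' w'deg w'I f'W sum0.
have E : (e./2.*2 + b)%N = e by rewrite addnC -eb odd_double_half.
move=> /(_ e./2); rewrite /f' E => /(_ i eB) ui0; exact/val_inj.
Qed.

End ActionMap.

Section ActionMapHom.
Variables (m : nat) (s : int) (tau : 'I_m -> int).
Hypotheses (hs : s = 1 \/ s = -1) (htau : forall k : 'I_m, tau k = 1 \/ tau k = -1).
Variables (Vprim : forall d, submodClosed (Hd d)) (W : forall e, submodClosed (Md s e)).
Hypotheses (hV : primitive_generators m Vprim) (hW : forall e : nat, admissible s e ->
  graded_sub (Md_hom tau e) (W e) /\ complement (W e) (decomposable tau e)).
Local Notation "x ★ g" := (star tau x g) (at level 40, left associativity).
Local Notation He e := (He s tau Vprim e).
Local Notation src := (action_source tau Vprim W).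
Local Notation actm := (action_map tau Vprim W).

Lemma cohm_hom_lin a D c (x y : cohm s) : cohm_hom tau a D x -> cohm_hom tau a D y ->
  cohm_hom tau a D (c *: x + y).
Proof.
move=> [p ph ->] [q qh ->]; exists (c *: p + q); last by rewrite linearP.
case: ph => [->|[k [pk DE]]]; first by rewrite scaler0 add0r.
right; exists k; split=> //; rewrite rpredD ?rpredZ //.
exact: Md_hom_eq qh DE.
Qed.

Lemma cohm_hom0 a D : cohm_hom tau a D (0 : cohm s).
Proof. by exists 0; [left|rewrite linear0]. Qed.

Lemma source_hom_act a D (t : src) : source_hom tau Vprim W a D t -> cohm_hom tau a D (actm t).
Proof.
move=> th; have [B tB] := dsum_bound t; rewrite (actm_bound tB).
have sum_hom n (F : 'I_n -> cohm s) : (forall i, cohm_hom tau a D (F i)) -> cohm_hom tau a D (\sum_i F i).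
  move=> Fh; elim/big_ind: _ => // [|x y xh yh]; first exact: cohm_hom0.
  by rewrite -[x]scale1r; apply: cohm_hom_lin.
apply: sum_hom => e; move: (t e) (th e) => te.
move: te; apply: lspan_ind => [|c x y [f [w [d [D1 [D2 [fh wh -> -> ->]]]]]] IH].
  by rewrite (lin0 (@act_linear m s tau Vprim W e)); apply: cohm_hom0.
rewrite (@act_linear m s tau Vprim W e); apply: cohm_hom_lin => //; rewrite act_pure.
exact: star_hom.
Qed.

Lemma actions_lift a D g : g \in lspan (actions tau Vprim W a D) ->
  exists2 t : src, source_hom tau Vprim W a D t & actm t = g.
Proof.
move: g; apply: lspan_ind => [|c x y [e [f [w [d [D1 [D2 [fH fh wW wh [aE DE ->]]]]]]]] [t th ty]].
  by exists 0; [move=> e; apply: rpred0|apply: (lin0 (@actm_linear m s tau Vprim W))].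
exists (c *: dinj (fun e => tens (subsp (He e)) (subsp (W e))) e (pure (insp fH) (insp wW)) + t).
  move=> e'; apply: rpredD; last exact: th.
  apply: rpredZ; have [<-|ee] := pselect (e = e'); last by rewrite dinj_neq // rpred0.
  by rewrite dinjE; apply: lspan_gen; exists (insp fH), (insp wW), d, D1, D2.
by rewrite (@actm_linear m s tau Vprim W) ty actm_dinj act_pure.
Qed.

Lemma actm_inj : injective actm.
Proof.
by apply: lin_inj => [|t]; [apply: actm_linear|apply: actm_kernel].
Qed.

Lemma actm_surj g : exists t, actm t = g.
Proof.
have := allactions_span hs htau hV hW g; move: g.
apply: lspan_ind => [|c x y [a [D aD]] [t' ty]].
  by exists 0; apply: (lin0 (@actm_linear m s tau Vprim W)).
have [t _ tx] := actions_lift (lspan_gen aD).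
by exists (c *: t + t'); rewrite (@actm_linear m s tau Vprim W) tx ty.
Qed.

(** A homogeneous image has a homogeneous preimage by [actions_span], and injectivity identifies it
    with [t]. *)
Lemma act_source_hom a D (t : src) : cohm_hom tau a D (actm t) -> source_hom tau Vprim W a D t.
Proof.
move=> /(actions_span hs htau hV hW)/actions_lift[t' t'h /actm_inj tt'].
by rewrite -tt'.
Qed.

Lemma act_free_act e f (t : tens (subsp (He e)) (subsp (W e))) :
  action_map_at tau Vprim e (W e) (free_act (W e) f t) = val f ★ action_map_at tau Vprim e (W e) t.
Proof.
have bl (w : subsp (W e)) : linear (fun g => pure (He_mul f g) w).
  move=> a g h; rewrite -pureDl; congr pure; apply/val_inj => /=.
  by rewrite (hmulDr m) (hmulZr m).
have br (g : subsp (He e)) : linear (fun w : subsp (W e) => pure (He_mul f g) w).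
  by move=> a w w'; rewrite -pureDr.
have fl : linear (free_act (W e) f) by apply: tens_lift_linear.
have al := @act_linear m s tau Vprim W e.
elim/tens_ind: t => [|t t' IH IH'|g w].
- by rewrite (lin0 fl) (lin0 al) star0r.
- rewrite -[t]scale1r fl !al scale1r IH IH' scale1r.
  by have := star_linearr tau (val f) 1 (action_map_at tau Vprim e (W e) t)
    (action_map_at tau Vprim e (W e) t'); rewrite !scale1r => ->.
by rewrite {1}/free_act (tens_lift_pure bl br) !act_pure /= starM.
Qed.

End ActionMapHom.

Theorem theorem2 (m : nat) (s : int) (tau : 'I_m -> int)
    (hs : s = 1 \/ s = -1) (htau : forall k : 'I_m, tau k = 1 \/ tau k = -1)
    (Vprim : forall d : nat, submodClosed (Hd d))
    (hV : primitive_generators m Vprim)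
    (W : forall e : nat, submodClosed (Md s e))
    (hW : forall e : nat, admissible s e ->
      graded_sub (Md_hom tau e) (W e) /\ complement (W e) (decomposable tau e)) :
  [/\ linear (action_map tau Vprim W),
      bijective (action_map tau Vprim W) &
      forall (a : nat) (D : int) (t : action_source tau Vprim W),
        source_hom tau Vprim W a D t <->
        cohm_hom tau a D (action_map tau Vprim W t)] /\
  (forall e : nat, admissible s e ->
    [/\ linear (action_map_at tau Vprim e (W e)),
        injective (action_map_at tau Vprim e (W e)) &
        forall (f : subsp (He s tau Vprim e))
               (t : tens (subsp (He s tau Vprim e)) (subsp (W e))),
          action_map_at tau Vprim e (W e) (free_act (W e) f t) =
          star tau (val f) (action_map_at tau Vprim e (W e) t)]).
Proof.
split.
  split; first exact: actm_linear.
    have [g gK] := choice (actm_surj hs htau hV hW).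
    by exists g => // t; apply: (actm_inj hs htau hV hW); rewrite gK.
  by move=> a D t; split; [apply: source_hom_act|apply: act_source_hom].
move=> e ae; split; [exact: act_linear| |exact: act_free_act].
(* The restriction to one summand is the action map composed with the inclusion of that summand. *)
move=> t t' tt'; apply: (@dinj_inj _ (fun e => tens (subsp (He s tau Vprim e)) (subsp (W e))) e).
by apply: (actm_inj hs htau hV hW); rewrite !actm_dinj.
Qed.
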